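(* Let $N\ge 2$ be an integer, $1<p<N$, $p'=\frac{p}{p-1}$ and $R\in(0,\infty]$. Then: (I) For $\gamma>0$: one has $\int_{B_R^N}\exp(\alpha|u|^{\gamma})\,V_p(|x|)\,dx<\infty$ for every $u\in\dot W^{1,p}_{0,\mathrm{rad}}(B_R^N)$ and every $\alpha>0$ if and only if $\gamma\le p'$. (II) For $\alpha\in\mathbb{R}$: $$T^{\mathrm{rad}}_{p,\alpha}:=\sup\left\{\int_{B_R^N}\exp(\alpha|u|^{p'})\,V_p(|x|)\,dx\ \middle|\ u\in\dot W^{1,p}_{0,\mathrm{rad}}(B_R^N),\ \|\nabla u\|_{L^p(B_R^N)}\le1\right\}<\infty$$ if and only if $\alpha\le\alpha_p:=p\,\omega_p^{\frac1{p-1}}$.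
   Context: $B_R^N$ is the open ball of radius $R$ centered at $0$ in $\mathbb{R}^N$, and $B_\infty^N=\mathbb{R}^N$. $\dot W^{1,p}_0(B_R^N)$ is the completion of $C_c^\infty(B_R^N)$ with respect to $\|\nabla(\cdot)\|_p$ (since $p<N$, identified via the Sobolev inequality with a space of functions in $L^{p^*}(B_R^N)$, $p^*=\frac{Np}{N-p}$); $\dot W^{1,p}_{0,\mathrm{rad}}(B_R^N)$ is its subspace of radial functions. For real $s>0$, $\omega_s:=\frac{2\pi^{s/2}}{\Gamma(s/2)}$. For $x\in B_R^N\setminus\{0\}$, $$V_p(|x|):=\left(\frac{\omega_p}{\omega_N}\right)^{p'}|x|^{-(N-1)p'}\exp\left[-\frac{p-1}{N-p}\,p\left(\frac{\omega_p}{\omega_N}\right)^{\frac1{p-1}}\left(|x|^{-\frac{N-p}{p-1}}-R^{-\frac{N-p}{p-1}}\right)\right],$$ with the convention $\infty^{-\frac{N-p}{p-1}}:=0$. *)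

(* Defs.v *)
From HB Require Import structures.
From mathcomp Require Import all_boot all_order all_algebra.
From mathcomp Require Import all_classical all_reals all_analysis.
Set Implicit Arguments.
Unset Strict Implicit.
Unset Printing Implicit Defensive.
Import Order.TTheory GRing.Theory Num.Def Num.Theory.
Import numFieldNormedType.Exports.
Local Open Scope classical_set_scope.
Local Open Scope ring_scope.

(* Points of R^N are row vectors.  The sigma-algebra is the one generated by
   the coordinates, that is, the Borel sigma-algebra of the usual topology. *)
Section measurable_rV.
Context {R : realType} (n : nat).

Let coors : 'I_n -> 'rV[R]_n -> measurableTypeR R := fun i x => x ord0 i.

Let rV_set0 : g_sigma_preimage coors set0.
Proof. exact: sigma_algebra0. Qed.

Let rV_setC A : g_sigma_preimage coors A -> g_sigma_preimage coors (~` A).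
Proof. exact: sigma_algebraC. Qed.

Let rV_bigcup (F : _^nat) : (forall i, g_sigma_preimage coors (F i)) ->
  g_sigma_preimage coors (\bigcup_i (F i)).
Proof. exact: sigma_algebra_bigcup. Qed.

HB.instance Definition _ := @isMeasurable.Build default_measure_display
  'rV[R]_n (g_sigma_preimage coors) rV_set0 rV_setC rV_bigcup.

End measurable_rV.

Lemma measurable_coord {R : realType} n (i : 'I_n) :
  measurable_fun setT ((fun x : 'rV[R]_n => x ord0 i) : _ -> measurableTypeR R).
Proof.
move=> _ A mA; rewrite setTI; apply: sub_sigma_algebra => /=.
rewrite -bigcup_seq/=; exists i => /=; first by rewrite mem_index_enum.
by exists A => //; rewrite setTI.
Qed.

Lemma measurable_fun_rV {R : realType} d (T : measurableType d) n
    (f : T -> 'rV[R]_n) :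
  (forall i, measurable_fun setT
    ((fun x => f x ord0 i) : _ -> measurableTypeR R)) ->
  measurable_fun setT f.
Proof.
move=> mf; apply: measurability => /=; first reflexivity.
move=> _ [B + <-]; rewrite -bigcup_seq/= => -[i _ [A mA <-]].
by have := mf i measurableT A mA; rewrite !setTI.
Qed.

(* [lebesgue_rV n] is the n-fold product of the Lebesgue measure of the line:
   the push-forward of [lebesgue_measure \x lebesgue_rV n.-1] by [cons_rV]. *)
Definition cons_rV {R : realType} n (x : measurableTypeR R * 'rV[R]_n) :
  'rV[R]_n.+1 := row_mx (x.1)%:M x.2 : 'rV[R]_(1 + n).

Lemma measurable_cons_rV {R : realType} n :
  measurable_fun setT (@cons_rV R n).
Proof.
apply: measurable_fun_rV => i; rewrite /cons_rV.
case: (unliftP ord0 i) => [j ->|->].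
- rewrite (_ : (fun _ => _) = (fun y : 'rV[R]_n => y ord0 j) \o snd).
    by apply: measurableT_comp; [exact: measurable_coord|exact: measurable_snd].
  apply/funext => x /=; rewrite (_ : lift ord0 j = rshift 1 j).
    by rewrite (@row_mxEr R 1 1 n).
  exact: val_inj.
- rewrite (_ : (fun _ => _) = fst); first exact: measurable_fst.
  apply/funext => x; rewrite (_ : ord0 = lshift n (ord0 : 'I_1)).
    by rewrite (@row_mxEl R 1 1 n) mxE eqxx mulr1n.
  exact: val_inj.
Qed.

Section cons_measure.
Context {R : realType} (n : nat).
Variable mu : {sigma_finite_measure set 'rV[R]_n -> \bar R}.

Definition cons_measure : set 'rV[R]_n.+1 -> \bar R :=
  pushforward (@lebesgue_measure R \x mu)%E (@cons_rV R n).

HB.instance Definition _ := Measure.copy cons_measure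
  (measure_function_pushforward__canonical__measure_function_Measure
     (@lebesgue_measure R \x mu)%E (@measurable_cons_rV R n)).

Let cons_measure_sigma_finite : sigma_finite setT cons_measure.
Proof.
have [F FT Foo] : sigma_finite setT (@lebesgue_measure R \x mu)%E.
  have /sigma_finiteP[F [TF ndF Foo]] :
    sigma_finite setT (@lebesgue_measure R) by exact: sigma_finiteT.
  have /sigma_finiteP[G [TG ndG Goo]] := sigma_finiteT mu.
  exists (fun k => F k `*` G k).
    rewrite -setXTT TF TG predeqE => -[x y]; split.
      move=> [/= [i _ Fix] [k _ Gky]]; exists (maxn i k) => //; split.
      - by move: x Fix; exact/subsetPset/ndF/leq_maxl.
      - by move: y Gky; exact/subsetPset/ndG/leq_maxr.
    by move=> [i _ []/= ? ?]; split; exists i.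
  move=> k; have [? ?] := Foo k; have [? ?] := Goo k.
  split; first exact: measurableX.
  by rewrite product_measure1E// lte_mul_pinfty// ge0_fin_numE.
pose unc (x : 'rV[R]_n.+1) : measurableTypeR R * 'rV[R]_n :=
  (x ord0 ord0, \row_j x ord0 (lift ord0 j)).
have uncK y : unc (cons_rV y) = y.
  case: y => a v; rewrite /unc /cons_rV; congr pair => /=.
    rewrite (_ : ord0 = lshift n (ord0 : 'I_1)); last exact: val_inj.
    by rewrite (@row_mxEl R 1 1 n) mxE eqxx mulr1n.
  apply/rowP => j; rewrite mxE (_ : lift ord0 j = rshift 1 j).
    by rewrite (@row_mxEr R 1 1 n).
  exact: val_inj.
have munc : measurable_fun setT unc.
  apply/measurable_fun_pairP; split; first exact: measurable_coord.
  apply: measurable_fun_rV => i.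
  rewrite (_ : (fun _ => _) = (fun x : 'rV[R]_n.+1 => x ord0 (lift ord0 i))).
    exact: measurable_coord.
  by apply/funext => x /=; rewrite mxE.
exists (fun k => unc @^-1` F k).
  by rewrite -preimage_bigcup -FT preimage_setT.
move=> k; have [mF Fk] := Foo k; split.
  by rewrite -[X in measurable X]setTI; exact: munc.
rewrite /cons_measure /pushforward.
rewrite (_ : _ @^-1` _ = F k)//.
by apply/seteqP; split => y /=; rewrite uncK.
Qed.

HB.instance Definition _ := Measure_isSigmaFinite.Build _ _ _ cons_measure
  cons_measure_sigma_finite.

End cons_measure.

Fixpoint lebesgue_rV {R : realType} n :
    {sigma_finite_measure set 'rV[R]_n -> \bar R} :=
  match n with
  | 0 => dirac (0 : 'rV[R]_0)
  | m.+1 => cons_measure (lebesgue_rV m)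
  end.

Section euclidean.
Context {R : realType} {N : nat}.
Implicit Types (x : 'rV[R]_N) (r : \bar R).

(* The norm [`|x|] of a row vector is the sup norm, hence [enorm]. *)
Definition enorm x : R := Num.sqrt (\sum_(i < N) x ord0 i ^+ 2).

(* [eball +oo] is the whole space. *)
Definition eball r : set 'rV[R]_N := [set x | ((enorm x)%:E < r)%E].

Definition partial (i : 'I_N) (f : 'rV[R]_N -> R) : 'rV[R]_N -> R :=
  fun x => 'D_(delta_mx ord0 i) f x.

Definition iter_partial (s : seq 'I_N) (f : 'rV[R]_N -> R) : 'rV[R]_N -> R :=
  foldr partial f s.

(* ['D_v f x] is a total function, so the existence of the partial derivatives
   has to be required separately. *)
Definition smooth (f : 'rV[R]_N -> R) : Prop :=
  forall s : seq 'I_N, continuous (iter_partial s f) /\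
    forall i x, derivable (iter_partial s f) x (delta_mx ord0 i).

Definition test_fun r (f : 'rV[R]_N -> R) : Prop :=
  let K := closure [set x | f x != 0] in
  [/\ smooth f, compact K & K `<=` eball r].

Definition grad (f : 'rV[R]_N -> R) : 'rV[R]_N -> 'rV[R]_N :=
  fun x => \row_i partial i f x.

Definition ball_norm r (q : R) (f : 'rV[R]_N -> R) : \bar R :=
  Lnorm (lebesgue_rV N) q%:E ((EFin \o f) \_ (eball r)).

End euclidean.

Section sobolev.
Context {R : realType} {N : nat}.
Variables (p : R) (r : \bar R).
Implicit Types (u : 'rV[R]_N -> R) (G : 'rV[R]_N -> 'rV[R]_N).

Definition sobolev_exponent : R := N%:R * p / (N%:R - p).

(* [phi] is a Cauchy sequence of test functions for the norm of the gradient,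
   and [u] is the function of L^{p*} to which the Sobolev inequality identifies
   its class in the completion. *)
Definition represents (phi : nat -> 'rV[R]_N -> R) u : Prop :=
  [/\ forall k, test_fun r (phi k),
      forall e : R, 0 < e -> exists k0, forall k l, (k0 <= k)%N -> (k0 <= l)%N ->
        (ball_norm r p (fun x => enorm (grad (phi k) x - grad (phi l) x)%R)
          <= e%:E)%E
    & ball_norm r sobolev_exponent (fun x => phi k x - u x) @[k --> \oo]
        --> 0%E].

(* Functions on the ball are total functions of which only the values in
   [eball r] matter, up to a negligible set. *)
Definition dotW0 u : Prop :=
  measurable_fun (eball r) u /\ exists phi, represents phi u.

(* The gradient is the continuous extension to the completion, with values in
   L^p, of the gradient of test functions. *)
Definition is_grad u G : Prop :=
  measurable_fun (eball r) G /\
  exists phi, represents phi u /\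
    (ball_norm r p (fun x => enorm (grad (phi k) x - G x)) @[k --> \oo]
       --> 0%E).

Definition radial u : Prop :=
  exists2 g : R -> R, measurable_fun setT g &
    {ae lebesgue_rV N, forall x, eball r x -> u x = g (enorm x)}.

Definition dotW0_rad u : Prop := dotW0 u /\ radial u.

End sobolev.

Section weight.
Context {R : realType}.
Implicit Types (p s : R) (r : \bar R).

Definition Gamma s : R :=
  \int[lebesgue_measure]_(t in `]0, +oo[) (t `^ (s - 1) * expR (- t)).

Definition omega s : R := 2 * pi `^ (s / 2) / Gamma (s / 2).

Definition conj_exp p : R := p / (p - 1).

(* The power of an extended real to a negative exponent, with the value 0 at
   [+oo] ([poweR] has value [+oo] there); [-oo] is irrelevant. *)
Definition neg_pow r (a : R) : R := if r is x%:E then x `^ a else 0.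

Definition V (N : nat) p r (t : R) : R :=
  let c := omega p / omega N%:R in
  let b := - ((N%:R - p) / (p - 1)) in
  c `^ conj_exp p * t `^ (- ((N%:R - 1) * conj_exp p)) *
  expR (- ((p - 1) / (N%:R - p) * p * c `^ (p - 1)^-1 *
           (t `^ b - neg_pow r b))).

Definition exp_integral (N : nat) p r (gamma alpha : R) (u : 'rV[R]_N -> R)
    : \bar R :=
  (\int[lebesgue_rV N]_(x in eball r)
    (expR (alpha * `|u x| `^ gamma) * V N p r (enorm x))%:E)%E.

Definition T_rad (N : nat) p r (alpha : R) : \bar R :=
  ereal_sup [set exp_integral p r (conj_exp p) alpha u | u in
    [set u : 'rV[R]_N -> R | dotW0_rad p r u /\
      exists G, is_grad p r u G /\
        (ball_norm r p (fun x => enorm (G x)) <= 1)%E]].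

Definition alpha_crit p : R := p * omega p `^ (p - 1)^-1.

End weight.

(* Main.v *)
(**
In polar coordinates the problem lives on a ray.  With [b = (N - p) / (p - 1)],
[T s = A (s^-b - R^-b)] and [A] the constant in the exponent of [V_p], the
integral of a radial function [u x = g |x|] is, up to a constant factor, the
integral over [0 < s < R] of [exp (alpha |g s|^gamma - T s) s^(-b-1)].  The
weight is chosen so that [A b = alpha_p / omega_N^(1/(p-1))], hence Hoelder's
inequality reads [alpha_p |g|^p' <= T] for functions of gradient norm at
most [1].

Upper bounds follow Moser.  Two points of the set where
[T - alpha |g|^p' <= n] almost saturate Hoelder's inequality, which confines
[T] to two intervals of length [O(n)]; summing [e^-n] times these lengths gives
a bound independent of [g].  The test functions approximating a radial [u]
need not be radial, so the estimate is applied along one ray on which they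
converge to [u] almost everywhere and carry at most their share of the energy.
The exponent [alpha_p] is reached by Fatou's lemma from smaller ones, and (I)
follows by subtracting a test function close to [u].

Sharpness in (II) is shown by smoothed truncations of [|x|^-b], linear in
[|x|^-b] over an interval of length [L] with [L] tending to infinity, and
sharpness in (I) by a smooth dyadic version of [|x|^-s] with
[b / gamma < s < (N - p) / p].
*)
Require Import Defs.
From mathcomp Require Import all_boot all_order all_algebra.
From mathcomp Require Import all_classical all_reals all_analysis.
From mathcomp Require Import measurable_realfun ring lra.
Set Implicit Arguments.
Unset Strict Implicit.
Unset Printing Implicit Defensive.
Import Order.TTheory GRing.Theory Num.Def Num.Theory.
Import numFieldNormedType.Exports.
Local Open Scope classical_set_scope.
Local Open Scope ring_scope.

(** * Polar coordinates *)

Section lebesgue_rV_integral.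
Context {R : realType}.
Notation mu := (@lebesgue_measure R).
Local Open Scope ereal_scope.

(** As a function of [T], the measure [s ^ (- b - 1)] ds is a multiple of Lebesgue measure, because
    (N - 1) (1 - p') = - b - 1. The radial problem is thus Moser's one-dimensional problem with p in
    the place of the dimension. At the critical exponent Hoelder's inequality alone bounds the
    integrand by 1 on an interval of infinite length, hence the need for a finer argument.

    An element of the completion is known only through test functions, which need not be radial, and
    [u] itself has no derivative to integrate. Averaging over rotations is avoided: the bound on a
    ray asks only for a bound on the energy along it, so one direction that carries at most its
    share for infinitely many indices suffices. Such a direction is found only up to a margin, so
    the estimate is proved with a loss [M < M']. Its constant does not depend on the exponent, which
    lets the loss tend to 0.

    The interval for s in (I) is nonempty exactly when gamma > p', because (N - p) / p = b / p'. *)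

Lemma ge0_integral_cons n (f : 'rV[R]_n.+1 -> \bar R) :
  measurable_fun setT f -> (forall x, 0 <= f x) ->
  \int[lebesgue_rV n.+1]_x f x =
  \int[mu]_x \int[lebesgue_rV n]_y f (cons_rV (x, y)).
Proof.
move=> mf f0.
have := @ge0_integral_pushforward _ _ _ _ R (@cons_rV R n)
  (@measurable_cons_rV R n) (mu \x lebesgue_rV n) setT f measurableT mf.
rewrite preimage_setT => E; rewrite [LHS]E//.
rewrite fubini_tonelli1//.
by apply: measurableT_comp => //; exact: measurable_cons_rV.
all: try by move=> *; exact: f0.
Qed.

(** [c] times the image of Lebesgue measure under multiplication by [c] agrees with Lebesgue measure
    on the intervals ]a, b], hence on all measurable sets. *)
Lemma ge0_integral_scale1 (c : R) (f : R -> \bar R) : (0 < c)%R ->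
  measurable_fun setT f -> (forall x, 0 <= f x) ->
  \int[mu]_x f (c * x)%R = (c^-1)%:E * \int[mu]_x f x.
Proof.
move=> c0 mf f0.
have mc : measurable_fun setT ( *%R c : measurableTypeR R -> measurableTypeR R).
  exact: mulrl_measurable.
pose nu0 := measure_function_pushforward__canonical__measure_function_Measure mu mc.
pose nu := mscale (NngNum (ltW c0)) nu0 : {measure set _ -> \bar R}.
have nuE A : measurable A -> mu A = nu A.
  apply: lebesgue_measure_unique => X [[a b] _ <-].
  change (mu `]a, b]%classic = c%:E * mu (( *%R c) @^-1` `]a, b]%classic)).
  have -> : ( *%R c) @^-1` `]a, b]%classic = `](c^-1 * a)%R, (c^-1 * b)%R]%classic; last first.
    rewrite !lebesgue_measure_itv/= !lte_fin ltr_pM2l ?invr_gt0//.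
    case: ifPn => ab; last by rewrite mule0.
    rewrite -!EFinB -EFinM -mulrBr mulrA divff ?mul1r// gt_eqF//.
  apply/seteqP; split => x /=; rewrite !in_itv/=.
    by rewrite ltr_pdivrMl// ler_pdivlMl//.
  by rewrite ltr_pdivrMl// ler_pdivlMl//.
rewrite [in RHS](@eq_measure_integral _ _ _ setT nu)//=; last first.
  by move=> A mA _; exact: nuE.
rewrite ge0_integral_mscale//= ge0_integral_pushforward// preimage_setT/=.
by rewrite muleA -EFinM mulVf ?mul1e// gt_eqF.
Qed.

Lemma measurable_scale_rV n :
  measurable_fun setT
    (fun z : measurableTypeR R * 'rV[R]_n => (z.1 *: z.2)%R).
Proof.
apply: measurable_fun_rV => i.
rewrite [X in measurable_fun _ X](_ : _ = (fun z : measurableTypeR R * 'rV[R]_n => z.1 * z.2 ord0 i)%R); last first.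
  by apply/funext => z; rewrite mxE.
apply: measurable_funM; first exact: measurable_fst.
exact: (measurableT_comp (@measurable_coord R n i) measurable_snd).
Qed.

Lemma ge0_integral_scale n (c : R) (f : 'rV[R]_n -> \bar R) : (0 < c)%R ->
  measurable_fun setT f -> (forall x, 0 <= f x) ->
  \int[lebesgue_rV n]_x f (c *: x)%R = (c^-1 ^+ n)%:E * \int[lebesgue_rV n]_x f x.
Proof.
move=> c0; elim: n f => [|n IH] f mf f0.
  rewrite expr0 mul1e; apply: eq_integral => x _; congr f.
  by apply/rowP => -[].
have msc m : measurable_fun setT (fun x : 'rV[R]_m => c *: x)%R.
  have H := measurableT_comp (@measurable_scale_rV m)
    (measurable_fun_pair (measurable_cst (c : measurableTypeR R))
       (@measurable_id _ 'rV[R]_m setT)).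
  exact: H.
have mfc : measurable_fun setT (fun x : measurableTypeR R * 'rV[R]_n => f (cons_rV x)).
  by apply: measurableT_comp => //; exact: measurable_cons_rV.
have mg : measurable_fun setT (fun x : measurableTypeR R => \int[lebesgue_rV n]_y f (cons_rV (x, y))).
  exact: (measurable_fun_fubini_tonelli_F _ mfc).
rewrite !ge0_integral_cons//; last exact: (measurableT_comp mf (msc _)).
pose g (x : R) := \int[lebesgue_rV n]_y f (cons_rV (x, y)).
have g0 x : 0 <= g x by apply: integral_ge0 => y _.
transitivity (\int[mu]_x ((c^-1 ^+ n)%:E * g (c * x)%R)).
  apply: eq_integral => x _; rewrite -IH//.
    apply: eq_integral => y _; congr f.
    rewrite /cons_rV/= (@scale_row_mx _ 1 1 n).
    by rewrite scale_scalar_mx.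
  apply: (measurableT_comp mfc
    (g := fun y : 'rV[R]_n => ((c * x)%R : measurableTypeR R, y))).
  by apply: measurable_fun_pair; [exact: measurable_cst|exact: measurable_id].
have mgc : measurable_fun setT (fun x : measurableTypeR R => g (c * x)%R).
  exact: (measurableT_comp mg (mulrl_measurable c)).
have cn : 0 <= (c^-1 ^+ n)%:E by rewrite lee_fin exprn_ge0// invr_ge0 ltW.
transitivity ((c^-1 ^+ n)%:E * \int[mu]_x g (c * x)%R).
  apply: (ge0_integralZl _ _ mgc) => // x _; exact: g0.
by rewrite (ge0_integral_scale1 c0 mg g0) muleA -EFinM exprSr.
Qed.

End lebesgue_rV_integral.

Section ge0_integral_cover.
Local Open Scope ereal_scope.

(** Carries bounds from compact intervals, where the fundamental theorem of calculus applies, over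
    to half-open or unbounded ones: the restrictions of [f] to the [D n] increase to its restriction
    to the union. *)
Lemma ge0_integral_bigcup_le d (T : measurableType d) (R : realType)
    (mu : {measure set T -> \bar R}) (D : (set T)^nat) (f : T -> \bar R) M :
  (forall n, measurable (D n)) -> {homo D : n m / (n <= m)%N >-> n `<=` m} ->
  measurable_fun (\bigcup_n D n) f -> (forall x, 0 <= f x) ->
  (forall n, \int[mu]_(x in D n) f x <= M) ->
  \int[mu]_(x in \bigcup_n D n) f x <= M.
Proof.
move=> mD ndD mf f0 fM.
have mDU : measurable (\bigcup_n D n) by exact: bigcup_measurable.
rewrite integral_mkcond.
have r0 E x : 0 <= (f \_ E) x by rewrite patchE; case: ifPn.
have -> : \int[mu]_x (f \_ (\bigcup_n D n)) x = \int[mu]_x limn (fun n => (f \_ (D n)) x).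
  apply: eq_integral => x _; apply/esym/cvg_lim => //.
  have [[k _ Dkx]|nDx] := pselect ((\bigcup_n D n) x).
    rewrite patchE mem_set; last by exists k.
    apply: cvg_near_cst; exists k => // n /= kn.
    by rewrite patchE mem_set//; exact: ndD kn _ _.
  rewrite patchE memNset//; apply: cvg_near_cst; apply: nearW => n.
  by rewrite patchE memNset// => Dnx; apply: nDx; exists n.
rewrite monotone_convergence//; last 2 first.
- move=> n; apply/(measurable_restrictT _ _).1 => //.
  by apply: measurable_funS mf => //; exact: bigcup_sup.
- move=> x _ m n mn; rewrite !patchE.
  case: ifPn => [|_]; last by case: ifPn.
  by rewrite inE => Dmx; rewrite mem_set//; exact: ndD mn _ _.
apply: lime_le.
  apply: ereal_nondecreasing_is_cvgn => m n mn; apply: ge0_le_integral => //.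
  - apply/(measurable_restrictT _ _).1 => //.
    by apply: measurable_funS mf => //; exact: bigcup_sup.
  - apply/(measurable_restrictT _ _).1 => //.
    by apply: measurable_funS mf => //; exact: bigcup_sup.
  - move=> x _; rewrite !patchE; case: ifPn => [|_]; last by case: ifPn.
    by rewrite inE => Dmx; rewrite mem_set//; exact: ndD mn _ _.
by apply: nearW => n; rewrite -integral_mkcond.
Qed.

End ge0_integral_cover.

(** * Integrals of powers *)

Section powR_integral.
Context {R : realType}.
Notation mu := (@lebesgue_measure R).

Lemma continuous_powR (a x : R) : 0 < x -> {for x, continuous (@powR R ^~ a)}.
Proof.
move=> x0; apply: differentiable_continuous; apply/derivable1_diffP.
by apply: derivable_powR; rewrite in_itv/= x0.
Qed.

Lemma integral_powR_itvcc (k x y : R) : k != 0 -> 0 < x -> x < y ->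
  (\int[mu]_(s in `[x, y]) (s `^ (k - 1))%:E = ((y `^ k - x `^ k) / k)%:E)%E.
Proof.
move=> k0 x0 xy.
have dF (s : R) : 0 < s -> is_derive s 1 (fun t => t `^ k / k) (s `^ (k - 1)).
  move=> s0; have -> : (fun t => t `^ k / k) = k^-1 \*: (@powR R ^~ k).
    by apply/funext => t /=; rewrite mulrC.
  have /(is_deriveZ k^-1) H := is_derive1_powR k s0.
  by apply: is_derive_eq; rewrite /GRing.scale/= mulrA mulVf// mul1r.
have cF s : 0 < s -> {for s, continuous (fun t => t `^ k / k)}.
  move=> s0; apply: differentiable_continuous; apply/derivable1_diffP.
  exact: (@ex_derive _ _ _ _ _ _ _ (dF s s0)).
rewrite (@continuous_FTC2 _ _ (fun t => t `^ k / k))//.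
- by rewrite -EFinB mulrBl.
- apply: continuous_in_subspaceT => s; rewrite inE/= in_itv/= => /andP[xs _].
  by apply: continuous_powR; exact: lt_le_trans xs.
- split.
  + move=> s; rewrite in_itv/= => /andP[xs _].
    exact: (@ex_derive _ _ _ _ _ _ _ (dF s (lt_trans x0 xs))).
  + by apply: cvg_at_right_filter; exact: cF.
  + by apply: cvg_at_left_filter; apply: cF; exact: lt_trans xy.
- move=> s; rewrite in_itv/= => /andP[xs _].
  rewrite derive1E; exact: (@derive_val _ _ _ _ _ _ _ (dF s (lt_trans x0 xs))).
Qed.

Lemma integral_powRy (b x : R) : 0 < b -> 0 < x ->
  (\int[mu]_(s in `[x, +oo[) (s `^ (- b - 1))%:E = (x `^ (- b) / b)%:E)%E.
Proof.
move=> b0 x0.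
have dF (s : R) : 0 < s -> is_derive s 1 (fun t => - (t `^ (- b) / b)) (s `^ (- b - 1)).
  move=> s0; have -> : (fun t => - (t `^ (- b) / b)) = (- b)^-1 \*: (@powR R ^~ (- b)).
    by apply/funext => t /=; rewrite mulrC /GRing.scale/= invrN mulNr.
  have /(is_deriveZ (- b)^-1) H := is_derive1_powR (- b) s0.
  by apply: is_derive_eq; rewrite /GRing.scale/= mulrA mulVf ?mul1r// oppr_eq0 gt_eqF.
have cF s : 0 < s -> {for s, continuous (fun t => - (t `^ (- b) / b))}.
  move=> s0; apply: differentiable_continuous; apply/derivable1_diffP.
  exact: (@ex_derive _ _ _ _ _ _ _ (dF s s0)).
rewrite (@ge0_continuous_FTC2y _ _ (fun t => - (t `^ (- b) / b)) _ 0)//.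
- by rewrite -EFinB sub0r opprK.
- by move=> s _; exact: powR_ge0.
- apply: continuous_in_subspaceT => s; rewrite inE/= in_itv/= andbT => xs.
  by apply: continuous_powR; exact: lt_le_trans xs.
- rewrite (_ : (fun t => _) = (fun t => (- b^-1) * (t `^ b)^-1)); last first.
    by apply/funext => t; rewrite powRN mulrC mulNr.
  rewrite -[X in _ --> X](mulr0 (- b^-1)); apply: cvgMr.
  apply/cvgrPdist_le => e e0; near=> t.
  have t0 : 0 < t by near: t; apply: nbhs_pinfty_gt; rewrite num_real.
  have te : e^-1 `^ b^-1 <= t by near: t; apply: nbhs_pinfty_ge; rewrite num_real.
  rewrite sub0r normrN gtr0_norm ?invr_gt0 ?powR_gt0//.
  rewrite invf_ple ?posrE ?powR_gt0//.
  have -> : e^-1 = (e^-1 `^ b^-1) `^ b.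
    by rewrite -powRrM mulVf ?gt_eqF// powRr1// invr_ge0 ltW.
  by apply: ge0_ler_powR; rewrite ?nnegrE ?powR_ge0 ?ltW.
- move=> s xs; exact: (@ex_derive _ _ _ _ _ _ _ (dF s (lt_trans x0 xs))).
- by apply: cvg_at_right_filter; exact: cF.
- move=> s; rewrite in_itv/= andbT => xs.
  rewrite derive1E; exact: (@derive_val _ _ _ _ _ _ _ (dF s (lt_trans x0 xs))).
Unshelve. all: by end_near. Qed.

Lemma le_integral_powR0 (k y : R) : 0 < k -> 0 < y ->
  (\int[mu]_(s in `]0%R, y]) (s `^ (k - 1))%:E <= (y `^ k / k)%:E)%E.
Proof.
move=> k0 y0.
(* The denominator starts at 2 so that the left end is strictly below [y], as the formula on a
   compact interval requires. *)
pose D n : set R := `[y / n.+2%:R, y]%classic.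
have yn n : 0 < y / n.+2%:R < y.
  by rewrite divr_gt0//= ltr_pdivrMr// ltr_pMr// ltr1n.
have -> : `]0%R, y]%classic = \bigcup_n D n.
  apply/seteqP; split => x /=; rewrite ?in_itv/=.
    move=> /andP[x0 xy]; exists (truncn (y / x)) => //.
    rewrite /D/= in_itv/= xy andbT.
    rewrite ler_pdivrMr// mulrC -ler_pdivrMr//; apply/ltW.
    by rewrite (lt_trans (truncnS_gt _))// ltr_nat.
  move=> [n _]; rewrite /D/= in_itv/= => /andP[yx ->]; rewrite andbT.
  by apply: lt_le_trans yx; case/andP: (yn n).
apply: ge0_integral_bigcup_le.
- by move=> n; exact: measurable_itv.
- move=> m n mn x /=; rewrite /D/= !in_itv/= => /andP[yx ->]; rewrite andbT.
  by apply: le_trans yx; rewrite ler_pM2l// lef_pV2 ?posrE// ler_nat !ltnS.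
- apply: measurable_funTS; apply/measurable_EFinP.
  exact: measurable_powR.
- by move=> x; rewrite lee_fin powR_ge0.
- move=> n; case/andP: (yn n) => yn0 yn1.
  rewrite integral_powR_itvcc ?gt_eqF// lee_fin ler_pM2r ?invr_gt0//.
  by rewrite lerBlDr lerDl powR_ge0.
Qed.

End powR_integral.

Section enorm_theory.
Context {R : realType} {N : nat}.
Implicit Types x y : 'rV[R]_N.

Lemma enorm_ge0 x : 0 <= enorm x.
Proof. exact: sqrtr_ge0. Qed.

Lemma enorm_sqr x : enorm x ^+ 2 = \sum_(i < N) x ord0 i ^+ 2.
Proof. by rewrite sqr_sqrtr// sumr_ge0// => i _; rewrite sqr_ge0. Qed.

Lemma enormZ (c : R) x : enorm (c *: x) = `|c| * enorm x.
Proof.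
rewrite /enorm -sqrtr_sqr -sqrtrM ?sqr_ge0// mulr_sumr.
by under eq_bigr do rewrite mxE exprMn.
Qed.

Lemma enorm0 : enorm (0 : 'rV[R]_N) = 0.
Proof. by rewrite -(scale0r (0 : 'rV[R]_N)) enormZ normr0 mul0r. Qed.

Lemma enorm_eq0 x : (enorm x == 0) = (x == 0).
Proof.
apply/idP/eqP => [|->]; last by rewrite enorm0.
rewrite -(eqrXn2 (n := 2))// ?enorm_ge0// enorm_sqr expr0n/=.
rewrite psumr_eq0 => [/allP h|i _]; last by rewrite sqr_ge0.
apply/rowP => i; rewrite mxE; apply/eqP; rewrite -sqrf_eq0.
by apply: h; rewrite mem_index_enum.
Qed.

Lemma enorm_gt0 x : (0 < enorm x) = (x != 0).
Proof. by rewrite lt0r enorm_ge0 andbT enorm_eq0. Qed.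

Lemma le_coord_enorm x i : `|x ord0 i| <= enorm x.
Proof.
rewrite -(ler_pXn2r (n := 2))// ?nnegrE ?enorm_ge0// enorm_sqr real_normK ?num_real//.
by rewrite (bigD1 i)//= lerDl sumr_ge0// => j _; rewrite sqr_ge0.
Qed.

Lemma measurable_enorm : measurable_fun setT (@enorm R N).
Proof.
apply: (@measurableT_comp _ _ _ _ _ _ (@Num.sqrt R)).
  by apply: continuous_measurable_fun; exact: sqrt_continuous.
apply: measurable_sum => i.
by apply: measurable_funX; exact: measurable_coord.
Qed.

Lemma measurable_eball (r : \bar R) : measurable (eball r : set 'rV[R]_N).
Proof.
have mE : measurable_fun setT (fun x : 'rV[R]_N => (enorm x)%:E).
  by apply/measurable_EFinP; exact: measurable_enorm.
by have := emeasurable_fun_infty_o measurableT mE r; rewrite setTI.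
Qed.

End enorm_theory.

(** The point lies in the hyperplane where the first coordinate vanishes. The dimension is positive:
    in dimension 0 the measure is the Dirac mass at 0. *)
Lemma lebesgue_rV_set0 {R : realType} n :
  lebesgue_rV n.+1 [set (0 : 'rV[R]_n.+1)] = 0%E.
Proof.
have m0 : measurable [set (0:R)] by exact: measurable_set1.
have mC : measurable ([set x : 'rV[R]_n.+1 | x ord0 ord0 = 0]).
  by have := @measurable_coord R n.+1 ord0 measurableT _ m0; rewrite setTI.
have C0 : lebesgue_rV n.+1 [set x : 'rV[R]_n.+1 | x ord0 ord0 = 0] = 0%E.
  change ((@lebesgue_measure R \x lebesgue_rV n)%E
    (@cons_rV R n @^-1` [set x : 'rV[R]_n.+1 | x ord0 ord0 = 0]) = 0%E).
  rewrite (_ : _ @^-1` _ = [set (0:R)] `*` setT).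
    rewrite product_measure1E// [X in (X * _)%E](_ : _ = 0%E) ?mul0e//.
    exact: lebesgue_measure_set1.
  have e0 (z : R * 'rV[R]_n) : cons_rV z ord0 ord0 = z.1.
    rewrite /cons_rV (_ : ord0 = lshift n (ord0 : 'I_1)); last exact: val_inj.
    by rewrite (@row_mxEl R 1 1 n) mxE eqxx mulr1n.
  by apply/seteqP; split => z /=; rewrite e0 => // -[].
apply: (subset_measure0 _ mC _ C0).
  rewrite (_ : [set 0] = @enorm R n.+1 @^-1` [set 0]).
    by have := @measurable_enorm R n.+1 measurableT _ m0; rewrite setTI.
  by apply/seteqP; split => x /= => [->|/eqP]; rewrite ?enorm0// enorm_eq0 => /eqP.
by move=> x /= ->; rewrite mxE.
Qed.

Section polar_coordinates.
Context {R : realType} {n : nat}.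
Notation mu := (@lebesgue_measure R).
Notation N := n.+1.
Notation lam := (@lebesgue_rV R N).
Local Open Scope ereal_scope.

(** Directions are parametrised by this ball with Lebesgue measure, [dir] being the projection to
    the sphere. This replaces a surface measure: integrals over the sphere are N times those over
    the ball. *)
Definition punctured_ball : set 'rV[R]_N := [set y | (0 < enorm y <= 1)%R].
Definition dir (y : 'rV[R]_N) : 'rV[R]_N := ((enorm y)^-1 *: y)%R.

Lemma measurable_punctured_ball : measurable punctured_ball.
Proof.
rewrite (_ : punctured_ball = @enorm R N @^-1` `]0%R, 1%R]%classic).
  rewrite -[X in measurable X]setTI.
  by apply: measurable_enorm => //; exact: measurable_itv.
by apply/seteqP; split => x /=; rewrite in_itv.
Qed.

Lemma enorm_dir y : (0 < enorm y)%R -> enorm (dir y) = 1%R.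
Proof. by move=> y0; rewrite /dir enormZ gtr0_norm ?invr_gt0// mulVf ?gt_eqF. Qed.

Lemma measurable_dir : measurable_fun setT dir.
Proof.
apply: measurable_fun_rV => i.
rewrite [X in measurable_fun _ X](_ : _ = (fun y => (enorm y) `^ (-1) * y ord0 i)%R); last first.
  by apply/funext => y; rewrite mxE powR_inv1// enorm_ge0.
apply: measurable_funM; last exact: measurable_coord.
exact: (measurableT_comp (@measurable_powR R (-1)) measurable_enorm).
Qed.

Variable f : 'rV[R]_N -> \bar R.
Hypothesis mf : measurable_fun setT f.
Hypothesis f0 : forall x, 0 <= f x.

(** Two kernels related by z = s y. Integrated in s, [K (y, s)] gives the integral of f along the
    direction [dir y], after replacing s by |y| s. Integrated in y, it gives the integral of
    [L (z, s)] in z. The integral of [L (z, s)] in s is f z times |z|^N times that of s^(-N-1) over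
    [|z|, +oo[, that is f z / N. *)
Let kR (y : 'rV[R]_N) (s : R) : R :=
  (\1_punctured_ball y * \1_(`]0%R, +oo[%classic : set R) s * (enorm y `^ N%:R * s `^ (N%:R - 1)))%R.
Let K (z : 'rV[R]_N * measurableTypeR R) : \bar R := (kR z.1 z.2)%:E * f (z.2 *: z.1)%R.
Let lR (z : 'rV[R]_N) (s : R) : R :=
  (\1_[set z : 'rV[R]_N * measurableTypeR R | (0 < enorm z.1 <= z.2)%R] (z, s) * (enorm z `^ N%:R * s `^ (- N%:R - 1)))%R.
Let L (z : 'rV[R]_N * measurableTypeR R) : \bar R := (lR z.1 z.2)%:E * f z.1.

Let menorm1 : measurable_fun setT (fun z : 'rV[R]_N * measurableTypeR R => enorm z.1 : R).
Proof. exact: (measurableT_comp measurable_enorm measurable_fst). Qed.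

Let mK : measurable_fun setT K.
Proof.
apply: emeasurable_funM; last first.
  apply: measurableT_comp => //.
  apply: (measurableT_comp (@measurable_scale_rV R N)
   (g := fun z : 'rV[R]_N * measurableTypeR R => (z.2, z.1))).
  by apply: measurable_fun_pair; [exact: measurable_snd|exact: measurable_fst].
apply/measurable_EFinP; apply: measurable_funM; apply: measurable_funM.
- have H : measurable_fun setT (\1_punctured_ball : 'rV[R]_N -> R).
    by apply: measurable_indic; exact: measurable_punctured_ball.
  exact: (measurableT_comp H measurable_fst).
- have H : measurable_fun setT (\1_(`]0%R, +oo[%classic : set R) : R -> R).
    exact: measurable_indic.
  exact: (measurableT_comp H measurable_snd).
- exact: (measurableT_comp (measurable_powR _) menorm1).
- exact: (measurableT_comp (measurable_powR _) measurable_snd).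
Qed.

Let mL : measurable_fun setT L.
Proof.
apply: emeasurable_funM; last exact: (measurableT_comp mf measurable_fst).
apply/measurable_EFinP; apply: measurable_funM; last apply: measurable_funM.
- rewrite (_ : (fun z => _) = \1_[set z : 'rV[R]_N * measurableTypeR R | (0 < enorm z.1 <= z.2)%R]).
    apply: measurable_indic.
    have m1 : measurable_fun setT (fun z : 'rV[R]_N * measurableTypeR R => (0 < enorm z.1)%R).
      by apply: measurable_fun_ltr => //; exact: menorm1.
    have m2 : measurable_fun setT (fun z : 'rV[R]_N * measurableTypeR R => (enorm z.1 <= z.2)%R).
      by apply: measurable_fun_ler; [exact: menorm1|exact: measurable_snd].
    have mt : measurable [set true] by [].
    have := measurable_and m1 m2 measurableT mt.
    rewrite setTI; congr measurable; by apply/seteqP; split => z /=; [move->|].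
  by apply/funext => -[].
- exact: (measurableT_comp (measurable_powR _) menorm1).
- exact: (measurableT_comp (measurable_powR _) measurable_snd).
Qed.

Let kR_ge0 y s : (0 <= kR y s)%R.
Proof. by rewrite /kR !mulr_ge0 ?powR_ge0// indicE. Qed.
Let lR_ge0 y s : (0 <= lR y s)%R.
Proof. by rewrite /lR !mulr_ge0 ?powR_ge0// indicE. Qed.
Let K0 z : 0 <= K z.
Proof. by rewrite mule_ge0// lee_fin. Qed.
Let L0 z : 0 <= L z.
Proof. by rewrite mule_ge0// lee_fin. Qed.

Lemma measurable_ray (y : 'rV[R]_N) :
  measurable_fun setT (fun s : R => s *: y)%R.
Proof.
apply: measurable_fun_rV => i.
rewrite [X in measurable_fun _ X](_ : _ = (fun s => s * y ord0 i)%R); last first.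
  by apply/funext => s; rewrite mxE.
exact: mulrr_measurable.
Qed.

Let step1 y : punctured_ball y ->
  \int[mu]_(s in `]0%R, +oo[) ((s `^ (N%:R - 1))%:E * f (s *: dir y)%R) =
  \int[mu]_s K (y, s).
Proof.
move=> Ay; have [y0 y1] := andP Ay.
pose h (s : R) : \bar R := (\1_(`]0%R, +oo[%classic : set R) s * s `^ (N%:R - 1))%R%:E * f (s *: dir y)%R.
have mh : measurable_fun setT h.
  apply: emeasurable_funM; last exact: (measurableT_comp mf (measurable_ray _)).
  apply/measurable_EFinP; apply: measurable_funM; last exact: measurable_powR.
  exact: measurable_indic.
have h0 s : 0 <= h s.
  by rewrite mule_ge0// lee_fin mulr_ge0 ?powR_ge0// indicE.
transitivity (\int[mu]_s h s).
  rewrite [LHS]integral_mkcond; apply: eq_integral => s _.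
  by rewrite patchE /h indicE; case: (s \in _); rewrite ?mul1r// mul0r mul0e.
have E := ge0_integral_scale1 y0 mh h0.
have -> : \int[mu]_s h s = (enorm y)%:E * \int[mu]_s h (enorm y * s)%R.
  by rewrite E muleA -EFinM divff ?mul1e// gt_eqF.
rewrite -(@ge0_integralZl _ _ R mu setT measurableT (fun s => h (enorm y * s)%R) _ (enorm y)%:E)//; last 2 first.
- exact: (measurableT_comp mh (mulrl_measurable _)).
- by rewrite lee_fin ltW.
apply: eq_integral => s _; rewrite /h /K muleA /kR /dir/=; congr (_ * f _); last first.
  by rewrite scalerA mulrAC divff ?mul1r// gt_eqF.
rewrite -EFinM; congr EFin; rewrite !indicE (mem_set Ay) mul1r.
rewrite !mem_setE !in_itv/= !andbT pmulr_rgt0//.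
have [s0|s0] := ltP 0%R s; last by rewrite !mul0r mulr0.
rewrite !mul1r powRM ?ltW// mulrA; congr (_ * _)%R.
by rewrite mulr_powRB1 ?ltW.
Qed.

Let step2 s : \int[lam]_y K (y, s) = \int[lam]_z L (z, s).
Proof.
have [s0|s0] := ltP 0%R s; last first.
  rewrite !integral0_eq// => y _; rewrite /K /L /kR /lR/= !indicE.
    rewrite memNset ?mul0r ?mul0e//= => /andP[a b].
    by have := lt_le_trans (lt_le_trans a b) s0; rewrite ltxx.
  by rewrite [s \in _]memNset/= ?mulr0 ?mul0r ?mul0e//= in_itv/= andbT ltNge s0.
have mLs : measurable_fun setT (fun z => L (z, s)).
  by apply: (measurableT_comp mL); apply: measurable_fun_pair; [exact: measurable_id|exact: measurable_cst].
have -> : \int[lam]_z L (z, s) = (s ^+ N)%:E * \int[lam]_z L (s *: z, s)%R.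
  rewrite (ge0_integral_scale s0 mLs (fun z => L0 (z, s))) muleA -EFinM.
  by rewrite exprVn divff ?mul1e// expf_neq0// gt_eqF.
have mLss : measurable_fun setT (fun z : 'rV[R]_N => L (s *: z, s)%R).
  apply: (measurableT_comp mLs).
  apply: (measurableT_comp (@measurable_scale_rV R N) (g := fun z : 'rV[R]_N => (s : measurableTypeR R, z))).
  by apply: measurable_fun_pair; [exact: measurable_cst|exact: measurable_id].
have sN0 : 0 <= (s ^+ N)%:E by rewrite lee_fin exprn_ge0// ltW.
rewrite -(ge0_integralZl lam measurableT mLss (fun z _ => L0 (s *: z, s)%R) sN0).
apply: eq_integral => y _; rewrite /K /L muleA -EFinM; congr (_%:E * _)%E.
rewrite /kR /lR/= !indicE.
rewrite [s \in _]mem_set/= ?in_itv/= ?s0// mulr1.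
have -> : ((s *: y, s)%R \in [set z : 'rV[R]_N * measurableTypeR R | (0 < enorm z.1 <= z.2)%R]) = (y \in punctured_ball).
  apply/idP/idP; rewrite !inE /punctured_ball/= enormZ gtr0_norm// => /andP[].
    by rewrite pmulr_rgt0// => ->/=; rewrite -[leRHS]mulr1 ler_pM2l.
  by move=> y0 h /=; rewrite pmulr_rgt0//= y0/= -[leRHS]mulr1 ler_pM2l.
rewrite enormZ gtr0_norm// powRM ?enorm_ge0 ?ltW//.
have -> : (s `^ (N%:R - 1) = s ^+ N * (s `^ N%:R * s `^ (- N%:R - 1)))%R.
  have sD (a b : R) : (s `^ (a + b) = s `^ a * s `^ b)%R.
    by apply: powRD; rewrite (gt_eqF s0) implybT.
  by rewrite -powR_mulrn ?ltW// -!sD; congr powR; ring.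
by rewrite [RHS]mulrCA; congr (_ * _)%R; rewrite [LHS]mulrCA; congr (_ * _)%R; rewrite mulrCA mulrA.
Qed.

Let step3 z : z != 0%R -> \int[mu]_s L (z, s) = (N%:R^-1)%:E * f z.
Proof.
rewrite -enorm_gt0 => z0.
pose g (s : R) : \bar R := ((\1_(`[enorm z, +oo[%classic : set R) s * s `^ (- N%:R - 1))%R)%:E.
have mg : measurable_fun setT g.
  apply/measurable_EFinP; apply: measurable_funM; last exact: measurable_powR.
  exact: measurable_indic.
have g0 s : 0 <= g s by rewrite lee_fin mulr_ge0 ?powR_ge0// indicE.
transitivity (\int[mu]_s ((enorm z `^ N%:R)%:E * f z * g s)).
  apply: eq_integral => s _; rewrite /L /lR/= muleAC -EFinM muleC muleC; congr (_%:E * _).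
  rewrite !indicE mulrCA; congr (_ * (_ * _))%R.
  congr ((nat_of_bool _)%:R)%R; apply/idP/idP; rewrite !inE/= in_itv/= andbT z0//.
rewrite ge0_integralZl//; last by rewrite mule_ge0// lee_fin powR_ge0.
have -> : \int[mu]_s g s = (enorm z `^ (- N%:R) / N%:R)%:E.
  rewrite -(@integral_powRy R N%:R)// [RHS]integral_mkcond; apply: eq_integral => s _.
  by rewrite patchE /g indicE; case: (s \in _); rewrite ?mul1r// mul0r.
rewrite muleAC -EFinM mulrA powRN divff ?mul1r//.
by rewrite gt_eqF// powR_gt0.
Qed.

Theorem ge0_integral_polar :
  \int[lam]_x f x = N%:R%:E *
  \int[lam]_(y in punctured_ball)
     \int[mu]_(s in `]0%R, +oo[) ((s `^ (N%:R - 1))%:E * f (s *: dir y)%R).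
Proof.
have -> : \int[lam]_(y in punctured_ball)
    \int[mu]_(s in `]0%R, +oo[) ((s `^ (N%:R - 1))%:E * f (s *: dir y)%R) =
    \int[lam]_y \int[mu]_s K (y, s).
  rewrite integral_mkcond; apply: eq_integral => y _; rewrite patchE.
  case: ifPn => [|yA]; first by rewrite inE => /step1.
  rewrite integral0_eq// => s _; rewrite /K /kR/= indicE (negbTE yA).
  by rewrite !mul0r mul0e.
rewrite (@fubini_tonelli _ _ _ _ R lam mu K mK K0).
rewrite [X in (_ * X)%E](_ : _ = \int[mu]_s \int[lam]_z L (z, s)); last first.
  by apply: eq_integral => s _; exact: step2.
rewrite -(@fubini_tonelli _ _ _ _ R lam mu L mL L0).
(* At z = 0 the kernel [L] vanishes whatever f is, so the identity is used off a null set only. *)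
have -> : \int[lam]_z \int[mu]_s L (z, s) = \int[lam]_z ((N%:R^-1)%:E * f z).
  apply: ge0_ae_eq_integral => //.
  - exact: (measurable_fun_fubini_tonelli_F _ mL).
  - exact: measurable_funeM.
  - by move=> z _; exact: integral_ge0.
  - by move=> z _; rewrite mule_ge0// lee_fin invr_ge0.
  - exists [set 0%R]; split => //.
    + rewrite (_ : [set 0%R] = @enorm R N @^-1` [set 0%R]).
        by have := @measurable_enorm R N measurableT _ (measurable_set1 0%R); rewrite setTI.
      by apply/seteqP; split => x /= => [->|/eqP]; rewrite ?enorm0// enorm_eq0 => /eqP.
    + exact: lebesgue_rV_set0.
    + move=> z /=; apply: contra_notP => /eqP z0 _; exact: step3.
rewrite ge0_integralZl// ?lee_fin ?invr_ge0//.
by rewrite muleA -EFinM divff ?mul1e// pnatr_eq0.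
Qed.

End polar_coordinates.

(** * The Gamma function and the area of the sphere *)

Section Gamma_theory.
Context {R : realType}.
Notation mu := (@lebesgue_measure R).

(** Substitution is available on compact intervals: [1/(n+1), n+1] and its image under squaring both
    exhaust the half-line, and each of the two inequalities bounds one family by the full integral
    of the other side. *)
Lemma ge0_integral_sqr_subst (G : R -> R) :
  (forall x, 0 < x -> {for x, continuous G}) -> (forall x, 0 <= G x) ->
  measurable_fun setT G ->
  (\int[mu]_(x in `]0%R, +oo[) (G x)%:E =
   \int[mu]_(x in `]0%R, +oo[) (2 * x * G (x ^+ 2))%:E)%E.
Proof.
move=> cG G0 mG.
pose D (n : nat) : set R := `[n.+1%:R^-1, n.+1%:R]%classic.
pose D2 (n : nat) : set R := `[n.+1%:R^-1 ^+ 2, n.+1%:R ^+ 2]%classic.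
have D0 n x : D n x -> 0 < x.
  by rewrite /D/= in_itv/= => /andP[+ _]; apply: lt_le_trans; rewrite invr_gt0.
have D20 n x : D2 n x -> 0 < x.
  by rewrite /D2/= in_itv/= => /andP[+ _]; apply: lt_le_trans; rewrite exprn_gt0// invr_gt0.
have leDn (m n : nat) : (m <= n)%N -> m.+1%:R <= n.+1%:R :> R by rewrite ler_nat ltnS.
have geDn (m n : nat) : (m <= n)%N -> n.+1%:R^-1 <= m.+1%:R^-1 :> R.
  by move=> mn; rewrite lef_pV2 ?posrE// leDn.
have UD : \bigcup_n D n = `]0%R, +oo[%classic.
  apply/seteqP; split => x.
    by move=> [n _ /D0]; rewrite /= in_itv/= andbT.
  rewrite /= in_itv/= andbT => x0.
  exists (truncn (Num.max x x^-1)) => //; rewrite /D/= in_itv/=.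
  have := truncnS_gt (Num.max x x^-1); rewrite gt_max => /andP[xn xVn].
  by rewrite (ltW xn) andbT -[leRHS]invrK lef_pV2 ?posrE ?invr_gt0// ltW.
have UD2 : \bigcup_n D2 n = `]0%R, +oo[%classic.
  apply/seteqP; split => x.
    by move=> [n _ /D20]; rewrite /= in_itv/= andbT.
  rewrite -UD => -[n _ Dn]; exists n => //; move: Dn (D0 _ _ Dn).
  rewrite /D /D2/= !in_itv/= => /andP[nx xn] x0; apply/andP; split.
    have n1 : n.+1%:R^-1 <= 1 :> R by rewrite invf_le1// ler1n.
    by apply: le_trans nx; rewrite expr2 ler_piMl// invr_ge0.
  by apply: le_trans xn _; rewrite expr2 ler_peMl// ler1n.
have ndD : {homo D : n m / (n <= m)%N >-> n `<=` m}.
  move=> m n mn x; rewrite /D/= !in_itv/= => /andP[a b]; apply/andP; split.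
    exact: le_trans (geDn _ _ mn) a.
  exact: le_trans b (leDn _ _ mn).
have ndD2 : {homo D2 : n m / (n <= m)%N >-> n `<=` m}.
  move=> m n mn x; rewrite /D2/= !in_itv/= => /andP[a b]; apply/andP; split.
    by apply: le_trans a; rewrite ler_pXn2r ?nnegrE ?invr_ge0// geDn.
  by apply: le_trans b _; rewrite ler_pXn2r ?nnegrE// leDn.
have mH : measurable_fun setT (fun x : R => 2 * x * G (x ^+ 2)).
  apply: measurable_funM; first exact: mulrl_measurable.
  by apply: (measurableT_comp mG); exact: measurable_funX.
have dF (x : R) : is_derive x 1 (fun y : R => y ^+ 2) (2 * x).
  have -> : (fun y : R => y ^+ 2) = id ^+ 2 by apply/funext.
  by apply: is_derive_eq; rewrite /= expr1 /GRing.scale/= mulr1.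
have dFE : (fun y : R => y ^+ 2)^`()%classic = (fun x => 2 * x).
  by apply/funext => x; rewrite derive1E; exact: (@derive_val _ _ _ _ _ _ _ (dF x)).
have cF' : continuous (fun x : R => 2 * x) by move=> x; exact: mulrl_continuous.
have cF (x : R) : {for x, continuous (fun y : R => y ^+ 2)} by exact: exprn_continuous.
have DE n : (\int[mu]_(x in D2 n) (G x)%:E = \int[mu]_(x in D n) (2 * x * G (x ^+ 2))%:E)%E.
  rewrite /D2 (@integration_by_substitution_increasing _ (fun y : R => y ^+ 2))//.
  - by apply: eq_integral => x _; rewrite dFE /= mulrC.
  - by apply: (@le_trans _ _ 1); rewrite ?invf_le1// ler1n.
  - move=> x y xD yD xy; rewrite ltr_pXn2r ?nnegrE// ltW//; exact: (D0 n).
  - by rewrite dFE => x _; exact: cF'.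
  - by rewrite dFE; apply/cvg_ex; eexists; apply: cvg_at_right_filter; exact: cF'.
  - by rewrite dFE; apply/cvg_ex; eexists; apply: cvg_at_left_filter; exact: cF'.
  - split.
    + by move=> x _; exact: (@ex_derive _ _ _ _ _ _ _ (dF x)).
    + by apply: cvg_at_right_filter; exact: cF.
    + by apply: cvg_at_left_filter; exact: cF.
  - apply: continuous_in_subspaceT => x; rewrite inE => xD2; apply: cG.
    exact: (D20 n).
apply/eqP; rewrite eq_le; apply/andP; split.
- rewrite -UD2; apply: ge0_integral_bigcup_le => //.
  + by move=> n; exact: measurable_itv.
  + by apply: measurable_funTS; exact/measurable_EFinP.
  move=> n; rewrite DE; apply: ge0_subset_integral => //.
  + exact: measurable_itv.
  + by rewrite UD2; exact: measurable_itv.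
  + by apply: measurable_funTS; exact/measurable_EFinP.
  + by move=> x; rewrite UD2/= in_itv/= andbT => x0; rewrite lee_fin mulr_ge0// mulr_ge0// ltW.
  + by rewrite UD2 -UD; exact: bigcup_sup.
(* The integrand may be negative for x < 0, while the exhaustion lemma asks for a function
   nonnegative everywhere. On the half-line [H] coincides with it. *)
- pose H (x : R) := Num.max 0 (2 * x * G (x ^+ 2)).
  have EH E : E `<=` `]0%R, +oo[%classic -> (\int[mu]_(x in E) (2 * x * G (x ^+ 2))%:E = \int[mu]_(x in E) (H x)%:E)%E.
    move=> EO; apply: eq_integral => x; rewrite inE => /EO; rewrite /= in_itv/= andbT => x0.
    by rewrite /H max_r// mulr_ge0// mulr_ge0// ltW.
  rewrite EH// -UD; apply: ge0_integral_bigcup_le => //.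
  + by move=> n; exact: measurable_itv.
  + apply: measurable_funTS; apply/measurable_EFinP.
    by apply: measurable_maxr => //; exact: measurable_cst.
  + by move=> x; rewrite lee_fin le_max lexx.
  move=> n; rewrite -EH; last by rewrite -UD; exact: bigcup_sup.
  rewrite -DE; apply: ge0_subset_integral => //.
  + exact: measurable_itv.
  + by rewrite UD; exact: measurable_itv.
  + by apply: measurable_funTS; exact/measurable_EFinP.
  + by move=> x _; rewrite lee_fin.
  + by rewrite UD => x /D20; rewrite /= in_itv/= andbT.
Qed.

Let g (s t : R) : R := t `^ (s - 1) * expR (- t).

Let mg s : measurable_fun setT (g s).
Proof.
apply: measurable_funM; first exact: measurable_powR.
by apply: measurableT_comp => //; exact: measurable_funN.
Qed.

Let g0 s t : 0 <= g s t.
Proof. by rewrite mulr_ge0 ?powR_ge0 ?expR_ge0. Qed.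

Lemma Gamma_integral_lty (s : R) : 0 < s ->
  (\int[mu]_(t in `]0%R, +oo[) (g s t)%:E < +oo)%E.
Proof.
move=> s0.
have -> : `]0%R, +oo[%classic = `]0%R, 1%R]%classic `|` `]1%R, +oo[%classic :> set R.
  by rewrite -itv_bndbnd_setU// ?bnd_simp.
rewrite ge0_integral_setU//=.
- apply: lte_add_pinfty.
  + apply: (@le_lt_trans _ _ (\int[mu]_(t in `]0%R, 1%R]) (t `^ (s - 1))%:E)%E).
      apply: ge0_le_integral => //=.
      * by move=> t _; rewrite lee_fin.
      * by apply: measurable_funTS; apply/measurable_EFinP; exact: mg.
      * by apply: measurable_funTS; apply/measurable_EFinP; exact: measurable_powR.
      move=> t; rewrite in_itv/= => /andP[t0 _]; rewrite lee_fin ler_piMr ?powR_ge0//.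
      by rewrite expR_le1 oppr_le0 ltW.
    by apply: (le_lt_trans (le_integral_powR0 s0 ltr01)); rewrite ltry.
  (* Since t^(n+1) / (n+1)! <= e^t and n + 1 > s + 1, the integrand is at most (n+1)! t^(-2) beyond
     1. *)
  + pose n := truncn (s + 1).
    apply: (@le_lt_trans _ _ (\int[mu]_(t in `]1%R, +oo[) ((n.+1)`!%:R%:E * (t `^ (- 1 - 1))%:E))%E).
      apply: ge0_le_integral => //=.
      * by move=> t _; rewrite lee_fin.
      * by apply: measurable_funTS; apply/measurable_EFinP; exact: mg.
      * apply: measurable_funTS; apply/measurable_EFinP.
        by apply: measurable_funM => //; exact: measurable_powR.
      move=> t; rewrite in_itv/= andbT => t1; rewrite -EFinM lee_fin.
      have t0 : 0 < t by exact: lt_trans t1.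
      have tD (a b : R) : t `^ (a + b) = t `^ a * t `^ b.
        by apply: powRD; rewrite (gt_eqF t0) implybT.
      rewrite /g expRN ler_pdivrMr ?expR_gt0//.
      have -> : t `^ (s - 1) = t `^ (-1 - 1) * t `^ (s + 1).
        by rewrite -tD; congr powR; ring.
      rewrite [leRHS]mulrAC [leRHS]mulrC ler_pM2l ?powR_gt0//.
      apply: (@le_trans _ _ (t ^+ n.+1)).
        rewrite -powR_mulrn ?(ltW t0)//.
        by apply: ler_powR; [exact: ltW|exact: (ltW (truncnS_gt _))].
      have := @expR_ge1Dxn R t n (ltW t0); rewrite -ler_pdivrMl ?ltr0n ?fact_gt0//.
      by apply: le_trans; rewrite mulrC lerDr.
    have mp : measurable_fun (`]1%R, +oo[%classic : set R) (fun t : R => (t `^ (- 1 - 1))%:E).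
      by apply: measurable_funTS; apply/measurable_EFinP; exact: measurable_powR.
    rewrite (ge0_integralZl mu _ mp)//; last by move=> t _; rewrite lee_fin powR_ge0.
    rewrite lte_mul_pinfty// ?lee_fin//.
    apply: (@le_lt_trans _ _ (\int[mu]_(t in `[1%R, +oo[) (t `^ (- 1 - 1))%:E)%E).
      apply: ge0_subset_integral => //.
      * by apply: measurable_funTS; apply/measurable_EFinP; exact: measurable_powR.
      * by move=> t _; rewrite lee_fin powR_ge0.
      * by move=> t; rewrite /= !in_itv/= !andbT => /ltW.
    by rewrite integral_powRy// ltry.
- by apply: measurable_funTS; apply/measurable_EFinP; exact: mg.
- by move=> t _; rewrite lee_fin.
- apply/disj_set2P/seteqP; split => x //=; rewrite !in_itv/= andbT.
  by move=> [/andP[_ x1]] x2; have := le_lt_trans x1 x2; rewrite ltxx.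
Qed.

Lemma Gamma_gt0 (s : R) : 0 < s -> 0 < Gamma s.
Proof.
move=> s0; rewrite /Gamma /Rintegral; apply: fine_gt0.
rewrite Gamma_integral_lty// andbT.
(* On [1, 2] the integrand is at least t^(-1) e^(-2), whatever s > 0. *)
apply: (@lt_le_trans _ _ (\int[mu]_(t in `[1%R, 2%R]) (cst (expR (- 2) / 2)%:E) t)%E).
  rewrite integral_cst//= lebesgue_measure_itv/= lte_fin ltr1n.
  by rewrite -EFinB -EFinM lte_fin mulr_gt0 ?divr_gt0 ?expR_gt0// lerBrDl.
apply: (@le_trans _ _ (\int[mu]_(t in `[1%R, 2%R]) (g s t)%:E)%E).
  apply: ge0_le_integral => //=.
  - by apply: measurable_funTS; apply/measurable_EFinP; exact: mg.
  move=> t; rewrite in_itv/= => /andP[t1 t2]; rewrite lee_fin /g mulrC.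
  apply: ler_pM; rewrite ?expR_ge0 ?invr_ge0// ?ler_expR ?lerN2//.
  apply: (@le_trans _ _ (t `^ (-1))).
    by rewrite powR_inv1 ?(le_trans _ t1)// lef_pV2 ?posrE// (lt_le_trans _ t1).
  by apply: ler_powR => //; rewrite -[leLHS]add0r lerD2r ltW.
apply: ge0_subset_integral => //=.
- by apply: measurable_funTS; apply/measurable_EFinP; exact: mg.
- by move=> t _; rewrite lee_fin.
- by move=> t /=; rewrite !in_itv/= andbT => /andP[t1 _]; exact: lt_le_trans t1.
Qed.

(** Substituting the square turns the integral of Gamma into the radial part of a Gaussian
    integral. *)
Lemma Gamma_sqr (s : R) : 0 < s ->
  ((Gamma s)%:E = 2%:E * \int[mu]_(t in `]0%R, +oo[) ((t `^ (2 * s - 1)) * expR (- t ^+ 2))%:E)%E.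
Proof.
move=> s0; rewrite /Gamma /Rintegral fineK; last first.
  rewrite ge0_fin_numE ?Gamma_integral_lty//.
  by apply: integral_ge0 => t _; rewrite lee_fin; exact: (g0 s t).
rewrite (ge0_integral_sqr_subst (G := g s))//; last first.
  move=> x x0; apply: cvgM; first exact: continuous_powR.
  apply: (@continuous_comp _ _ _ (@GRing.opp R) expR); last exact: continuous_expR.
  exact: opp_continuous.
have mp : measurable_fun (`]0%R, +oo[%classic : set R) (fun t : R => (t `^ (2 * s - 1) * expR (- t ^+ 2))%:E).
  apply: measurable_funTS; apply/measurable_EFinP.
  apply: measurable_funM; first exact: measurable_powR.
  by apply: measurableT_comp => //; apply: measurable_funN => //; exact: measurable_funX.
have p0 (t : R) : (`]0%R, +oo[%classic : set R) t -> (0 <= (t `^ (2 * s - 1) * expR (- t ^+ 2))%:E)%E.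
  by move=> _; rewrite lee_fin mulr_ge0 ?powR_ge0 ?expR_ge0.
have two0 : (0 <= 2%:E :> \bar R)%E by rewrite lee_fin.
rewrite -(ge0_integralZl mu (measurable_itv _) mp p0 two0).
apply: eq_integral => t; rewrite inE/= in_itv/= andbT => t0; rewrite -EFinM; congr EFin.
rewrite /g -!mulrA; congr (_ * _); rewrite mulrA; congr (_ * _).
rewrite -powR_mulrn ?ltW// -powRrM -{1}(powRr1 (ltW t0)) -powRD.
  by congr powR; ring.
by rewrite (gt_eqF t0) implybT.
Qed.

End Gamma_theory.

Section surface_area.
Context {R : realType}.
Notation mu := (@lebesgue_measure R).
Local Open Scope ereal_scope.

Lemma integral_gauss_rV n :
  \int[lebesgue_rV n]_x (expR (- enorm x ^+ 2)%R)%:E = ((pi : R) `^ (n%:R / 2))%:E.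
Proof.
elim: n => [|n IH].
  rewrite mul0r powRr0 /= integral_dirac//=.
    by rewrite diracT mul1e enorm0 expr0n/= oppr0 expR0.
  apply/measurable_EFinP; apply: measurableT_comp => //; apply: measurable_funN.
  by apply: measurable_funX; exact: measurable_enorm.
have mG : measurable_fun setT (fun x : 'rV[R]_n.+1 => (expR (- enorm x ^+ 2)%R)%:E).
  apply/measurable_EFinP; apply: measurableT_comp => //; apply: measurable_funN.
  by apply: measurable_funX; exact: measurable_enorm.
have mGn : measurable_fun setT (fun x : 'rV[R]_n => (expR (- enorm x ^+ 2)%R)%:E).
  apply/measurable_EFinP; apply: measurableT_comp => //; apply: measurable_funN.
  by apply: measurable_funX; exact: measurable_enorm.
rewrite ge0_integral_cons//.
transitivity (\int[mu]_x ((pi `^ (n%:R / 2))%:E * (gauss_fun x)%:E)).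
  apply: eq_integral => x _.
  rewrite -IH muleC -(ge0_integralZl (lebesgue_rV n) _ mGn)//.
  - apply: eq_integral => y _; rewrite -EFinM; congr EFin.
    rewrite /gauss_fun -expRD -opprD; congr (expR (- _))%R.
    rewrite !enorm_sqr big_ord_recl /cons_rV; congr (_ ^+ 2 + _)%R.
      rewrite (_ : ord0 = lshift n (ord0 : 'I_1)); last exact: val_inj.
      by rewrite (@row_mxEl R 1 1 n) mxE eqxx mulr1n.
    apply: eq_bigr => i _; congr (_ ^+ 2)%R.
    rewrite (_ : lift ord0 i = rshift 1 i); last exact: val_inj.
    by rewrite (@row_mxEr R 1 1 n).
  - by rewrite lee_fin expR_ge0.
rewrite (ge0_integralZl mu measurableT)//; last 3 first.
- by apply/measurable_EFinP; exact: measurable_gauss_fun.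
- by move=> x _; rewrite lee_fin expR_ge0.
- by rewrite lee_fin powR_ge0.
rewrite integralT_gauss -EFinM -powR12_sqrt ?pi_ge0// -powRD; last first.
  by rewrite (gt_eqF (pi_gt0 R)) implybT.
have -> : (n.+1%:R = n%:R + 1 :> R)%R by rewrite natr1.
by rewrite mulrDl mul1r.
Qed.

Lemma omega_gt0 (s : R) : (0 < s)%R -> (0 < omega s)%R.
Proof.
by move=> s0; rewrite /omega divr_gt0 ?mulr_gt0 ?powR_gt0 ?pi_gt0// Gamma_gt0// divr_gt0.
Qed.

(** The measure of the ball remains an unknown factor here, because this identity, applied to the
    Gaussian, is what determines it. *)
Let ge0_integral_radial0 n (F : R -> \bar R) :
  measurable_fun setT F -> (forall s, 0 <= F s) ->
  \int[lebesgue_rV n.+1]_x F (enorm x) =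
  n.+1%:R%:E * (lebesgue_rV n.+1 (@punctured_ball R n) *
    \int[mu]_(s in `]0%R, +oo[) ((s `^ (n.+1%:R - 1))%:E * F s)).
Proof.
move=> mF F0.
rewrite (@ge0_integral_polar _ _ (fun x => F (enorm x)))//; last first.
  by apply: measurableT_comp => //; exact: measurable_enorm.
congr (_ * _); rewrite muleC -integral_cst; last exact: measurable_punctured_ball.
apply: eq_integral => y; rewrite inE => /andP[y0 _].
apply: eq_integral => s; rewrite inE/= in_itv/= andbT => s0.
by rewrite enormZ enorm_dir// mulr1 gtr0_norm.
Qed.

(** The Gaussian integral is computed twice: as a product of one-dimensional integrals it is
    pi^(N/2), in polar coordinates it is N Gamma(N/2) / 2 times the measure of the ball. *)
Lemma lebesgue_punctured_ball n :
  lebesgue_rV n.+1 (@punctured_ball R n) = (omega n.+1%:R / n.+1%:R)%:E.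
Proof.
have := integral_gauss_rV n.+1.
rewrite (@ge0_integral_radial0 n (fun t => (expR (- t ^+ 2)%R)%:E)); last 2 first.
- apply/measurable_EFinP; apply: measurableT_comp => //; apply: measurable_funN => //.
- by move=> t; rewrite lee_fin expR_ge0.
have n0 : (0 < n.+1%:R / 2 :> R)%R by rewrite divr_gt0.
have := Gamma_sqr n0; rewrite mulrCA divff// mulr1.
under [X in _ -> _ * (_ * X) = _ -> _]eq_integral do rewrite -EFinM.
set I := \int[mu]_(s in _) _ => GE.
have Ifin : I = (Gamma (n.+1%:R / 2) / 2)%:E.
  by rewrite mulrC EFinM GE muleA -EFinM mulVf// mul1e.
rewrite Ifin; have G0 := Gamma_gt0 n0.
(* A measure that is not finite would contradict the finite value pi^(N/2). *)
case: (lebesgue_rV n.+1 _) => [k| |] /=; last 2 first.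
- by rewrite gt0_mulye ?lte_fin ?divr_gt0// gt0_muley ?lte_fin.
- by rewrite gt0_mulNye ?lte_fin ?divr_gt0// gt0_muleNy ?lte_fin.
rewrite -!EFinM => -[E]; congr EFin; rewrite /omega -E; field.
by rewrite nat1r pnatr_eq0 /= (gt_eqF G0).
Qed.

Lemma ge0_integral_radial n (F : R -> \bar R) :
  measurable_fun setT F -> (forall s, 0 <= F s) ->
  \int[lebesgue_rV n.+1]_x F (enorm x) =
  (omega n.+1%:R)%:E *
    \int[mu]_(s in `]0%R, +oo[) ((s `^ (n.+1%:R - 1))%:E * F s).
Proof.
move=> mF F0; rewrite ge0_integral_radial0// lebesgue_punctured_ball muleA -EFinM.
by rewrite mulrCA divff ?mulr1.
Qed.

End surface_area.

(** * Moser's estimate on a ray *)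

Section moser_gap.
Context {R : realType}.
Implicit Types p s t l : R.

Lemma conj_exp_gt1 p : 1 < p -> 1 < conj_exp p.
Proof. by move=> p1; rewrite /conj_exp ltr_pdivlMr ?subr_gt0// mul1r gtrBl. Qed.

Lemma conj_exp_inv p : 1 < p -> p^-1 + (conj_exp p)^-1 = 1.
Proof.
move=> p1; rewrite /conj_exp invf_div -[X in X + _]mul1r -mulrDl addrC subrK divff//.
by rewrite gt_eqF// (lt_trans _ p1).
Qed.

Lemma expR_le1D2x (y : R) : 0 <= y <= 2^-1 -> expR y <= 1 + 2 * y.
Proof.
move=> /andP[y0 y1]; have := expR_ge1Dx (- y); rewrite expRN => h.
have y2 : 0 < 1 - y by lra.
have : expR y <= (1 - y)^-1.
  by rewrite -[leLHS]invrK lef_pV2 ?posrE ?invr_gt0 ?expR_gt0.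
move=> /le_trans; apply; rewrite -[leLHS]mul1r ler_pdivrMr//; nra.
Qed.

(** On [0, 1/2] one has ln (1 - e) >= - 2 e. This gives a linear bound for every a > 0, whereas
    Bernoulli's inequality would restrict the exponent to a >= 1. *)
Lemma powR_ge1Bx (e a : R) : 0 < a -> 0 <= e <= 2^-1 -> 1 - 2 * a * e <= (1 - e) `^ a.
Proof.
move=> a0 /andP[e0 e1]; have d0 : 0 < 1 - e by lra.
rewrite /powR gt_eqF//.
apply: le_trans (expR_ge1Dx _).
have E : (1 - e)^-1 = 1 + e / (1 - e) by field; rewrite gt_eqF.
have : ln (1 - e)^-1 <= e / (1 - e).
  by rewrite [in leLHS]E; apply: le_ln1Dx; apply: (@lt_le_trans _ _ 0); rewrite ?ltrN10// divr_ge0// ltW.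
rewrite lnV ?posrE// => h1.
have h2 : e / (1 - e) <= 2 * e by rewrite ler_pdivrMr//; nra.
by nra.
Qed.

Lemma powR1D_le (x a : R) : 0 < a -> 0 <= x -> x / a <= 2^-1 ->
  (1 + x) `^ a^-1 <= 1 + 2 * (x / a).
Proof.
move=> a0 x0 xa; have d0 : 0 < 1 + x by lra.
rewrite /powR gt_eqF//.
apply: (@le_trans _ _ (expR (x / a))).
  rewrite ler_expR mulrC ler_pM2r ?invr_gt0//.
  by apply: le_ln1Dx; apply: (@lt_le_trans _ _ 0); rewrite ?ltrN10.
by apply: expR_le1D2x; rewrite xa divr_ge0// ltW.
Qed.

(** With C = 2^(p+1) Moser's argument ends in t + s - l <= (1 + C l / t) (t + s / 2). The factor 4
    makes C l / t at most 1/4, so that the terms in s can be absorbed and s <= 4 (1 + C) l follows.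
    The same number serves as threshold for t and as bound for s. *)
Definition gap_const p : R := 4 * (1 + 2 `^ (p + 1)).

Lemma gap_const_gt0 p : 0 < gap_const p.
Proof. by rewrite mulr_gt0// addr_gt0// powR_gt0. Qed.

(* Hoelder with the weight 1/2 on the second increment: if the energy e1 spent
   up to time t is almost everything, the remaining energy e2 is at most of
   order l / t, which only allows to stay close to the extremal growth for a
   further time of order l. *)
Lemma moser_gap p t s l v1 v2 e1 e2 : 1 < p ->
  0 <= s -> 0 < l -> gap_const p * l <= t -> 0 <= v1 -> 0 <= v2 ->
  0 <= e1 -> 0 <= e2 -> e1 + e2 <= 1 ->
  v1 <= e1 `^ p^-1 * t `^ (conj_exp p)^-1 ->
  v2 <= v1 + e2 `^ p^-1 * s `^ (conj_exp p)^-1 ->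
  t - v1 `^ conj_exp p <= l -> t + s - v2 `^ conj_exp p <= l ->
  s <= gap_const p * l.
Proof.
move=> p1 s0 l0 tl v10 v20 e10 e20 e12 hv1 hv2 hl1 hl2.
have q1 := conj_exp_gt1 p1; set q := conj_exp p in q1 hv1 hv2 hl1 hl2 *.
have q0 : 0 < q by rewrite (lt_trans _ q1).
have p0 : 0 < p by rewrite (lt_trans _ p1).
have qn0 : q != 0 by rewrite gt_eqF.
have pn0 : p != 0 by rewrite gt_eqF.
have a0 : 0 < p - 1 by rewrite subr_gt0.
have an0 : p - 1 != 0 by rewrite gt_eqF.
have qa : p^-1 * q = (p - 1)^-1 by rewrite /q /conj_exp mulrA mulVf// mul1r.
have pa : q^-1 * p = p - 1 by rewrite /q /conj_exp invf_div divfK.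
have pq := conj_exp_inv p1; rewrite -/q in pq; clearbody q.
have t0 : 0 < t by apply: lt_le_trans tl; rewrite mulr_gt0// gap_const_gt0.
pose C := (2 : R) `^ (p + 1).
have C0 : 0 < C by rewrite powR_gt0.
have CE : C = 2 * 2 `^ p by rewrite /C addrC powRD ?powRr1// pnatr_eq0 implybT.
have C2 : 2 <= C.
  by rewrite CE -[leLHS]mulr1 ler_pM2l// -[leLHS](powRr0 2) ler_powR ?ler1n// ltW.
pose e := l / t.
have e0 : 0 < e by rewrite divr_gt0.
have et : e * t = l by rewrite /e divfK// gt_eqF.
have eC : C * e <= 4^-1.
  have : (4 * (1 + C)) * e <= 1.
    by rewrite /e mulrA ler_pdivrMr// mul1r.
  by nra.
have e14 : e <= 8^-1 by nra.
have pe : 2 `^ p * e <= 2^-1 by rewrite CE in eC; nra.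
have h1 : v1 `^ q <= e1 `^ (p - 1)^-1 * t.
  apply: (@le_trans _ _ ((e1 `^ p^-1 * t `^ q^-1) `^ q)).
    by apply: ge0_ler_powR; rewrite ?nnegrE ?mulr_ge0 ?powR_ge0 ?(ltW q0).
  by rewrite powRM ?powR_ge0// -!powRrM qa mulVf// powRr1 ?(ltW t0).
have h2 : 1 - e <= e1 `^ (p - 1)^-1.
  by rewrite -(ler_pM2r t0) mulrBl et mul1r; apply: le_trans h1; lra.
have h3 : (1 - e) `^ (p - 1) <= e1.
  rewrite -[leRHS]powRr1// -[in leRHS](mulVf an0) [leRHS]powRrM.
  by apply: ge0_ler_powR; rewrite ?nnegrE ?powR_ge0 ?(ltW a0)//; lra.
have h4 : 1 - 2 * (p - 1) * e <= (1 - e) `^ (p - 1) by apply: powR_ge1Bx => //; lra.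
have h5 : e2 <= 2 * (p - 1) * e by lra.
pose A := e1 + e2 * 2 `^ (p - 1).
have A0 : 0 <= A by rewrite addr_ge0// mulr_ge0// powR_ge0.
have s20 : 0 <= s / 2 by rewrite divr_ge0.
(* Writing e2^(1/p) s^(1/q) as (e2^(1/p) 2^(1/q)) (s/2)^(1/q) costs a factor 2^(p-1) on the small
   energy e2 but halves s. The missing half of s then has to be paid for by l. *)
have h6 : v2 <= A `^ p^-1 * (t + s / 2) `^ q^-1.
  have := @hoelder2 R (e1 `^ p^-1) (e2 `^ p^-1 * 2 `^ q^-1) (t `^ q^-1) ((s / 2) `^ q^-1) p q.
  rewrite mulr_ge0 ?powR_ge0// => /(_ isT isT isT isT p0 q0 pq).
  rewrite (powRM p (powR_ge0 e2 p^-1) (powR_ge0 2 q^-1)) -!powRrM !mulVf// pa !powRr1// ?(ltW t0)//.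
  rewrite -mulrA -powRM// mulrCA divff// mulr1 => h.
  by apply: (le_trans hv2); apply: le_trans h; rewrite lerD2r.
have h7 : v2 `^ q <= A `^ (p - 1)^-1 * (t + s / 2).
  have ts : 0 <= t + s / 2 by rewrite addr_ge0// ltW.
  apply: (@le_trans _ _ ((A `^ p^-1 * (t + s / 2) `^ q^-1) `^ q)).
    by apply: ge0_ler_powR; rewrite ?nnegrE ?mulr_ge0 ?powR_ge0 ?(ltW q0).
  by rewrite powRM ?powR_ge0// -!powRrM qa mulVf// powRr1.
have p2 : (2 : R) `^ p = 2 `^ (p - 1) * 2.
  rewrite -[X in _ * X]powRr1// -powRD ?subrK// pnatr_eq0 implybT//.
pose x := 2 `^ (p - 1) * (2 * (p - 1) * e).
have xE : x / (p - 1) = 2 `^ p * e by rewrite /x p2; field.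
have x0 : 0 <= x.
  rewrite /x; apply: mulr_ge0; first exact: powR_ge0.
  by apply: mulr_ge0; [apply: mulr_ge0 => //; exact: ltW|exact: ltW].
have h8 : A <= 1 + x.
  rewrite /A /x; apply: lerD; first by lra.
  by rewrite mulrC ler_pM2l// powR_gt0.
have h9 : A `^ (p - 1)^-1 <= 1 + C * e.
  apply: (@le_trans _ _ ((1 + x) `^ (p - 1)^-1)).
    by apply: ge0_ler_powR; rewrite ?nnegrE ?invr_ge0 ?(ltW a0)//; exact: addr_ge0.
  apply: (le_trans (powR1D_le a0 x0 _)); first by rewrite xE.
  by rewrite xE CE mulrA.
have h10 : t + s - l <= (1 + C * e) * (t + s / 2).
  apply: le_trans (ler_wpM2r _ h9); first by lra.
  by rewrite addr_ge0// ltW.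
have h11 : C * e * t = C * l by rewrite -mulrA et.
have h12 : C * e * s <= 4^-1 * s by rewrite ler_wpM2r.
rewrite /gap_const -/C; nra.
Qed.

End moser_gap.

(** * Hoelder's inequality along a ray *)

Section ray.
Context {R : realType}.
Notation mu := (@lebesgue_measure R).

Lemma ler_powRN (x y k : R) : k <= 0 -> 0 < x -> x <= y -> y `^ k <= x `^ k.
Proof.
move=> k0 x0 xy; have y0 : 0 < y := lt_le_trans x0 xy.
rewrite -(opprK k) !(powRN _ (- k)) lef_pV2 ?posrE ?powR_gt0//.
by apply: ge0_ler_powR; rewrite ?oppr_ge0// nnegrE ltW.
Qed.

Definition slab (b u1 u2 : R) : set R := [set s | 0 < s /\ u1 <= s `^ (- b) <= u2].

Lemma measurable_slab b u1 u2 : measurable (slab b u1 u2).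
Proof.
rewrite (_ : slab b u1 u2 = `]0%R, +oo[%classic `&` (@powR R ^~ (- b)) @^-1` `[u1, u2]%classic).
  apply: measurableI => //; rewrite -[X in measurable X]setTI.
  by apply: measurable_powR => //; exact: measurable_itv.
by apply/seteqP; split => s; rewrite /slab/= !in_itv/= andbT.
Qed.

(** In the variable t = s^(-b) the measure s^(-b-1) ds is dt / b up to sign, so a slab weighs at
    most its length in t divided by b. For [u1 = 0] the slab is a half-line in s. *)
Lemma le_integral_slab (b u1 u2 : R) : 0 < b -> 0 <= u1 -> u1 <= u2 ->
  (\int[mu]_(s in slab b u1 u2) (s `^ (- b - 1))%:E <= ((u2 - u1) / b)%:E)%E.
Proof.
move=> b0 u10 u12.
have m1 (E : set R) : measurable_fun E (fun s : R => (s `^ (- b - 1))%:E).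
  by apply: measurable_funTS; apply/measurable_EFinP; exact: measurable_powR.
have p0 (E : set R) s : E s -> (0 <= (s `^ (- b - 1))%:E)%E.
  by move=> _; rewrite lee_fin powR_ge0.
have bK (s : R) : 0 < s -> (s `^ (- b)) `^ (- b^-1) = s.
  by move=> s0; rewrite -powRrM mulrNN divff ?gt_eqF// powRr1// ltW.
have Kb (s : R) : 0 < s -> (s `^ (- b^-1)) `^ (- b) = s.
  by move=> s0; rewrite -powRrM mulrNN mulVf ?gt_eqF// powRr1// ltW.
have [u20|u20] := leP u2 0.
  rewrite (_ : slab b u1 u2 = set0) ?integral_set0 ?lee_fin ?divr_ge0 ?subr_ge0// ?ltW//.
  apply/seteqP; split => s //= -[s0 /andP[_ h]].
  by have := lt_le_trans (powR_gt0 (- b) s0) (le_trans h u20); rewrite ltxx.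
pose x := u2 `^ (- b^-1).
have x0 : 0 < x by rewrite powR_gt0.
have b1 : - b^-1 <= 0 by rewrite oppr_le0 invr_ge0 ltW.
have sx s : slab b u1 u2 s -> x <= s.
  move=> [s0 /andP[_ h]]; rewrite -(bK _ s0).
  by apply: ler_powRN => //; exact: powR_gt0.
move: u10; rewrite le_eqVlt => /predU1P[u10|u10].
  rewrite -u10 subr0 -[in X in (_ <= X)%E](Kb _ u20) -integral_powRy//.
  apply: ge0_subset_integral => //; try exact: measurable_slab; try exact: m1; try exact: p0.
  by move=> s; rewrite u10 => /sx xs; rewrite /= in_itv/= xs.
pose y := u1 `^ (- b^-1).
have y0 : 0 < y by rewrite powR_gt0.
have sy s : slab b u1 u2 s -> s <= y.
  move=> [s0 /andP[h _]]; rewrite -(bK _ s0).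
  by apply: ler_powRN.
have : x <= y by apply: ler_powRN.
rewrite le_eqVlt => /predU1P[xy|xy].
  apply: (@le_trans _ _ (\int[mu]_(s in `[x, x]) (s `^ (- b - 1))%:E)%E).
    apply: ge0_subset_integral => //; try exact: measurable_slab; try exact: m1; try exact: p0.
    by move=> s h; rewrite /= in_itv/= sx// xy sy.
  by rewrite set_itv1 integral_set1 lee_fin divr_ge0 ?subr_ge0// ltW.
apply: (@le_trans _ _ (\int[mu]_(s in `[x, y]) (s `^ (- b - 1))%:E)%E).
  apply: ge0_subset_integral => //; try exact: measurable_slab; try exact: m1; try exact: p0.
  by move=> s h; rewrite /= in_itv/= sx// sy.
by rewrite integral_powR_itvcc ?oppr_eq0 ?gt_eqF// /x /y !Kb// lee_fin invrN mulrN -mulNr opprB.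
Qed.

Variables (p m : R).
Hypotheses (p1 : 1 < p) (pm : p < m).
Let b := (m - p) / (p - 1).
Let q := conj_exp p.

Let b0 : 0 < b. Proof. by rewrite divr_gt0 ?subr_gt0. Qed.
Let p0 : 0 < p. Proof. by rewrite (lt_trans _ p1). Qed.
Let a0 : 0 < p - 1. Proof. by rewrite subr_gt0. Qed.
Let q0 : 0 < q. Proof. by rewrite (lt_trans _ (conj_exp_gt1 p1)). Qed.
Let pq : p^-1 + q^-1 = 1. Proof. exact: conj_exp_inv. Qed.

Variables (w dw : R -> R).
Hypothesis dwE : forall s : R, 0 < s -> is_derive s 1 w (dw s).
Hypothesis cdw : forall s : R, 0 < s -> {for s, continuous dw}.

Let cw (s : R) : 0 < s -> {for s, continuous w}.
Proof.
move=> s0; apply: differentiable_continuous; apply/derivable1_diffP.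
exact: (@ex_derive _ _ _ _ _ _ _ (dwE s0)).
Qed.

Lemma measurable_ray_deriv : measurable_fun (`]0%R, +oo[%classic : set R) dw.
Proof.
apply: open_continuous_measurable_fun => //.
by move=> s; rewrite inE/= in_itv/= andbT; exact: cdw.
Qed.

Lemma measurable_ray_fun : measurable_fun (`]0%R, +oo[%classic : set R) w.
Proof.
apply: open_continuous_measurable_fun => //.
by move=> s; rewrite inE/= in_itv/= andbT; exact: cw.
Qed.

(** Energy density along a ray: [dw] is the derivative of [w], and s^(m-1) the Jacobian of polar
    coordinates. *)
Definition ray_density (s : R) : R := `|dw s| `^ p * s `^ (m - 1).

Lemma measurable_ray_density : measurable_fun (`]0%R, +oo[%classic : set R) ray_density.
Proof.
apply: measurable_funM; last by apply: measurable_funTS; exact: measurable_powR.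
apply: (measurableT_comp (@measurable_powR R p)).
by apply: measurableT_comp => //; exact: measurable_ray_deriv.
Qed.

Lemma ray_density_ge0 s : 0 <= ray_density s.
Proof. by rewrite mulr_ge0 ?powR_ge0. Qed.

(** Hoelder's inequality for the product of dw s^((m-1)/p) and s^(-(m-1)/p). The first factor yields
    the energy, and the q-th power of the second is s^(-b-1) because (m - 1) / (p - 1) = b + 1. *)
Lemma ray_hoelder (x y : R) : 0 < x -> x < y ->
  (`|w y - w x|%:E <=
   (\int[mu]_(s in `[x, y]) (ray_density s)%:E) `^ p^-1 *
   (((x `^ (- b) - y `^ (- b)) / b) `^ q^-1)%:E)%E.
Proof.
move=> x0 xy.
have xyO : `[x, y]%classic `<=` (`]0%R, +oo[%classic : set R).
  by move=> s; rewrite /= !in_itv/= andbT => /andP[+ _]; exact: lt_le_trans.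
have mdw : measurable_fun `[x, y] dw.
  by apply: measurable_funS measurable_ray_deriv.
have -> : (`|w y - w x|%:E = `| \int[mu]_(s in `[x, y]) (dw s)%:E |)%E.
  rewrite (@continuous_FTC2 _ dw w)//.
  - apply: continuous_in_subspaceT => s; rewrite inE => /xyO.
    by rewrite /= in_itv/= andbT; exact: cdw.
  - split.
    + move=> s; rewrite in_itv/= => /andP[xs _].
      exact: (@ex_derive _ _ _ _ _ _ _ (dwE (lt_trans x0 xs))).
    + by apply: cvg_at_right_filter; exact: cw.
    + by apply: cvg_at_left_filter; apply: cw; exact: lt_trans xy.
  - move=> s; rewrite in_itv/= => /andP[xs _].
    by rewrite derive1E; exact: (@derive_val _ _ _ _ _ _ _ (dwE (lt_trans x0 xs))).
apply: (le_trans (le_abse_integral mu _ _)) => //; first exact/measurable_EFinP.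
pose f := (fun s => dw s * s `^ ((m - 1) / p)) \_ `[x, y].
pose g := (fun s : R => s `^ (- ((m - 1) / p))) \_ `[x, y].
have mf : measurable_fun setT f.
  apply/(measurable_restrictT _ _).1 => //.
  by apply: measurable_funM => //; apply: measurable_funTS; exact: measurable_powR.
have mg : measurable_fun setT g.
  apply/(measurable_restrictT _ _).1 => //.
  by apply: measurable_funTS; exact: measurable_powR.
have := hoelder mu mf mg p0 q0 pq; rewrite Lnorm1.
have -> : (\int[mu]_s `|(EFin \o (f \* g)%R) s| = \int[mu]_(s in `[x, y]) `|(dw s)%:E|)%E.
  rewrite [RHS]integral_mkcond; apply: eq_integral => s _.
  rewrite /f /g !patchE/= !patchE; case: ifPn => [|_]; last by rewrite mul0r normr0.
  rewrite inE => /xyO; rewrite /= in_itv/= andbT => s0.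
  by rewrite -mulrA -powRD ?subrr ?powRr0 ?mulr1// (gt_eqF s0) implybT.
move=> /le_trans; apply; rewrite unlock; apply: lee_pmul.
- exact: poweR_ge0.
- exact: poweR_ge0.
- rewrite le_eqVlt; apply/orP; left; apply/eqP; congr poweR.
  rewrite [RHS]integral_mkcond; apply: eq_integral => s _.
  rewrite /f/= !patchE; case: ifPn => [|_]; last by rewrite normr0 powR0 ?gt_eqF.
  rewrite inE => /xyO; rewrite /= in_itv/= andbT => s0.
  rewrite /ray_density normrM powRM// (ger0_norm (powR_ge0 _ _)) -powRrM.
  by rewrite divfK// gt_eqF.
- rewrite -poweR_EFin le_eqVlt; apply/orP; left; apply/eqP; congr poweR.
  have -> : (x `^ (- b) - y `^ (- b)) / b = (y `^ (- b) - x `^ (- b)) / (- b).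
    by rewrite invrN mulrN -mulNr opprB.
  have Nb0 : - b != 0 by rewrite oppr_eq0 gt_eqF.
  rewrite -(integral_powR_itvcc Nb0 x0 xy).
  rewrite [RHS]integral_mkcond; apply: eq_integral => s _.
  rewrite /g/= !patchE; case: ifPn => [|_]; last by rewrite normr0 powR0 ?gt_eqF.
  rewrite inE => /xyO; rewrite /= in_itv/= andbT => s0.
  rewrite (ger0_norm (powR_ge0 _ _)) -powRrM; congr (_ `^ _)%:E.
  by rewrite /b /q /conj_exp; field; rewrite !gt_eqF.
Qed.

End ray.

Section moser_ray.
Context {R : realType}.
Notation mu := (@lebesgue_measure R).
Variables (p m A rb : R).
Hypotheses (p1 : 1 < p) (pm : p < m) (A0 : 0 < A) (rb0 : 0 <= rb).
Let b := (m - p) / (p - 1).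
Let q := conj_exp p.
Let T (s : R) := A * (s `^ (- b) - rb).
(* For [rb = neg_pow r (- b)] this is the interval ]0, r[. *)
Definition ray_dom : set R := [set s | 0 < s /\ rb < s `^ (- b)].

Let b0 : 0 < b. Proof. by rewrite divr_gt0 ?subr_gt0. Qed.
Let p0 : 0 < p. Proof. by rewrite (lt_trans _ p1). Qed.
Let a0 : 0 < p - 1. Proof. by rewrite subr_gt0. Qed.
Let q0 : 0 < q. Proof. by rewrite (lt_trans _ (conj_exp_gt1 p1)). Qed.
Let qE : q^-1 = (p - 1) / p. Proof. by rewrite /q /conj_exp invf_div. Qed.
Let K := gap_const p.
Let K0 : 0 < K. Proof. exact: gap_const_gt0. Qed.

Lemma ray_dom_gt0 : ray_dom `<=` `]0, +oo[%classic.
Proof. by move=> s [s0 _]; rewrite /= in_itv/= s0. Qed.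

Lemma measurable_ray_dom : measurable ray_dom.
Proof.
rewrite (_ : ray_dom = `]0%R, +oo[%classic `&` (@powR R ^~ (- b)) @^-1` `]rb, +oo[%classic).
  apply: measurableI => //; rewrite -[X in measurable X]setTI.
  by apply: measurable_powR => //; exact: measurable_itv.
by apply/seteqP; split => s; rewrite /ray_dom/= !in_itv/= !andbT.
Qed.

Let T_gt0 s : ray_dom s -> 0 < T s.
Proof. by move=> [_ h]; rewrite /T mulr_gt0// subr_gt0. Qed.

Section one_function.
Variables (w dw : R -> R) (alpha M y0 : R).
Hypothesis dwE : forall s : R, 0 < s -> is_derive s 1 w (dw s).
Hypothesis cdw : forall s : R, 0 < s -> {for s, continuous dw}.
Hypothesis y0r : rb <= y0 `^ (- b).
Hypothesis w0 : forall s, y0 <= s -> w s = 0.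
Hypotheses (alpha0 : 0 <= alpha) (M0 : 0 <= M).
Hypothesis wM : (\int[mu]_(s in `]0%R, +oo[) (ray_density p m dw s)%:E <= M%:E)%E.
Hypothesis aM : alpha * M `^ (p - 1)^-1 <= A * b.

Let I (x y : R) : \bar R := (\int[mu]_(s in `[x, y]) (ray_density p m dw s)%:E)%E.

Let md (E : set R) : E `<=` `]0, +oo[%classic -> measurable_fun E (fun s => (ray_density p m dw s)%:E).
Proof.
move=> EO; apply/measurable_EFinP; apply: measurable_funS EO _ => //.
exact: measurable_ray_density.
Qed.

Let xyO (x y : R) : 0 < x -> `[x, y]%classic `<=` (`]0%R, +oo[%classic : set R).
Proof.
by move=> x0 s; rewrite /= !in_itv/= andbT => /andP[+ _]; exact: lt_le_trans.
Qed.

Let I0 x y : (0 <= I x y)%E.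
Proof. by apply: integral_ge0 => s _; rewrite lee_fin ray_density_ge0. Qed.

Let IM2 x y z : 0 < x -> x <= y -> y <= z -> (I x y + I y z <= M%:E)%E.
Proof.
move=> x0 xy yz; have yp : 0 < y := lt_le_trans x0 xy.
apply: le_trans wM.
have -> : (I y z = \int[mu]_(s in `]y, z]) (ray_density p m dw s)%:E)%E.
  rewrite /I integral_itv_obnd_cbnd//; apply: md => s.
  by rewrite /= !in_itv/= andbT => /andP[+ _]; exact: lt_trans.
rewrite -ge0_integral_setU//=.
- apply: ge0_subset_integral => //=.
  + exact: measurableU.
  + exact: md.
  + by move=> s _; rewrite lee_fin ray_density_ge0.
  + move=> s [|]; first exact: xyO.
    by rewrite /= !in_itv/= andbT => /andP[+ _]; exact: lt_trans.
- apply: md => s [|]; first exact: xyO.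
  by rewrite /= !in_itv/= andbT => /andP[+ _]; exact: lt_trans.
- by move=> s _; rewrite lee_fin ray_density_ge0.
- apply/disj_set2P/seteqP; split => s //=; rewrite !in_itv/=.
  by move=> [/andP[_ sy] /andP[ys _]]; have := le_lt_trans sy ys; rewrite ltxx.
Qed.

Let IM x y : 0 < x -> x <= y -> (I x y <= M%:E)%E.
Proof.
move=> x0 xy; apply: le_trans (IM2 x0 xy (lexx y)).
by rewrite leeDl.
Qed.

Let Ifin x y : 0 < x -> x <= y -> I x y = (fine (I x y))%:E.
Proof.
move=> x0 xy; rewrite fineK// ge0_fin_numE//; exact: le_lt_trans (IM x0 xy) (ltry M).
Qed.

(** Normalisation that gives Hoelder's inequality the form |v y - v x| <= e^(1/p) (T x - T y)^(1/q)
    with total energy at most 1, as [moser_gap] expects: [v] absorbs [alpha], and [kappa] is forced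
    by kappa^(1/p) = (alpha / (A b))^(1/q). The hypothesis [aM] amounts to kappa M <= 1. *)
Let kappa := (alpha / (A * b)) `^ (p - 1).
Let e x y := kappa * fine (I x y).
Let v s := alpha `^ q^-1 * `|w s|.

Let kappa0 : 0 <= kappa. Proof. exact: powR_ge0. Qed.
Let e0 x y : 0 <= e x y. Proof. by rewrite mulr_ge0// fine_ge0. Qed.
Let v0 s : 0 <= v s. Proof. by rewrite mulr_ge0// powR_ge0. Qed.
Let Ab0 : 0 < A * b. Proof. by rewrite mulr_gt0. Qed.

Let kM : kappa * M <= 1.
Proof.
have an0 : p - 1 != 0 by rewrite gt_eqF.
have c0 : 0 <= alpha / (A * b) by rewrite divr_ge0// ltW.
have -> : kappa * M = (alpha / (A * b) * M `^ (p - 1)^-1) `^ (p - 1).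
  by rewrite powRM ?powR_ge0// -powRrM mulVf// powRr1.
apply: (@le_trans _ _ (1 `^ (p - 1))); last by rewrite powR1.
apply: ge0_ler_powR; rewrite ?nnegrE ?(ltW a0)//.
  by rewrite mulr_ge0// powR_ge0.
by rewrite mulrAC ler_pdivrMr// mul1r.
Qed.

Let vq s : v s `^ q = alpha * `|w s| `^ q.
Proof.
by rewrite /v powRM ?powR_ge0// -powRrM mulVf ?powRr1// gt_eqF.
Qed.

Let v_hoelder x y : 0 < x -> x < y ->
  `|v y - v x| <= e x y `^ p^-1 * (A * (x `^ (- b) - y `^ (- b))) `^ q^-1.
Proof.
move=> x0 xy.
have xy1 : y `^ (- b) <= x `^ (- b).
  by apply: ler_powRN => //; [rewrite oppr_le0 ltW|exact: ltW].
have D0 : 0 <= x `^ (- b) - y `^ (- b) by rewrite subr_ge0.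
have := ray_hoelder p1 pm dwE cdw x0 xy; rewrite -/b -/q -/(I x y).
rewrite (Ifin x0 (ltW xy)) poweR_EFin -EFinM lee_fin => h.
rewrite /v -mulrBr normrM ger0_norm ?powR_ge0//.
apply: (@le_trans _ _ (alpha `^ q^-1 * `|w y - w x|)).
  by rewrite ler_wpM2l ?powR_ge0// ler_dist_dist.
apply: (@le_trans _ _ (alpha `^ q^-1 * (fine (I x y) `^ p^-1 *
     ((x `^ (- b) - y `^ (- b)) / b) `^ q^-1))).
  by rewrite ler_wpM2l ?powR_ge0.
have c0 : 0 <= alpha / (A * b) by rewrite divr_ge0// ltW.
have fI : 0 <= fine (I x y) by rewrite fine_ge0.
rewrite /e (powRM _ kappa0 fI) /kappa -powRrM -qE mulrCA -[leRHS]mulrA [leRHS]mulrCA.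
rewrite ler_wpM2l ?powR_ge0//.
have AD : 0 <= A * (x `^ (- b) - y `^ (- b)) by rewrite mulr_ge0// ltW.
have Db : 0 <= (x `^ (- b) - y `^ (- b)) / b by rewrite divr_ge0// ltW.
rewrite -(powRM _ alpha0 Db) -(powRM _ c0 AD).
rewrite le_eqVlt; apply/orP; left; apply/eqP; congr powR.
by field; rewrite (gt_eqF b0) (gt_eqF A0).
Qed.

(** Energy spent between s and [y0], beyond which [w] vanishes. [T] plays the role of time and
    increases inwards from the boundary. *)
Let e1 s := if s < y0 then e s y0 else 0.

Let e1_ge0 s : 0 <= e1 s. Proof. by rewrite /e1; case: ifP. Qed.

Let v_e1 s : ray_dom s -> v s <= e1 s `^ p^-1 * T s `^ q^-1.
Proof.
move=> [s0 sr]; rewrite /e1; case: ltP => [sy|ys]; last first.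
  by rewrite /v w0// normr0 mulr0 mulr_ge0 ?powR_ge0.
have -> : v s = `|v y0 - v s|.
  by rewrite [v y0]/v w0// normr0 mulr0 sub0r normrN ger0_norm.
apply: (le_trans (v_hoelder s0 sy)); rewrite ler_wpM2l ?powR_ge0//.
have ysb : y0 `^ (- b) <= s `^ (- b).
  by apply: ler_powRN => //; [rewrite oppr_le0 ltW|exact: ltW].
apply: ge0_ler_powR; rewrite ?nnegrE ?invr_ge0 ?(ltW q0)//.
- by rewrite mulr_ge0 ?(ltW A0)// subr_ge0.
- by rewrite mulr_ge0 ?(ltW A0)// subr_ge0 ltW.
- by rewrite ler_pM2l// lerD2l lerN2.
Qed.

Let e1_e x s : 0 < x -> x < s -> e1 s + e x s <= 1.
Proof.
move=> x0 xs; rewrite /e1; case: ltP => sy.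
  rewrite /e -mulrDr; apply: le_trans kM; rewrite ler_wpM2l//.
  rewrite -lee_fin EFinD -!Ifin ?(ltW xs) ?(ltW sy)//; last exact: lt_trans xs.
  by rewrite addeC; apply: IM2 => //; exact: ltW.
rewrite add0r /e; apply: le_trans kM; rewrite ler_wpM2l//.
by rewrite -lee_fin -Ifin ?(ltW xs)//; apply: IM => //; exact: ltW.
Qed.

Let e1_le1 s : 0 < s -> e1 s <= 1.
Proof.
move=> s0; have s2 : s / 2 < s by rewrite ltr_pdivrMr// ltr_pMr// ltr1n.
apply: le_trans (e1_e _ s2); last by rewrite divr_gt0.
by rewrite lerDl.
Qed.

Let v_le_T s : ray_dom s -> v s `^ q <= T s.
Proof.
move=> sd; have s0 := sd.1; have T0 := ltW (T_gt0 sd).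
apply: (@le_trans _ _ ((T s `^ q^-1) `^ q)).
  apply: ge0_ler_powR; rewrite ?nnegrE ?powR_ge0 ?(ltW q0)//.
  apply: (le_trans (v_e1 sd)); rewrite -[leRHS]mul1r ler_wpM2r ?powR_ge0//.
  apply: (@le_trans _ _ (1 `^ p^-1)); last by rewrite powR1.
  apply: ge0_ler_powR; rewrite ?nnegrE ?invr_ge0 ?(ltW p0)//.
  exact: e1_le1.
by rewrite -powRrM mulVf ?gt_eqF// powRr1.
Qed.

Let gap x y l : 0 < l -> ray_dom x -> ray_dom y -> x < y ->
  K * l <= T y -> T x - v x `^ q <= l -> T y - v y `^ q <= l -> T x - T y <= K * l.
Proof.
move=> l0 xd yd xy Ky hx hy; have x0 := xd.1.
have TE : A * (x `^ (- b) - y `^ (- b)) = T x - T y by rewrite /T; ring.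
have xy1 : y `^ (- b) <= x `^ (- b).
  by apply: ler_powRN => //; [rewrite oppr_le0 ltW|exact: ltW].
apply: (@moser_gap R p (T y) (T x - T y) l (v y) (v x) (e1 y) (e x y)) => //.
- by rewrite -TE mulr_ge0 ?(ltW A0)// subr_ge0.
- exact: e1_e.
- exact: v_e1.
- rewrite -TE -lerBlDl; apply: le_trans (v_hoelder x0 xy).
  by rewrite distrC ler_norm.
- by have -> : T y + (T x - T y) = T x by ring.
Qed.

(** By [gap], any two points with defect at most n + 1 and T at least K (n + 1) have values of T
    within K (n + 1) of each other. They fit into a slab around any one of them, and the remaining
    points into the slab next to the boundary. Slabs are written in the variable s^(-b) = rb + T /
    A. *)
Let cover (n : nat) : exists c : R, 0 <= c /\ forall s, ray_dom s -> T s - v s `^ q <= n.+1%:R ->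
  slab b rb (rb + K * n.+1%:R / A) s \/
  slab b (Num.max 0 (c - K * n.+1%:R / A)) (c + K * n.+1%:R / A) s.
Proof.
have slab1 s : ray_dom s -> T s <= K * n.+1%:R -> slab b rb (rb + K * n.+1%:R / A) s.
  move=> [s0 sr] h; split => //; rewrite (ltW sr)/= -lerBlDl ler_pdivlMr//.
  by rewrite mulrC.
have [[y [yd yK yl]]|none] := pselect (exists y, [/\ ray_dom y, K * n.+1%:R <= T y &
    T y - v y `^ q <= n.+1%:R]); last first.
  exists 0; split => // s sd sl; left; apply: slab1 => //.
  by rewrite leNgt; apply/negP => /ltW h; apply: none; exists s.
exists (y `^ (- b)); split; first exact: powR_ge0.
move=> s sd sl; have [h|/ltW h] := leP (T s) (K * n.+1%:R); [left; exact: slab1|right].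
have : `|T s - T y| <= K * n.+1%:R.
  have [sy|ys|->] := ltgtP s y; last by rewrite subrr normr0 mulr_ge0// ltW.
    have le1 : T s - T y <= K * n.+1%:R by apply: gap.
    have : T y <= T s.
      rewrite /T ler_pM2l// lerD2r; apply: ler_powRN; rewrite ?oppr_le0 ?(ltW b0) ?(ltW sy)//.
      exact: sd.1.
    by rewrite -subr_ge0 => /ger0_norm ->.
  have le1 : T y - T s <= K * n.+1%:R by apply: gap.
  have : T s <= T y.
    rewrite /T ler_pM2l// lerD2r; apply: ler_powRN; rewrite ?oppr_le0 ?(ltW b0) ?(ltW ys)//.
    exact: yd.1.
  by rewrite distrC -subr_ge0 => /ger0_norm ->.
have -> : T s - T y = A * (s `^ (- b) - y `^ (- b)) by rewrite /T; ring.
rewrite normrM gtr0_norm// mulrC -ler_pdivlMr// ler_distl => /andP[h1 h2].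
by split; [exact: sd.1|rewrite ge_max powR_ge0 h1 h2].
Qed.

(** Where the integer part of T - v^q is n, the exponential is at most e^(-n), and the two slabs of
    [cover] have total length at most 3 K (n + 1) / A. With n + 1 <= 2 e^(n/2) the terms are
    dominated by a geometric series of ratio e^(-1/2), hence the 6 and the last factor. *)
Lemma moser_ray_bound :
  (\int[mu]_(s in ray_dom) (expR (alpha * `|w s| `^ q - T s) * s `^ (- b - 1))%:E <=
   (6 * K / (A * b) / (1 - expR (- 2^-1)))%:E)%E.
Proof.
have [c /= hc] := choice cover.
pose S1 n := slab b rb (rb + K * n.+1%:R / A).
pose S2 n := slab b (Num.max 0 (c n - K * n.+1%:R / A)) (c n + K * n.+1%:R / A).
pose h (E : set R) (s : R) : \bar R := (\1_E s * s `^ (- b - 1))%:E.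
have h0 E s : (0 <= h E s)%E by rewrite lee_fin mulr_ge0 ?powR_ge0// indicE.
have mh E D : measurable E -> measurable_fun D (h E).
  move=> mE; apply: measurable_funTS; apply/measurable_EFinP.
  by apply: measurable_funM; [exact: measurable_indic|exact: measurable_powR].
have mS1 n : measurable (S1 n) by exact: measurable_slab.
have mS2 n : measurable (S2 n) by exact: measurable_slab.
pose g n s := ((expR (- n%:R))%:E * (h (S1 n) s + h (S2 n) s))%E.
have g0 n s : (0 <= g n s)%E by apply: mule_ge0; [rewrite lee_fin expR_ge0|exact: adde_ge0].
have mg n D : measurable_fun D (g n).
  by apply: measurable_funeM; apply: emeasurable_funD; exact: mh.
apply: (@le_trans _ _ (\int[mu]_(s in ray_dom) \sum_(n <oo) g n s)%E).
  apply: ge0_le_integral => //=.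
  - exact: measurable_ray_dom.
  - by move=> s _; rewrite lee_fin mulr_ge0 ?powR_ge0 ?expR_ge0.
  - apply/measurable_EFinP; apply: measurable_funM; last first.
      by apply: measurable_funTS; exact: measurable_powR.
    apply: measurableT_comp => //; apply: measurable_funB; last first.
      apply: measurable_funTS; apply: measurable_funM => //.
      by apply: measurable_funB => //; exact: measurable_powR.
    apply: measurable_funM => //; apply: (measurableT_comp (@measurable_powR R q)).
    apply: measurableT_comp => //.
    by apply: measurable_funS ray_dom_gt0 (measurable_ray_fun dwE).
  - by apply: (ge0_emeasurable_sum (P := xpredT)) => // n *; exact: mg.
  move=> s sd; have Tv := v_le_T sd.
  pose F := T s - v s `^ q; pose n := truncn F.
  have F0 : 0 <= F by rewrite subr_ge0.
  have nF : n%:R <= F by rewrite truncn_le.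
  have Fn : F <= n.+1%:R by rewrite ltW// truncnS_gt.
  apply: (@le_trans _ _ (g n s)); last first.
    apply: (@le_trans _ _ (\sum_(0 <= i < n.+1) g i s)%E); last exact: nneseries_lim_ge.
    by rewrite big_nat_recr//= leeDr// sume_ge0.
  rewrite -vq -opprB -/F EFinM /g; apply: lee_pmul; [by rewrite lee_fin expR_ge0|by rewrite lee_fin powR_ge0|
    by rewrite lee_fin ler_expR lerN2|].
  - case: (hc n) => _ /(_ s sd Fn)[s1|s1].
      by apply: (@le_trans _ _ (h (S1 n) s)); [rewrite /h indicE mem_set// mul1r|rewrite leeDl].
    by apply: (@le_trans _ _ (h (S2 n) s)); [rewrite /h indicE mem_set// mul1r|rewrite leeDr].
rewrite integral_nneseries//; last 2 first.
- exact: measurable_ray_dom.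
- by move=> n; exact: mg.
have hI E : measurable E -> (\int[mu]_s h E s = \int[mu]_(s in E) (s `^ (- b - 1))%:E)%E.
  move=> mE; rewrite [RHS]integral_mkcond; apply: eq_integral => s _.
  by rewrite /h indicE patchE; case: ifPn; rewrite ?mul1r ?mul0r.
pose z : R := expR (- 2^-1).
have z0 : 0 < z by exact: expR_gt0.
have z1 : `|z| < 1 by rewrite gtr0_norm// expR_lt1 oppr_lt0 invr_gt0.
have term n : (\int[mu]_(s in ray_dom) g n s <= (6 * K / (A * b) * z ^+ n)%:E)%E.
  pose d := K * n.+1%:R / A.
  have d0 : 0 <= d by rewrite divr_ge0 ?mulr_ge0// ?(ltW K0)// ltW.
  apply: (@le_trans _ _ (\int[mu]_s g n s)%E).
    apply: ge0_subset_integral => //; [exact: measurable_ray_dom|exact: mg].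
  have mhh : measurable_fun setT (fun s => h (S1 n) s + h (S2 n) s)%E.
    by apply: emeasurable_funD; exact: mh.
  have hh0 s : setT s -> (0 <= h (S1 n) s + h (S2 n) s)%E by move=> _; exact: adde_ge0.
  have en : (0 <= (expR (- n%:R : R))%:E)%E by rewrite lee_fin expR_ge0.
  rewrite /g (ge0_integralZl mu measurableT mhh hh0 en).
  rewrite ge0_integralD//; [|exact: mh|exact: mh].
  rewrite !hI//.
  apply: (@le_trans _ _ ((expR (- n%:R))%:E * ((d / b)%:E + (2 * d / b)%:E))%E).
    apply: lee_wpmul2l; first by rewrite lee_fin expR_ge0.
    apply: leeD.
      have := @le_integral_slab R b rb (rb + d) b0 rb0; rewrite lerDl d0 => /(_ isT).
      by move/le_trans; apply; rewrite lee_fin addrAC subrr add0r.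
    have c0 := (hc n).1.
    have := @le_integral_slab R b (Num.max 0 (c n - d)) (c n + d) b0.
    rewrite le_max lexx/= => /(_ isT); rewrite ge_max addr_ge0//=.
    have cd : c n - d <= c n + d by lra.
    rewrite cd => /(_ isT) /le_trans; apply; rewrite lee_fin ler_pM2r ?invr_gt0//.
    have : c n - d <= Num.max 0 (c n - d) by rewrite le_max lexx orbT.
    by lra.
  rewrite -EFinD -EFinM lee_fin.
  have -> : expR (- n%:R) * (d / b + 2 * d / b) = 3 * K / (A * b) * (n.+1%:R * expR (- n%:R)).
    by rewrite /d; field; rewrite !gt_eqF.
  have -> : 6 * K / (A * b) * z ^+ n = 3 * K / (A * b) * (2 * z ^+ n) by ring.
  rewrite ler_wpM2l//; first by rewrite !mulr_ge0 ?invr_ge0 ?(ltW K0) ?(ltW Ab0).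
  have -> : z ^+ n = expR (n%:R / 2) * expR (- n%:R).
    by rewrite /z -expRM_natl -expRD; congr expR; lra.
  rewrite mulrA ler_wpM2r ?expR_ge0//.
  have -> : n.+1%:R = n%:R + 1 :> R by rewrite natr1.
  have := expR_ge1Dx (n%:R / 2 : R); lra.
apply: lime_le; first by apply: is_cvg_nneseries => n _ _; apply: integral_ge0.
apply: nearW => n.
apply: (@le_trans _ _ (\sum_(0 <= i < n) (6 * K / (A * b) * z ^+ i)%:E)%E).
  by apply: lee_sum => i _; exact: term.
rewrite sumEFin lee_fin.
have := @geometric_le_lim R n (6 * K / (A * b)) z; rewrite seriesEnat/=; apply => //.
by rewrite !mulr_ge0 ?invr_ge0 ?(ltW K0) ?(ltW Ab0).
Qed.

End one_function.
End moser_ray.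

(** * Smooth functions *)

Section directional_derivatives.
Context {R : realType} {V : normedModType R}.
Implicit Types (f g : V -> R) (x u v e : V).

Lemma is_derive_cvgP f x v (d : R) :
  is_derive x v f d <-> h^-1 * (f (h *: v + x) - f x) @[h --> 0^'] --> d.
Proof.
split=> [[df <-]|]; first exact: df.
by move=> h; split; [apply/cvg_ex; exists d|exact: cvg_lim].
Qed.

Lemma is_derive_line f x v (t d : R) : is_derive (t *: v + x) v f d ->
  is_derive t (1:R) (fun s : R => f (s *: v + x)) d.
Proof.
move=> /is_derive_cvgP fd; split.
  apply/cvg_ex; exists d; apply: cvg_trans fd; apply: near_eq_cvg; apply: nearW => h.
  by rewrite /= -[(h *: 1)%R]/(h * 1) mulr1 scalerDl addrA.
apply/cvg_lim => //; apply: cvg_trans fd; apply: near_eq_cvg; apply: nearW => h.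
by rewrite /= -[(h *: 1)%R]/(h * 1) mulr1 scalerDl addrA.
Qed.

Lemma is_derive_lineP f x v (d : R) :
  is_derive (0:R) (1:R) (fun s : R => f (s *: v + x)) d -> is_derive x v f d.
Proof.
case=> df <-; apply/is_derive_cvgP; apply: cvg_trans df.
apply: near_eq_cvg; apply: nearW => h /=.
by rewrite /= -[(h *: 1)%R]/(h * 1) mulr1 addr0 scale0r add0r.
Qed.

(** Only the derivative of [f] in the single direction [v] is assumed, so the chain rule is reduced
    to one variable by restricting [f] to a line. *)
Lemma is_derive_comp_fun f (h : R -> R) x v (a d : R) :
  is_derive (f x) (1:R) h a -> is_derive x v f d ->
  is_derive x v (h \o f) (a * d).
Proof.
move=> ha fd; apply: is_derive_lineP.
have fd0 : is_derive (0 *: v + x) v f d by rewrite scale0r add0r.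
have := is_derive_line fd0; set F := (fun s : R => _) => dF.
have hF : is_derive (F 0) (1:R) h a by rewrite /F scale0r add0r.
exact: is_derive1_comp.
Qed.

(* Along [u + c *: e] the increment splits into an increment along [u] and one
   along [e] at a nearby point, which the mean value theorem controls. *)
Lemma is_derive_addl f x u e (c D : R) :
  is_derive x u f D -> (forall y, derivable f y e) ->
  {for x, continuous (fun y => 'D_e f y)} ->
  is_derive x (c *: e + u) f (c * 'D_e f x + D).
Proof.
move=> /is_derive_cvgP fu fe ce; apply/is_derive_cvgP.
have mvt (z : V) (t : R) : exists2 k : R, `|k| <= `|t| &
    f (t *: e + z) - f z = 'D_e f (k *: e + z) * t.
  pose g s := f (s *: e + z).
  have dg (s : R) : is_derive s (1:R) g ('D_e f (s *: e + z)).
    by apply: is_derive_line; split.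
  have cg : continuous g.
    move=> s; apply: differentiable_continuous; apply/derivable1_diffP.
    exact: (@ex_derive _ _ _ _ _ _ _ (dg s)).
  have g0 : g 0 = f z by rewrite /g scale0r add0r.
  have [t0|t0] := leP 0 t.
    have [k] := @MVT_segment R g (fun s => 'D_e f (s *: e + z)) 0 t t0 (fun s _ => dg s) (continuous_subspaceT cg).
    rewrite in_itv/= => /andP[k0 kt] E; exists k; first by rewrite !ger0_norm.
    by rewrite -g0 -/(g t) E subr0.
  have [k] := @MVT_segment R g (fun s => 'D_e f (s *: e + z)) t 0 (ltW t0) (fun s _ => dg s) (continuous_subspaceT cg).
  rewrite in_itv/= => /andP[k0 kt] E; exists k; first by rewrite !ler0_norm ?lerN2// ltW.
  by rewrite -g0 -/(g t) -opprB E sub0r mulrN opprK.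
have -> : (fun h : R => h^-1 * (f (h *: (c *: e + u) + x) - f x)) =
  (fun h => h^-1 * (f ((h * c) *: e + (h *: u + x)) - f (h *: u + x)) +
     h^-1 * (f (h *: u + x) - f x)).
  by apply/funext => h; rewrite -mulrDr addrA subrK scalerDr scalerA addrA.
apply: cvgD => //.
apply/cvgrPdist_le => eps eps0.
pose eps' := eps / (`|c| + 1).
have c1 : 0 < `|c| + 1 by rewrite ltr_wpDl.
have eps'0 : 0 < eps' by rewrite divr_gt0.
have /cvgrPdist_le /(_ _ eps'0) /nbhs_ballP[d /= d0 hd] := ce.
pose B := `|c| * `|e| + `|u| + 1.
have B0 : 0 < B by rewrite ltr_wpDl// addr_ge0// mulr_ge0.
near=> h.
have h0 : h != 0 by near: h; exact: nbhs_dnbhs_neq.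
have hB : `|h| < d / B.
  near: h; apply: nbhs_dnbhs; apply/nbhs_ballP; exists (d / B) => /=; first by rewrite divr_gt0.
  by move=> y; rewrite /ball/= sub0r normrN.
have [k kh E] := mvt (h *: u + x) (h * c).
rewrite E.
have -> : h^-1 * ('D_e f (k *: e + (h *: u + x)) * (h * c)) =
  c * 'D_e f (k *: e + (h *: u + x)) by field.
rewrite -mulrBr normrM.
have : `|'D_e f x - 'D_e f (k *: e + (h *: u + x))| <= eps'.
  apply: hd; rewrite -ball_normE /ball_/=.
  have -> : x - (k *: e + (h *: u + x)) = - (k *: e + h *: u).
    by rewrite addrA opprD addrCA subrr addr0.
  rewrite normrN; apply: (le_lt_trans (ler_normD _ _)).
  rewrite !normrZ.
  apply: (@le_lt_trans _ _ (`|h| * B)).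
    rewrite /B mulrDr mulrDr mulr1 mulrA -[leLHS]addr0; apply: lerD => //; apply: lerD => //.
    by rewrite ler_wpM2r// -normrM.
  by rewrite -ltr_pdivlMr.
move=> h1; apply: (@le_trans _ _ (`|c| * eps')); first by rewrite ler_wpM2l.
rewrite /eps' mulrA ler_pdivrMr// [leRHS]mulrC ler_wpM2r ?(ltW eps0)//.
by rewrite lerDl.
Unshelve. all: by end_near. Qed.

End directional_derivatives.

(** * Iterated differentiability along a family of directions *)

Section differentiability_class.
Context {R : realType} {V : normedModType R} {I : Type} (e : I -> V).
Implicit Types (f g : V -> R) (U : set V).

(** [n] times continuously differentiable along the directions [e i] at the points of [U]. The set
    is a parameter because powers are smooth away from 0 only. It has to be open wherever a function
    is replaced by one that equals it on [U]. *)
Fixpoint Cn (n : nat) U f : Prop :=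
  (forall x, U x -> {for x, continuous f}) /\
  if n is k.+1 then
    forall i, (forall x, U x -> derivable f x (e i)) /\ Cn k U (fun x => 'D_(e i) f x)
  else True.

Lemma Cn_continuous n U f : Cn n U f -> forall x, U x -> {for x, continuous f}.
Proof. by case: n => [|n] []. Qed.

Lemma CnS n U f : Cn n.+1 U f -> Cn n U f.
Proof.
elim: n f => [|n IH] f [cf fd]; first by split.
by split=> // i; have [di] := fd i; split => //; exact: IH.
Qed.

Lemma Cn_ext n U f g : open U -> (forall x, U x -> f x = g x) -> Cn n U f -> Cn n U g.
Proof.
move=> oU; elim: n f g => [|n IH] f g fg [cf fd]; split => //.
- move=> x Ux; apply: cvg_trans; last first.
    by rewrite -(fg x Ux); exact: cf.
  by apply: near_eq_cvg; apply: filterS (open_nbhs_nbhs (conj oU Ux)) => y; exact: fg.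
- move=> x Ux; apply: cvg_trans; last first.
    by rewrite -(fg x Ux); exact: cf.
  by apply: near_eq_cvg; apply: filterS (open_nbhs_nbhs (conj oU Ux)) => y; exact: fg.
have nfg x : U x -> \near x, f x = g x.
  by move=> Ux; apply: filterS (open_nbhs_nbhs (conj oU Ux)) => y; exact: fg.
move=> i; have [fi ci] := fd i; split.
  by move=> x Ux; apply: near_eq_derivable (nfg x Ux) _; exact: fi.
by apply: IH ci => x Ux; apply: near_eq_derive; exact: nfg.
Qed.

Lemma Cn_sub n U U' f : U' `<=` U -> Cn n U f -> Cn n U' f.
Proof.
move=> UU; elim: n f => [|n IH] f [cf fd]; split => //; try by move=> x /UU; exact: cf.
by move=> i; have [fi ci] := fd i; split; [move=> x /UU; exact: fi|exact: IH].
Qed.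

Lemma Cn_setU n U U' f : Cn n U f -> Cn n U' f -> Cn n (U `|` U') f.
Proof.
elim: n f => [|n IH] f [cf fd] [cf' fd'].
  by split => // x [/cf|/cf'].
split; first by move=> x [/cf|/cf'].
move=> i; have [fi ci] := fd i; have [fi' ci'] := fd' i.
by split; [move=> x [/fi|/fi']|exact: IH].
Qed.

Lemma Cn_cst n U (c : R) : Cn n U (cst c).
Proof.
elim: n c => [|n IH] c; first by split => // x _; exact: cst_continuous.
split; first by move=> x _; exact: cst_continuous.
move=> i; split; first by move=> x _; exact: derivable_cst.
rewrite (_ : (fun x => _) = cst 0)//.
by apply/funext => x; rewrite derive_cst.
Qed.

Lemma Cn_add n U f g : open U -> Cn n U f -> Cn n U g -> Cn n U (f + g).
Proof.
move=> oU; elim: n f g => [|n IH] f g [cf fd] [cg gd].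
  by split => // x Ux; apply: cvgD; [exact: cf|exact: cg].
split; first by move=> x Ux; apply: cvgD; [exact: cf|exact: cg].
move=> i; have [fi ci] := fd i; have [gi di] := gd i; split.
  by move=> x Ux; apply: derivableD; [exact: fi|exact: gi].
apply: (Cn_ext oU _ (IH _ _ ci di)) => x Ux /=.
by rewrite deriveD; [|exact: fi|exact: gi].
Qed.

Lemma Cn_mul n U f g : open U -> Cn n U f -> Cn n U g -> Cn n U (f * g).
Proof.
move=> oU; elim: n f g => [|n IH] f g Cf Cg.
  have [[cf _] [cg _]] := (Cf, Cg).
  by split => // x Ux; apply: cvgM; [exact: cf|exact: cg].
have [[cf fd] [cg gd]] := (Cf, Cg).
split; first by move=> x Ux; apply: cvgM; [exact: cf|exact: cg].
move=> i; have [fi ci] := fd i; have [gi di] := gd i; split.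
  by move=> x Ux; apply: derivableM; [exact: fi|exact: gi].
apply: (Cn_ext oU _ (Cn_add oU (IH _ _ (CnS Cf) di) (IH _ _ (CnS Cg) ci))) => x Ux /=.
by rewrite deriveM; [|exact: fi|exact: gi].
Qed.

Lemma Cn_scale n U (c : R) f : open U -> Cn n U f -> Cn n U (fun x => c * f x).
Proof. by move=> oU Cf; exact: (Cn_mul oU (Cn_cst n U c) Cf). Qed.

Lemma Cn_sum n U (J : Type) (s : seq J) (F : J -> V -> R) : open U ->
  (forall j, Cn n U (F j)) -> Cn n U (fun x => \sum_(j <- s) F j x).
Proof.
move=> oU CF; elim: s => [|j s IH].
  by apply: (Cn_ext oU _ (Cn_cst n U 0)) => x _; rewrite big_nil.
by apply: (Cn_ext oU _ (Cn_add oU (CF j) IH)) => x _; rewrite big_cons.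
Qed.

End differentiability_class.

Section composition.
Context {R : realType} {V : normedModType R} {I : Type} (e : I -> V).

Definition Cn1 := @Cn R R unit (fun=> 1).

(** Induction through (h o f)' = (h' o f) f', whose factors have one order less. This avoids any
    formula for higher derivatives. *)
Lemma Cn_comp n (U : set V) (W : set R) (h : R -> R) (f : V -> R) :
  open U -> (forall x, U x -> W (f x)) -> Cn1 n W h -> Cn e n U f -> Cn e n U (h \o f).
Proof.
move=> oU UW; elim: n h f UW => [|n IH] h f UW Ch Cf.
  split => // x Ux; apply: continuous_comp; first exact: Cn_continuous Cf _ Ux.
  by apply: (Cn_continuous Ch); exact: UW.
split.
  move=> x Ux; apply: continuous_comp; first exact: Cn_continuous Cf _ Ux.
  by apply: (Cn_continuous Ch); exact: UW.
have [_ /(_ tt)[hd Ch']] := Ch; have [_ fd] := Cf.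
move=> i; have [fi ci] := fd i.
have hf x : U x -> is_derive x (e i) (h \o f) ('D_1 h (f x) * 'D_(e i) f x).
  move=> Ux; apply: is_derive_comp_fun.
    by split => //; apply: hd; exact: UW.
  by split => //; exact: fi.
split; first by move=> x Ux; exact: (@ex_derive _ _ _ _ _ _ _ (hf x Ux)).
apply: (Cn_ext oU _ (Cn_mul oU (IH _ _ UW Ch' (CnS Cf)) ci)) => x Ux.
by rewrite (@derive_val _ _ _ _ _ _ _ (hf x Ux)).
Qed.

Lemma Cn1_powR n (k : R) : Cn1 n [set s | 0 < s] (@powR R ^~ k).
Proof.
have o0 : open [set s : R | 0 < s] by exact: open_gt.
have cp (a x : R) : 0 < x -> {for x, continuous (@powR R ^~ a)}.
  move=> x0; apply: differentiable_continuous; apply/derivable1_diffP.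
  by apply: derivable_powR; rewrite in_itv/= x0.
elim: n k => [|n IH] k; first by split => // x x0; exact: cp.
split; first by move=> x x0; exact: cp.
move=> _; split; first by move=> x x0; apply: derivable_powR; rewrite in_itv/= andbT.
apply: (Cn_ext o0 _ (Cn_scale k o0 (IH (k - 1)))) => x x0.
by rewrite (@derive_val _ _ _ _ _ _ _ (is_derive1_powR k x0)).
Qed.

Lemma Cn1_id n U : Cn1 n U id.
Proof.
case: n => [|n]; first by split => // x _; exact: cvg_id.
split; first by move=> x _; exact: cvg_id.
move=> _; split; first by move=> x _; exact: derivable_id.
rewrite (_ : (fun x => _) = cst 1); first exact: Cn_cst.
by apply/funext => x; rewrite derive_id.
Qed.

End composition.

(** * Smooth functions flat at the origin *)

Section flat_functions.
Context {R : realType}.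

(** All values of [m] are treated together because derivation stays within the span of these
    functions: the derivative of [flat m] is [flat m.+2] minus m times [flat m.+1]. *)
Definition flat (m : nat) (y : R) : R :=
  if 0 < y then y^-1 ^+ m * expR (- y^-1) else 0.

Lemma flat_ge0 m y : 0 <= flat m y.
Proof. by rewrite /flat; case: ltP => // y0; rewrite mulr_ge0 ?expR_ge0// exprn_ge0// invr_ge0 ltW. Qed.

Lemma flat_le m (y : R) : flat m y <= m.+1`!%:R * `|y|.
Proof.
rewrite /flat; case: ltP => y0; last by rewrite mulr_ge0.
rewrite gtr0_norm// expRN ler_pdivrMr ?expR_gt0//.
have yV0 : 0 <= y^-1 by rewrite invr_ge0 ltW.
have := @expR_ge1Dxn R y^-1 m yV0 => h.
have {}h : y^-1 ^+ m.+1 <= m.+1`!%:R * expR y^-1.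
  by rewrite mulrC -ler_pdivrMr ?ltr0n ?fact_gt0//; apply: le_trans h; rewrite lerDr.
rewrite mulrAC mulrC.
have -> : y^-1 ^+ m = y * y^-1 ^+ m.+1 by rewrite exprS mulrA divff ?mul1r// gt_eqF.
by rewrite ler_pM2l.
Qed.

Lemma is_derive_flat m (y : R) :
  is_derive y 1 (flat m) (flat m.+2 y - m%:R * flat m.+1 y).
Proof.
have [y0|y0|->] := ltgtP y 0.
- have -> : flat m.+2 y - m%:R * flat m.+1 y = 0.
    by rewrite /flat ltNge (ltW y0)/= mulr0 subr0.
  have H : is_derive y (1:R) (cst (0:R)) 0 by exact: is_derive_cst.
  apply: near_eq_is_derive H; near=> z.
  have z0 : z < 0 by near: z; exact: lt_nbhsl.
  by rewrite /flat ltNge (ltW z0).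
- pose f := (fun z : R => z^-1).
  have yn0 : y != 0 by rewrite gt_eqF.
  have df : is_derive y 1 f (- y ^- 2 *: 1) by apply: is_deriveV.
  have dh : is_derive y 1 (f ^+ m * (expR \o (- f)))
      ((f ^+ m) y *: (expR ((- f) y) * - (- y ^- 2 *: 1)) +
       (expR \o (- f)) y *: ((m%:R * f y ^+ m.-1) *: (- y ^- 2 *: 1))).
    by apply: is_deriveM.
  have nf : \near y, (f ^+ m * (expR \o (- f))) y = flat m y.
    near=> z; have z0 : 0 < z by near: z; exact: lt_nbhsr.
    by rewrite /flat z0 /= /f /= exprfctE.
  have {dh} := near_eq_is_derive nf dh => dh.
  apply: is_derive_eq; rewrite /flat y0 /f /= exprfctE /GRing.scale/=.
  case: m {dh nf} => [|k] /=; rewrite ?expr0 ?mul0r ?mulr0 ?subr0 ?addr0 !exprS; field.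
  by rewrite gt_eqF.
  by rewrite gt_eqF.
(* At 0 the difference quotient from the right is [flat m.+1], which [flat_le] makes small. *)
- have -> : flat m.+2 (0:R) - m%:R * flat m.+1 0 = 0.
    by rewrite /flat ltxx mulr0 subr0.
  apply/is_derive_cvgP; rewrite {2}/flat ltxx.
  apply/cvgrPdist_le => e e0; near=> h.
  have h0 : h != 0 by near: h; exact: nbhs_dnbhs_neq.
  rewrite sub0r normrN subr0 addr0 -[(h *: 1)%R]/(h * 1) mulr1.
  have [hp|hn] := ltP 0 h; last by rewrite /flat ltNge hn/= mulr0 normr0 ltW.
  have -> : h^-1 * flat m h = flat m.+1 h by rewrite /flat hp exprS mulrA.
  rewrite ger0_norm ?flat_ge0//; apply: (le_trans (flat_le _ _)).
  rewrite mulrC -ler_pdivlMr ?ltr0n ?fact_gt0//.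
  near: h; apply: nbhs_dnbhs; apply/nbhs_ballP.
  exists (e / m.+2`!%:R) => /=; first by rewrite divr_gt0// ltr0n fact_gt0.
  by move=> z; rewrite /ball/= sub0r normrN => /ltW.
Unshelve. all: by end_near. Qed.

Lemma Cn1_flat n m : Cn1 n setT (flat m).
Proof.
have cf k : continuous (flat k).
  move=> x; apply: differentiable_continuous; apply/derivable1_diffP.
  exact: (@ex_derive _ _ _ _ _ _ _ (is_derive_flat k x)).
elim: n m => [|n IH] m; first by split => // x _; exact: cf.
split; first by move=> x _; exact: cf.
move=> _; split; first by move=> x _; exact: (@ex_derive _ _ _ _ _ _ _ (is_derive_flat m x)).
apply: (Cn_ext openT _ (Cn_add openT (IH m.+2) (Cn_scale (- m%:R) openT (IH m.+1)))) => x _.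
by rewrite (@derive_val _ _ _ _ _ _ _ (is_derive_flat m x)) -mulNr.
Qed.

(* A smooth approximation of the positive part of [y]. *)
Definition ramp (y : R) : R := y * flat 0 y.

Lemma Cn1_ramp n : Cn1 n setT ramp.
Proof. exact: (Cn_mul openT (Cn1_id _ _) (Cn1_flat _ _)). Qed.

Definition dramp (y : R) : R := y * flat 2 y + flat 0 y.

Lemma is_derive_ramp (y : R) : is_derive y 1 ramp (dramp y).
Proof.
have d2 := is_derive_flat 0 y.
have : is_derive y (1:R) (id * flat 0) (y *: (flat 2 y - 0%:R * flat 1 y) + flat 0 y *: 1).
  by apply: is_deriveM.
by move=> h; apply: is_derive_eq; rewrite /dramp mul0r subr0 -[(flat 0 y *: 1)%R]/(flat 0 y * 1) mulr1.
Qed.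

Lemma ramp_le0 y : y <= 0 -> ramp y = 0.
Proof. by move=> y0; rewrite /ramp /flat ltNge y0 mulr0. Qed.

Lemma ramp_ge0 y : 0 <= ramp y.
Proof.
have [y0|y0] := leP y 0; first by rewrite ramp_le0.
by rewrite /ramp mulr_ge0 ?flat_ge0// ltW.
Qed.

(** From e^(-1/y) >= 1 - 1/y. The loss of 1 is what later shifts the thresholds of [plateau]. *)
Lemma ramp_ge y : y - 1 <= ramp y.
Proof.
have [y0|y0] := leP y 0; first by rewrite ramp_le0//; lra.
rewrite /ramp /flat y0 expr0 mul1r; have := expR_ge1Dx (- y^-1) => h.
apply: (@le_trans _ _ (y * (1 - y^-1))); last by rewrite ler_wpM2l// ltW.
by rewrite mulrBr mulr1 divff// gt_eqF.
Qed.

Lemma dramp_ge0 y : 0 <= dramp y.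
Proof.
rewrite /dramp addr_ge0 ?flat_ge0//.
have [y0|y0] := leP y 0; first by rewrite /flat ltNge y0 mulr0.
by rewrite mulr_ge0 ?flat_ge0// ltW.
Qed.

(** For y > 0 the derivative is (1 + 1/y) e^(-1/y), and 1 + x <= e^x. *)
Lemma dramp_le1 y : dramp y <= 1.
Proof.
have [y0|y0] := leP y 0; first by rewrite /dramp /flat ltNge y0 mulr0 addr0.
rewrite /dramp /flat y0 expr0 mul1r expRN.
have -> : y * (y^-1 ^+ 2 / expR y^-1) + (expR y^-1)^-1 = (1 + y^-1) / expR y^-1.
  by field; rewrite !gt_eqF// expR_gt0.
by rewrite ler_pdivrMr ?expR_gt0// mul1r expR_ge1Dx.
Qed.

Lemma dramp_le0 y : y <= 0 -> dramp y = 0.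
Proof. by move=> y0; rewrite /dramp /flat ltNge y0 mulr0 addr0. Qed.

Lemma ramp_nd : {homo ramp : x y / x <= y}.
Proof.
move=> x y xy.
have cr : continuous ramp.
  move=> z; apply: differentiable_continuous; apply/derivable1_diffP.
  exact: (@ex_derive _ _ _ _ _ _ _ (is_derive_ramp z)).
have [k _ E] := @MVT_segment R ramp dramp x y xy (fun s _ => is_derive_ramp s) (continuous_subspaceT cr).
by rewrite -subr_ge0 E mulr_ge0 ?dramp_ge0// subr_ge0.
Qed.

End flat_functions.

(** * Euclidean norm and measurability on row vectors *)

Section row_vectors.
Context {R : realType} {N : nat}.
Implicit Types (x v : 'rV[R]_N) (f : 'rV[R]_N -> R).

Lemma smooth_Cn f : (forall n, Cn (fun i : 'I_N => delta_mx ord0 i : 'rV[R]_N) n setT f) -> smooth f.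
Proof.
move=> Cf s.
have H n : Cn (fun i : 'I_N => delta_mx ord0 i : 'rV[R]_N) n setT (iter_partial s f).
  elim: s n => [|i s IH] n; first exact: Cf.
  by have [_ /(_ i)[_]] := IH n.+1.
have [ci di] := H 1%N; split; first by move=> x; exact: ci.
by move=> i x; have [+ _] := di i; exact.
Qed.

Lemma is_derive_coord (i : 'I_N) x v : is_derive x v (fun y : 'rV[R]_N => y ord0 i) (v ord0 i).
Proof.
apply/is_derive_cvgP; apply: (@cvg_near_cst); near=> h.
have h0 : h != 0 by near: h; exact: nbhs_dnbhs_neq.
by rewrite !mxE addrK mulrA mulVf// mul1r.
Unshelve. all: by end_near. Qed.

Lemma Cn_coord {I : Type} (e : I -> 'rV[R]_N) (i : 'I_N) n U :
  Cn e n U (fun y => y ord0 i).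
Proof.
case: n => [|n]; first by split => // x _; exact: coord_continuous.
split; first by move=> x _; exact: coord_continuous.
move=> j; split; first by move=> x _; exact: (@ex_derive _ _ _ _ _ _ _ (is_derive_coord i x (e j))).
rewrite (_ : (fun x => _) = cst (e j ord0 i)); first exact: Cn_cst.
by apply/funext => x; rewrite (@derive_val _ _ _ _ _ _ _ (is_derive_coord i x (e j))).
Qed.

Lemma Cn_enorm2 {I : Type} (e : I -> 'rV[R]_N) n : Cn e n setT (fun y => enorm y ^+ 2).
Proof.
have H : Cn e n setT (fun y => \sum_(i < N) ((fun y : 'rV[R]_N => y ord0 i) * (fun y => y ord0 i)) y).
  by apply: (Cn_sum _ openT) => i; apply: (Cn_mul openT); exact: Cn_coord.
by apply: (Cn_ext openT _ H) => x _; rewrite enorm_sqr.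
Qed.

Lemma continuous_enorm : continuous (@enorm R N).
Proof.
move=> x.
have -> : @enorm R N = Num.sqrt \o (fun y => enorm y ^+ 2).
  by apply/funext => y /=; rewrite sqrtr_sqr ger0_norm// enorm_ge0.
apply: continuous_comp; last exact: sqrt_continuous.
exact: (Cn_continuous (Cn_enorm2 (fun i : 'I_0 => 0) 0)).
Qed.

Lemma is_derive_enorm2 x v : is_derive x v (fun y => enorm y ^+ 2) (2 * \sum_(i < N) x ord0 i * v ord0 i).
Proof.
have -> : (fun y : 'rV[R]_N => enorm y ^+ 2) =
    \sum_(i < N) ((fun y : 'rV[R]_N => y ord0 i) * (fun y => y ord0 i)).
  by apply/funext => y; rewrite enorm_sqr fct_sumE; apply: eq_bigr.
have H i := is_deriveM (is_derive_coord i x v) (is_derive_coord i x v).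
apply: is_derive_eq; rewrite mulr_sumr; apply: eq_bigr => i _.
by rewrite /GRing.scale/=; ring.
Qed.

(** For unit vectors 2 c a b <= a^2 + b^2 is summed over the coordinates, with c = 1 and c = -1 in
    place of the absolute value. Scaling gives the general case. *)
Lemma CauchySchwarz_enorm x v : `|\sum_(i < N) x ord0 i * v ord0 i| <= enorm x * enorm v.
Proof.
have unit_case (y z : 'rV[R]_N) : enorm y = 1 -> enorm z = 1 ->
    `|\sum_(i < N) y ord0 i * z ord0 i| <= 1.
  move=> y1 z1; have H (c : R) : c ^+ 2 = 1 -> c * \sum_(i < N) y ord0 i * z ord0 i <= 1.
    move=> c1; have -> : 1 = \sum_(i < N) 2^-1 * (y ord0 i ^+ 2 + z ord0 i ^+ 2) :> R.
      by rewrite -mulr_sumr big_split/= -!enorm_sqr y1 z1 expr1n; field.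
    rewrite mulr_sumr; apply: ler_sum => i _.
    have := sqr_ge0 (c * y ord0 i - z ord0 i); rewrite sqrrB exprMn c1; nra.
  rewrite ler_norml; have := H 1 (expr1n _ _); have := H (-1); rewrite sqrrN expr1n => /(_ erefl).
  by move=> h1 h2; apply/andP; split; lra.
have [->|x0] := eqVneq x 0.
  by rewrite enorm0 mul0r big1 ?normr0// => i _; rewrite mxE mul0r.
have [->|v0] := eqVneq v 0.
  by rewrite enorm0 mulr0 big1 ?normr0// => i _; rewrite mxE mulr0.
rewrite -enorm_gt0 in x0; rewrite -enorm_gt0 in v0.
have u1 (y : 'rV[R]_N) : 0 < enorm y -> enorm ((enorm y)^-1 *: y) = 1.
  by move=> y0; rewrite enormZ gtr0_norm ?invr_gt0// mulVf// gt_eqF.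
have := unit_case _ _ (u1 _ x0) (u1 _ v0).
under eq_bigr do rewrite !mxE mulrACA; rewrite -mulr_sumr normrM gtr0_norm; last first.
  by rewrite mulr_gt0// invr_gt0.
by rewrite -invfM mulrC ler_pdivrMr ?mulr_gt0// mul1r.
Qed.

Lemma enormD x v : enorm (x + v) <= enorm x + enorm v.
Proof.
rewrite -(ler_pXn2r (n := 2))// ?nnegrE ?addr_ge0 ?enorm_ge0//.
have := le_trans (ler_norm _) (CauchySchwarz_enorm x v).
rewrite sqrrD !enorm_sqr => h.
have -> : \sum_(i < N) (x + v) ord0 i ^+ 2 =
  \sum_(i < N) x ord0 i ^+ 2 + 2 * \sum_(i < N) x ord0 i * v ord0 i + \sum_(i < N) v ord0 i ^+ 2.
  rewrite mulr_sumr -!big_split/=; apply: eq_bigr => i _; rewrite mxE; ring.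
by rewrite lerD2r lerD2l -[leRHS]mulr_natl ler_pM2l.
Qed.

Lemma enormN x : enorm (- x) = enorm x.
Proof. by rewrite -scaleN1r enormZ normrN normr1 mul1r. Qed.

(** The sigma-algebra is generated by the coordinates, so an open set has to be written as a
    countable union of measurable sets: the boxes contained in it with rational centre and width
    1/(k+1) on each side. They are balls of the sup norm. *)
Lemma continuous_measurable_rV f : continuous f -> measurable_fun setT f.
Proof.
move=> /continuousP cf; apply: (measurability _ (RGenOpens.measurableE R)).
move=> _ [_ [a [b ->] <-]]; rewrite setTI.
have : open (f @^-1` `]a, b[%classic) by apply: cf; exact: interval_open.
set U := (X in open X) => oU; suff : measurable U by [].
pose q (z : 'rV[rat]_N) : 'rV[R]_N := map_mx ratr z.
pose B (z : 'rV[rat]_N * nat) : set 'rV[R]_N :=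
  [set x | forall i, `|q z.1 ord0 i - x ord0 i| < z.2.+1%:R^-1].
have mB z : measurable (B z).
  have -> : B z = \bigcap_(i in [set: 'I_N]) ((fun x : 'rV[R]_N => x ord0 i) @^-1` (ball (q z.1 ord0 i) z.2.+1%:R^-1)).
    by apply/seteqP; split => x /= h i; [move=> _|]; exact: h.
  apply: fin_bigcap_measurable => // i _.
  have mb : measurable (ball (q z.1 ord0 i) z.2.+1%:R^-1) by exact: measurable_ball.
  by have := @measurable_coord R N i measurableT _ mb; rewrite setTI.
pose F (z : 'rV[rat]_N * nat) := if pselect (B z `<=` U) then B z else set0.
have -> : U = \bigcup_z F z.
  apply/seteqP; split => [x Ux|x [z _]]; last first.
    by rewrite /F; case: pselect => // BU; exact: BU.
  have /nbhs_ballP[e /= e0 xe] : nbhs x U by exact: (open_nbhs_nbhs (conj oU Ux)).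
  pose k := truncn (2 / e).
  have k0 : 0 < k.+1%:R^-1 :> R by rewrite invr_gt0.
  have ke : k.+1%:R^-1 + k.+1%:R^-1 <= e.
    have := truncnS_gt (2 / e); rewrite -/k ltr_pdivrMr// => h.
    by rewrite -mulr2n -(mulr_natl _ 2) ler_pdivrMr// mulrC ltW.
  have /= [qf hq] := choice (fun i : 'I_N => rat_in_itvoo (ltr_pwDr k0 (lexx (x ord0 i)))).
  have qB i : `|ratr (qf i) - x ord0 i| < k.+1%:R^-1.
    have := hq i; rewrite in_itv/= => /andP[h1 h2].
    by rewrite gtr0_norm ?subr_gt0// ltrBlDl.
  exists (\row_i qf i, k) => //; rewrite /F.
  case: pselect => [BU|nBU]; first by move=> i /=; rewrite !mxE; exact: qB.
  exfalso; apply: nBU => y By; apply: xe; split => // i j.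
  rewrite ord1 /ball/=; apply: lt_le_trans ke.
  apply: (le_lt_trans (ler_distD (ratr (qf j)) _ _)).
  by apply: ltrD; [rewrite distrC; exact: qB|have := By j; rewrite /= !mxE].
apply: countable_bigcupT_measurable; first exact: countableP.
by move=> z; rewrite /F; case: pselect => BU; [exact: mB|exact: measurable0].
Qed.

End row_vectors.

(** * Upper bounds *)

Section fatou_ae.
Local Open Scope ereal_scope.

Lemma fatou_ae d (T : measurableType d) (R : realType)
    (mu : {measure set T -> \bar R}) (D : set T) (f_ : nat -> T -> \bar R)
    (f : T -> \bar R) (C : \bar R) :
  measurable D -> (forall n, measurable_fun D (f_ n)) -> measurable_fun D f ->
  (forall n x, 0 <= f_ n x) -> (forall x, 0 <= f x) ->
  {ae mu, forall x, D x -> f_ n x @[n --> \oo] --> f x} ->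
  (forall n, \int[mu]_(x in D) f_ n x <= C) -> \int[mu]_(x in D) f x <= C.
Proof.
move=> mD mf_ mf f_0 f0 [N0 [mN0 N00 cN0]] fC.
rewrite (ge0_negligible_integral mN0 mD mf (fun x _ => f0 x) N00).
have mDN : measurable (D `\` N0) by exact: measurableD.
rewrite (eq_integral (fun x => limn_einf (f_ ^~ x))); last first.
  move=> x; rewrite inE => -[Dx nN0x]; apply/esym.
  have cx : f_ n x @[n --> \oo] --> f x.
    by apply: contrapT => h; apply: nN0x; apply: cN0 => h'; apply: h; exact: h'.
  by have [-> _] := cvg_limn_einf_sup cx.
apply: (le_trans (fatou _ mDN _ _)) => //.
  by move=> n; apply: measurable_funS (mf_ n) => // x [].
rewrite limn_einf_lim; apply: lime_le; first exact: is_cvg_einfs.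
apply: nearW => n; apply: le_trans (fC n).
apply: (@le_trans _ _ (\int[mu]_(x in D `\` N0) f_ n x)).
  by apply: ereal_inf_lbound; exists n => /=.
by apply: ge0_subset_integral => // x [].
Qed.

End fatou_ae.

Section ball_norm_theory.
Context {R : realType} {N : nat}.
Notation lam := (@lebesgue_rV R N).
Variable r : \bar R.
Local Open Scope ereal_scope.
Implicit Types f g h : 'rV[R]_N -> R.

Lemma ball_normE (q : R) f : (0 < q)%R ->
  ball_norm r q f = (\int[lam]_(x in eball r) (`|f x| `^ q)%:E) `^ q^-1.
Proof.
move=> q0; rewrite /ball_norm unlock; congr (_ `^ _).
rewrite [RHS]integral_mkcond; apply: eq_integral => x _.
rewrite !patchE; case: ifPn => _ /=; first by [].
by rewrite normr0 powR0// gt_eqF.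
Qed.

Let I0 (q : R) f : 0 <= \int[lam]_(x in eball r) (`|f x| `^ q)%:E.
Proof. by apply: integral_ge0 => x _; rewrite lee_fin powR_ge0. Qed.

Lemma ball_norm_leP (q M : R) f : (0 < q)%R -> (0 <= M)%R ->
  ball_norm r q f <= M%:E <-> \int[lam]_(x in eball r) (`|f x| `^ q)%:E <= (M `^ q)%:E.
Proof.
move=> q0 M0; rewrite ball_normE//; set I := \int[lam]_(x in _) _.
have II : 0 <= I by exact: I0.
have q1 : (q^-1 * q = 1)%R by rewrite mulVf// gt_eqF.
split=> h.
  have -> : I = (I `^ q^-1) `^ q by rewrite -poweRrM q1 poweRe1.
  by rewrite -poweR_EFin; apply: gt0_ler_poweR; rewrite ?in_itv/= ?leey ?andbT ?poweR_ge0 ?lee_fin// ltW.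
have -> : M%:E = ((M `^ q)%:E) `^ q^-1.
  by rewrite poweR_EFin -powRrM mulrC q1 powRr1.
by apply: gt0_ler_poweR; rewrite ?in_itv/= ?leey ?andbT ?invr_ge0 ?lee_fin ?powR_ge0// ltW.
Qed.

Lemma ball_norm_ge0 (q : R) f : 0 <= ball_norm r q f.
Proof. exact: Lnorm_ge0. Qed.

(** Minkowski's inequality under a pointwise bound, a form that also serves the lengths of vector
    fields. The functions are measurable on the ball only, hence the extension by 0. *)
Lemma Lnorm_ball_triangle (q : R) f g h : (1 <= q)%R ->
  measurable_fun (eball r) f -> measurable_fun (eball r) g -> measurable_fun (eball r) h ->
  (forall x, `|f x| <= `|g x| + `|h x|)%R ->
  ball_norm r q f <= ball_norm r q g + ball_norm r q h.
Proof.
move=> q1 mf mg mh fgh; have q0 : (0 < q)%R by exact: lt_le_trans q1.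
have mB := @measurable_eball R N r.
pose g' := (fun x => `|g x|)%R \_ (eball r).
pose h' := (fun x => `|h x|)%R \_ (eball r).
have mg' : measurable_fun setT g'.
  by apply/(measurable_restrictT _ _).1 => //; exact: measurableT_comp.
have mh' : measurable_fun setT h'.
  by apply/(measurable_restrictT _ _).1 => //; exact: measurableT_comp.
have E (k : 'rV[R]_N -> R) : Lnorm lam q%:E (EFin \o ((fun x => `|k x|)%R \_ (eball r))) = ball_norm r q k.
  rewrite ball_normE// unlock; congr (_ `^ _).
  rewrite [RHS]integral_mkcond; apply: eq_integral => x _.
  rewrite /= !patchE; case: ifPn => _ /=; first by rewrite normr_id.
  by rewrite normr0 powR0// gt_eqF.
have := minkowski_EFin lam mg' mh' q1; rewrite !E; apply: le_trans.
rewrite ball_normE// unlock; apply: gt0_ler_poweR.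
- by rewrite invr_ge0 ltW.
- by rewrite in_itv/= leey andbT I0.
- by rewrite in_itv/= leey andbT; apply: integral_ge0 => x _; first [exact: poweR_ge0|rewrite lee_fin; exact: powR_ge0].
rewrite [leLHS]integral_mkcond; apply: ge0_le_integral => //.
- by move=> x _; rewrite patchE; case: ifPn => // _; rewrite lee_fin powR_ge0.
- apply/(measurable_restrictT _ _).1 => //; apply/measurable_EFinP.
  by apply: (measurableT_comp (@measurable_powR R q)); exact: measurableT_comp.
- have -> : (fun x => `|(EFin \o (g' \+ h')%R) x| `^ q) = (fun x => (`|(g' \+ h')%R x| `^ q)%R%:E).
    by apply/funext => x; rewrite -poweR_EFin.
  apply/measurable_EFinP.
  apply: (measurableT_comp (@measurable_powR R q)); apply: measurableT_comp => //.
  exact: measurable_funD.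
move=> x _; rewrite patchE -[leRHS]/((`|(g' \+ h')%R x| `^ q)%R%:E) /g' /h' /=; case: ifPn => xB.
  rewrite lee_fin; apply: ge0_ler_powR; rewrite ?nnegrE ?(ltW q0)//.
  by rewrite !patchE xB; apply: (le_trans (fgh x)); exact: ler_norm.
by rewrite lee_fin powR_ge0.
Qed.

End ball_norm_theory.

Section test_functions.
Context {R : realType} {n : nat}.
Notation N := n.+1.
Implicit Types (f : 'rV[R]_N -> R).

Lemma test_fun_cst0 (r : \bar R) : test_fun r (cst 0 : 'rV[R]_N -> R).
Proof.
split.
- by apply: smooth_Cn => k; exact: Cn_cst.
- rewrite (_ : [set x | _] = set0) ?closure0; first exact: compact0.
  by apply/seteqP; split => x //=; rewrite eqxx.
- rewrite (_ : [set x | _] = set0) ?closure0//.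
  by apply/seteqP; split => x //=; rewrite eqxx.
Qed.

Lemma smooth_continuous f : smooth f -> continuous f.
Proof. by move=> /(_ [::])[]. Qed.

Lemma smooth_derivable f (i : 'I_N) x : smooth f -> derivable f x (delta_mx ord0 i).
Proof. by move=> /(_ [::])[_]; exact. Qed.

Lemma smooth_continuous_partial f i : smooth f -> continuous (partial i f).
Proof. by move=> /(_ [:: i])[]. Qed.

(** Smoothness is stated through partial derivatives, while rays have arbitrary directions. Adding
    one coordinate at a time, the continuity of the partial derivatives yields the derivative in
    every direction. *)
Lemma is_derive_smooth f x v : smooth f ->
  is_derive x v f (\sum_(i < N) v ord0 i * grad f x ord0 i).
Proof.
move=> sf.
have H (s : seq 'I_N) : is_derive x (\sum_(i <- s) v ord0 i *: delta_mx ord0 i) f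
    (\sum_(i <- s) v ord0 i * grad f x ord0 i).
  elim: s => [|i s IH].
    by rewrite !big_nil; split; [exact: derivable0|exact: derive0].
  rewrite !big_cons mxE; apply: is_derive_addl => //.
    by move=> y; exact: smooth_derivable.
  exact: smooth_continuous_partial.
by rewrite {1}(row_sum_delta v); exact: H.
Qed.

Lemma is_derive_smooth_ray f (w : 'rV[R]_N) (s : R) : smooth f ->
  is_derive s (1:R) (fun t : R => f (t *: w)) (\sum_(i < N) w ord0 i * grad f (s *: w) ord0 i).
Proof.
move=> sf; have := @is_derive_line _ _ f 0 w s _ (@is_derive_smooth f (s *: w + 0) w sf).
rewrite addr0; have -> // : (fun s : R => f (s *: w + 0)) = (fun s : R => f (s *: w)).
by apply/funext => t; rewrite addr0.
Qed.

Lemma continuous_ray (w : 'rV[R]_N) : continuous (fun s : R => s *: w).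
Proof. by move=> s; apply: cvgZr_tmp; exact: cvg_id. Qed.

Lemma continuous_smooth_ray f (w : 'rV[R]_N) : smooth f ->
  continuous (fun s : R => \sum_(i < N) w ord0 i * grad f (s *: w) ord0 i).
Proof.
move=> sf s.
have -> : (fun s : R => \sum_(i < N) w ord0 i * grad f (s *: w) ord0 i) =
   \sum_(i < N) (fun s : R => w ord0 i * partial i f (s *: w)).
  by apply/funext => t; rewrite fct_sumE; apply: eq_bigr => i _; rewrite mxE.
elim/big_ind: _ => [|a b ca cb|i _].
- exact: cst_continuous.
- exact: cvgD.
- apply: cvgMl_tmp; apply: (@continuous_comp _ _ _ (fun s : R => s *: w) (partial i f)).
    exact: continuous_ray.
  exact: smooth_continuous_partial.
Qed.

Lemma grad_eq0 f x : (\near x, f x = 0) -> grad f x = 0.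
Proof.
move=> f0; apply/rowP => i; rewrite !mxE /partial (@near_eq_derive _ _ _ f (cst 0))//.
exact: derive_cst.
Qed.

Lemma measurable_grad f : smooth f -> measurable_fun setT (grad f).
Proof.
move=> sf; apply: measurable_fun_rV => i.
rewrite [X in measurable_fun _ X](_ : _ = partial i f); last by apply/funext => x; rewrite mxE.
by apply: continuous_measurable_rV; exact: smooth_continuous_partial.
Qed.

Lemma test_fun_support (r : \bar R) f : (0 < r)%E -> test_fun r f ->
  exists y0 : R, [/\ 0 < y0, (y0%:E < r)%E &
    forall x, y0 <= enorm x -> f x = 0 /\ grad f x = 0].
Proof.
move=> r0 [sf cK Kr]; set K := closure _ in cK Kr.
have [y1 [y10 y1r hy1]] : exists y1 : R, [/\ 0 <= y1, (y1%:E < r)%E &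
    forall x, y1 < enorm x -> f x = 0].
  have [K0|/set0P[x0 Kx0]] := eqVneq K set0.
    exists 0; split => // x _; apply: contrapT => /eqP fx.
    have : K x by exact: subset_closure.
    by rewrite K0.
  have cE : {within K, continuous (@enorm R N)}.
    by apply: continuous_subspaceT; exact: continuous_enorm.
  have [c cK0 hc] := compact_EVT_max (ex_intro _ _ Kx0) cK cE.
  exists (enorm c); split; first exact: enorm_ge0.
    by apply: Kr; rewrite inE in cK0.
  move=> x cx; apply: contrapT => /eqP fx.
  have Kx : K x by exact: subset_closure.
  by have := hc x; rewrite inE => /(_ Kx); rewrite leNgt cx.
(* The room between [y1] and [y0] makes f vanish in a neighbourhood of every x with |x| >= y0, so
   that the gradient vanishes there too. *)
have [y0 y1y y0r] : exists2 y0 : R, y1 < y0 & (y0%:E < r)%E.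
  case: r y1r {r0 Kr} => [r| |]//; rewrite ?lte_fin => y1r.
    by exists ((y1 + r) / 2); rewrite ?lte_fin; lra.
  by exists (y1 + 1); rewrite ?ltry ?ltrDl.
exists y0; split => //; first exact: le_lt_trans y1y.
move=> x yx; have xy1 : y1 < enorm x by exact: lt_le_trans yx.
split; first exact: hy1.
apply: grad_eq0.
have nz : nbhs (enorm x) [set z | y1 < z] by exact: lt_nbhsr.
have : nbhs x (@enorm R N @^-1` [set z | y1 < z]) by exact: (@continuous_enorm R N x).
by apply: filterS => z; exact: hy1.
Qed.

Lemma test_fun_bounded (r : \bar R) f : (0 < r)%E -> test_fun r f ->
  exists2 S : R, 0 <= S & forall x, `|f x| <= S.
Proof.
move=> r0 [sf cK Kr]; set K := closure _ in cK Kr.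
have [K0|/set0P[x0 Kx0]] := eqVneq K set0.
  exists 0 => // x; have [->|fx] := eqVneq (f x) 0; first by rewrite normr0.
  have : K x by exact: subset_closure.
  by rewrite K0.
have cE : {within K, continuous (fun x => `|f x|)}.
  apply: continuous_subspaceT => x; apply: (@continuous_comp _ _ _ f (fun y : R => `|y|)).
    exact: smooth_continuous.
  exact: norm_continuous.
have [c cK0 hc] := compact_EVT_max (ex_intro _ _ Kx0) cK cE.
exists `|f c| => // x; have [->|fx] := eqVneq (f x) 0; first by rewrite normr0.
by apply: hc; rewrite inE; exact: subset_closure.
Qed.

End test_functions.

(** * Pointwise limits and the choice of a ray *)

Section subsequence.
Context {R : realType} {N : nat}.
Notation lam := (@lebesgue_rV R N).
Local Open Scope ereal_scope.

Lemma cvge0_near_lt (a : nat -> \bar R) (e : R) : a @ \oo --> 0 -> (0 < e)%R ->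
  \forall k \near \oo, a k <= e%:E.
Proof.
move=> /fine_cvgP[afin /cvgrPdist_le h] e0.
near=> k; rewrite -[a k]fineK; last by near: k.
rewrite lee_fin; apply: le_trans (ler_norm _) _.
rewrite -normrN -[X in (`|X| <= _)%R]sub0r.
by near: k; exact: h.
Unshelve. all: by end_near. Qed.

(** The indices are chosen so that the q-th power of the norm is at most 2^(-j). The series of the
    |f - u|^q then has a finite integral, so it converges almost everywhere and its terms tend to 0.
    The choice [sg] is not claimed to be increasing. *)
Lemma ae_cvg_subsequence (r : \bar R) (q : R) (f : nat -> 'rV[R]_N -> R)
    (u : 'rV[R]_N -> R) (k0 : nat) : (0 < q)%R ->
  (forall k, measurable_fun (eball r) (f k)) -> measurable_fun (eball r) u ->
  ball_norm r q (fun x => f k x - u x)%R @[k --> \oo] --> 0 ->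
  exists2 sg : nat -> nat, (forall j, (k0 <= sg j)%N) &
    {ae lam, forall x, eball r x -> f (sg j) x @[j --> \oo] --> u x}.
Proof.
move=> q0 mf mu cf; have mB := @measurable_eball R N r.
have /choice[sg hsg] : forall j, exists k, (k0 <= k)%N /\
    ball_norm r q (fun x => f k x - u x)%R <= ((2^-1 ^+ j) `^ q^-1)%:E.
  move=> j; have e0 : (0 < (2^-1 ^+ j) `^ q^-1 :> R)%R by rewrite powR_gt0// exprn_gt0.
  have [K _ hK] := cvge0_near_lt cf e0.
  by exists (maxn k0 K); rewrite leq_maxl; split => //; apply: hK => /=; exact: leq_maxr.
exists sg; first by move=> j; have [] := hsg j.
pose t j x := (`|f (sg j) x - u x| `^ q)%:E.
have t0 j x : 0 <= t j x by rewrite lee_fin powR_ge0.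
have mt j : measurable_fun (eball r) (t j).
  apply/measurable_EFinP; apply: (measurableT_comp (@measurable_powR R q)).
  by apply: measurableT_comp => //; exact: measurable_funB.
have It j : \int[lam]_(x in eball r) t j x <= (2^-1 ^+ j)%:E.
  have [_] := hsg j; move/ball_norm_leP => /(_ q0 (powR_ge0 _ _)).
  by rewrite -powRrM mulVf ?gt_eqF// powRr1// exprn_ge0.
have IS : \int[lam]_(x in eball r) \sum_(j <oo) t j x <= 2%:E.
  rewrite integral_nneseries//.
  apply: lime_le; first by apply: is_cvg_nneseries => k _ _; apply: integral_ge0.
  apply: nearW => k; apply: (@le_trans _ _ (\sum_(0 <= i < k) (2^-1 ^+ i)%:E)).
    by apply: lee_sum => i _; exact: It.
  rewrite sumEFin lee_fin.
  have := @geometric_le_lim R k 1 2^-1 ler01; rewrite seriesEnat/= invr_gt0 gtr0_norm ?invr_gt0// invf_lt1//.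
  rewrite ltr1n => /(_ (ltr0Sn _ _) isT); under eq_bigr do rewrite mul1r.
  move/le_trans; apply.
  have -> : (1 - 2^-1 = 2^-1 :> R)%R by lra.
  by rewrite invrK mul1r.
have : lam.-integrable (eball r) (fun x => \sum_(j <oo) t j x).
  apply/integrableP; split.
    by apply: (ge0_emeasurable_sum (P := xpredT)) => // k *; exact: mt.
  rewrite (eq_integral (fun x => \sum_(j <oo) t j x)); last first.
    by move=> x _; rewrite gee0_abs// nneseries_ge0.
  by apply: (le_lt_trans IS); rewrite ltry.
move=> /(integrable_ae mB); apply: filterS => x hx Bx; have {}hx := hx Bx.
have S_lt : \sum_(0 <= j <oo) t j x < +oo by rewrite ltey_eq hx.
have tail := nneseries_tail_cvg S_lt (fun k _ => t0 k x).
have tx : t j x @[j --> \oo] --> 0.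
  apply: (squeeze_cvge _ (cvg_cst 0) tail); apply: nearW => k; rewrite t0/=.
  rewrite (@nneseries_split _ _ k 1); last by move=> *; exact: t0.
  by rewrite addn1 big_nat1 leeDl// nneseries_ge0.
apply/cvgrPdist_le => e e0.
have eq0 : (0 < e `^ q)%R by rewrite powR_gt0.
apply: filterS (cvge0_near_lt tx eq0) => j; rewrite lee_fin => h.
rewrite distrC leNgt; apply/negP => h'; have h2 : (e `^ q < `|f (sg j) x - u x| `^ q)%R.
  by apply: gt0_ltr_powR => //; rewrite ?nnegrE ?normr_ge0 ?(ltW e0).
by have := le_lt_trans h h2; rewrite ltxx.
Qed.

End subsequence.

Section continuity_norm_power.
Context {R : realType}.

Lemma cvg_norm_powR (q : R) (t : nat -> R) (l : R) : 0 < q ->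
  t k @[k --> \oo] --> l -> `|t k| `^ q @[k --> \oo] --> `|l| `^ q.
Proof.
move=> q0 /cvg_norm tl; have [l0|l0] := eqVneq l 0.
  rewrite l0 normr0 powR0 ?gt_eqF//; rewrite l0 normr0 in tl.
  apply/cvgrPdist_le => e e0.
  have e1 : 0 < e `^ q^-1 by rewrite powR_gt0.
  have /cvgrPdist_le /(_ _ e1) := tl; apply: filterS => k.
  rewrite !sub0r !normrN normr_id => h; rewrite ger0_norm ?powR_ge0//.
  have -> : e = (e `^ q^-1) `^ q by rewrite -powRrM mulVf ?gt_eqF// powRr1// ltW.
  by apply: ge0_ler_powR; rewrite ?nnegrE ?powR_ge0 ?(ltW q0).
have lp : 0 < `|l| by rewrite normr_gt0.
by apply: (@cvg_comp _ _ _ (fun k => `|t k|) (@powR R ^~ q) _ _ _ tl); exact: continuous_powR.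
Qed.

End continuity_norm_power.

Section ray_domain.
Context {R : realType}.

Lemma ray_domE (p m s : R) (r : \bar R) : 1 < p -> p < m -> (0 < r)%E ->
  ray_dom p m (neg_pow r (- ((m - p) / (p - 1)))) s <-> 0 < s /\ (s%:E < r)%E.
Proof.
move=> p1 pm; set b := (m - p) / (p - 1).
have b0 : 0 < b by rewrite divr_gt0 ?subr_gt0.
case: r => [r| |]; rewrite ?lte_fin //= => r0; rewrite /ray_dom /= -/b.
  split=> -[s0 h]; split => //.
    rewrite ?lte_fin ltNge; apply/negP => rs; have := ler_powRN (_ : - b <= 0) r0 rs.
    by rewrite oppr_le0 ltW// leNgt h => /(_ isT).
  rewrite ?lte_fin in h; rewrite !powRN ltf_pV2 ?posrE ?powR_gt0//.
  by apply: gt0_ltr_powR; rewrite ?nnegrE ?(ltW r0) ?(ltW s0).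
split=> -[s0 _]; split => //; first by rewrite ltry.
by rewrite powR_gt0.
Qed.

End ray_domain.

Section ray_selection.
Context {R : realType} {n : nat}.
Notation mu := (@lebesgue_measure R).
Notation N := n.+1.
Notation lam := (@lebesgue_rV R N).

Lemma measurable_ray_integral (h : 'rV[R]_N -> \bar R) :
  measurable_fun setT h -> (forall x, (0 <= h x)%E) ->
  measurable_fun setT (fun y : 'rV[R]_N =>
    \int[mu]_(s in `]0%R, +oo[) ((s `^ (N%:R - 1))%:E * h (s *: dir y)%R))%E.
Proof.
move=> mh h0.
pose K (z : 'rV[R]_N * measurableTypeR R) : \bar R :=
  ((\1_(`]0%R, +oo[%classic : set R) (z.2 : R) * z.2 `^ (N%:R - 1))%:E * h (z.2 *: dir z.1)%R)%E.
have mK : measurable_fun setT K.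
  apply: emeasurable_funM.
    apply/measurable_EFinP; apply: measurable_funM.
      have H : measurable_fun setT (\1_(`]0%R, +oo[%classic : set R) : R -> R).
        exact: measurable_indic.
      exact: (measurableT_comp H measurable_snd).
    exact: (measurableT_comp (measurable_powR _) measurable_snd).
  apply: measurableT_comp => //.
  apply: (measurableT_comp (@measurable_scale_rV R N)
   (g := fun z : 'rV[R]_N * measurableTypeR R => (z.2, dir z.1))).
  apply: measurable_fun_pair; first exact: measurable_snd.
  exact: (measurableT_comp measurable_dir measurable_fst).
have K0 z : (0 <= K z)%E.
  by rewrite mule_ge0// lee_fin mulr_ge0 ?powR_ge0// indicE.
rewrite [X in measurable_fun _ X](_ : _ = (fun y => \int[mu]_s K (y, s))%E); last first.
  apply/funext => y; rewrite integral_mkcond; apply: eq_integral => s _.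
  by rewrite patchE /K/= indicE; case: (s \in _); rewrite ?mul1r// mul0r mul0e.
exact: (measurable_fun_fubini_tonelli_F _ mK).
Qed.

(* Fatou's lemma over the directions [dir y], which are parametrised by the ball. *)
Lemma good_ray (h : nat -> 'rV[R]_N -> \bar R) (B : set 'rV[R]_N) (M M' : R) :
  (forall j, measurable_fun setT (h j)) -> (forall j x, (0 <= h j x)%E) ->
  (forall j, (\int[lam]_x h j x <= M%:E)%E) -> M < M' -> 0 <= M' ->
  measurable B -> lam B = 0%E ->
  exists y, [/\ punctured_ball y,
    {ae mu, forall s, 0 < s -> ~ B (s *: dir y)} &
    forall k, exists2 j, (k <= j)%N &
      (\int[mu]_(s in `]0%R, +oo[) ((s `^ (N%:R - 1))%:E * h j (s *: dir y)%R) <= (M' / omega N%:R)%:E)%E].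
Proof.
move=> mh h0 hM MM' M'0 mB B0.
pose J j (y : 'rV[R]_N) := (\int[mu]_(s in `]0%R, +oo[) ((s `^ (N%:R - 1))%:E * h j (s *: dir y)%R))%E.
have mJ j : measurable_fun setT (J j) by exact: measurable_ray_integral.
have J0 j y : (0 <= J j y)%E.
  by apply: integral_ge0 => s _; rewrite mule_ge0// lee_fin powR_ge0.
have om0 : 0 < omega N%:R :> R by exact: omega_gt0.
pose c := M' / omega N%:R.
have c0 : 0 <= c by rewrite divr_ge0// ltW.
have mPB := @measurable_punctured_ball R n.
pose b1 (x : 'rV[R]_N) : \bar R := (\1_B x)%:E.
have mb1 : measurable_fun setT b1 by apply/measurable_EFinP; exact: measurable_indic.
have b10 x : (0 <= b1 x)%E by rewrite lee_fin indicE.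
pose JB (y : 'rV[R]_N) := (\int[mu]_(s in `]0%R, +oo[) ((s `^ (N%:R - 1))%:E * b1 (s *: dir y)%R))%E.
have mJB : measurable_fun setT JB by exact: measurable_ray_integral.
have JB0 y : (0 <= JB y)%E.
  by apply: integral_ge0 => s _; rewrite mule_ge0// lee_fin powR_ge0.
(* By polar coordinates a null set meets almost every ray in a null set. *)
have IB : (\int[lam]_(y in punctured_ball) JB y = 0)%E.
  have := ge0_integral_polar mb1 b10; rewrite -/JB.
  have -> : (\int[lam]_x b1 x = 0)%E by rewrite integral_indic// setIT.
  move/esym/eqP; rewrite mule_eq0 => /orP[|/eqP //].
  by rewrite eqe pnatr_eq0.
have aeB : {ae lam, forall y, punctured_ball y -> JB y = 0%E}.
  have mJBp : measurable_fun punctured_ball JB by exact: measurable_funTS.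
  have := (ae_eq_integral_abs lam mPB mJBp).1; apply.
  by rewrite -[RHS]IB; apply: eq_integral => y _; rewrite gee0_abs.
have goodB y : punctured_ball y -> JB y = 0%E -> {ae mu, forall s, 0 < s -> ~ B (s *: dir y)}.
  move=> Py JBy.
  have mO : measurable (`]0%R, +oo[%classic : set R) by exact: measurable_itv.
  pose F (s : R) := ((s `^ (N%:R - 1))%:E * b1 (s *: dir y)%R)%E.
  have mF : measurable_fun (`]0%R, +oo[%classic : set R) F.
    apply: measurable_funTS; apply: emeasurable_funM.
      by apply/measurable_EFinP; exact: measurable_powR.
    exact: (measurableT_comp mb1 (measurable_ray _)).
  have F0 s : (0 <= F s)%E by rewrite /F mule_ge0// lee_fin powR_ge0.
  have IF : (\int[mu]_(s in `]0%R, +oo[) `|F s| = 0)%E.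
    by rewrite -[RHS]JBy; apply: eq_integral => s _; rewrite gee0_abs.
  have := (ae_eq_integral_abs mu mO mF).1 IF; apply: filterS => s /= hs s0 Bs.
  have : F s = 0%E by apply: hs; rewrite /= in_itv/= s0.
  rewrite /F /b1 indicE mem_set// mule1 => -[] /eqP.
  by rewrite powR_eq0 gt_eqF.
(* If no direction is good, then for almost every y all but finitely many [J j y] exceed c, so their
   minimum with c tends to c. Fatou's lemma then gives c omega_N / N <= M / N, that is M' <= M. *)
apply: contrapT => none.
have aeJ : {ae lam, forall y, punctured_ball y ->
    mine (J j y) c%:E @[j --> \oo] --> (cst c%:E y : \bar R)}.
  apply: filterS aeB => y hy Py; have Bs := goodB _ Py (hy Py).
  apply: cvg_near_cst.
  have [[k hk]|nk] := pselect (exists k, forall j, (k <= j)%N -> (c%:E < J j y)%E).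
    by exists k => // j /= kj; apply/min_idPr; rewrite ltW// hk.
  exfalso; apply: none; exists y; split => // k.
  apply: contrapT => nj; apply: nk; exists k => j kj.
  by rewrite ltNge; apply/negP => Jj; apply: nj; exists j.
have : (\int[lam]_(y in punctured_ball) cst c%:E y <= (M / N%:R)%:E)%E.
  apply: (fatou_ae (f_ := fun j y => mine (J j y) c%:E)) => //.
  - by move=> j; apply: measurable_funTS; apply: measurable_mine => //; exact: measurable_cst.
  - by move=> j y; rewrite le_min J0 lee_fin.
  move=> j; apply: (@le_trans _ _ (\int[lam]_(y in punctured_ball) J j y)%E).
    apply: ge0_le_integral => //.
    - by move=> y _; rewrite le_min J0 lee_fin.
    - by apply: measurable_funTS; apply: measurable_mine => //; exact: measurable_cst.
    - exact: measurable_funTS.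
    - by move=> y _; rewrite ge_min lexx.
  have := hM j; rewrite (ge0_integral_polar (mh j) (h0 j)) -/(J j).
  set I := (\int[lam]_(y in punctured_ball) _)%E => hI.
  have I0 : (0 <= I)%E by apply: integral_ge0 => y _; exact: J0.
  have -> : I = ((N%:R^-1)%:E * (N%:R%:E * I))%E.
    by rewrite muleA -EFinM mulVf ?mul1e// pnatr_eq0.
  by rewrite mulrC EFinM; apply: lee_wpmul2l => //; rewrite lee_fin invr_ge0.
have E : (\int[lam]_(y in punctured_ball) cst c%:E y = c%:E * (omega N%:R / N%:R)%:E)%E.
  by rewrite -lebesgue_punctured_ball; exact: integral_cst.
rewrite E -EFinM lee_fin /c.
rewrite mulrA divfK ?gt_eqF// ler_pM2r ?invr_gt0//.
by rewrite leNgt MM'.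
Qed.

End ray_selection.

Lemma powR_div {R : realType} (x y k : R) : 0 <= x -> 0 <= y -> (x / y) `^ k = x `^ k / y `^ k.
Proof.
move=> x0 y0; rewrite powRM ?invr_ge0//; congr (_ * _).
by rewrite -(powR_inv1 y0) -powRrM mulN1r powRN.
Qed.

(** * From the ball to one ray *)

Section upper_bound.
Context {R : realType} {n : nat}.
Notation mu := (@lebesgue_measure R).
Notation N := n.+1.
Notation lam := (@lebesgue_rV R N).
Variables (p : R) (r : \bar R).
Hypotheses (p1 : 1 < p) (pN : p < N%:R) (r0 : (0 < r)%E).
Let m : R := N%:R.
Let b := (m - p) / (p - 1).
Let q := conj_exp p.
Let c := omega p / omega m.
Let A := (p - 1) / (m - p) * p * c `^ (p - 1)^-1.
Let rb := neg_pow r (- b).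
Let dom := ray_dom p m rb.
Let T (s : R) := A * (s `^ (- b) - rb).

Let p0 : 0 < p. Proof. by rewrite (lt_trans _ p1). Qed.
Let a0 : 0 < p - 1. Proof. by rewrite subr_gt0. Qed.
Let mp0 : 0 < m - p. Proof. by rewrite subr_gt0. Qed.
Let b0 : 0 < b. Proof. by rewrite divr_gt0. Qed.
Let q0 : 0 < q. Proof. by rewrite (lt_trans _ (conj_exp_gt1 p1)). Qed.
Let omp0 : 0 < omega p. Proof. exact: omega_gt0. Qed.
Let omm0 : 0 < omega m. Proof. by apply: omega_gt0; rewrite ltr0n. Qed.
Let c0 : 0 < c. Proof. by rewrite divr_gt0. Qed.
Let A0 : 0 < A. Proof. by rewrite mulr_gt0 ?powR_gt0// mulr_gt0// divr_gt0. Qed.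
Let rb0 : 0 <= rb. Proof. by rewrite /rb; case: (r) => //= x; exact: powR_ge0. Qed.

Lemma rate_mul : A * b = alpha_crit p / omega m `^ (p - 1)^-1.
Proof.
have H (x1 x2 x3 x4 x5 : R) : x1 != 0 -> x2 != 0 -> x4 != 0 ->
    x1 / x2 * x5 * (x3 / x4) * (x2 / x1) = x5 * x3 / x4.
  by move=> h1 h2 h4; field; rewrite h1 h2 h4.
rewrite /A /b /alpha_crit /c (powR_div _ (ltW omp0) (ltW omm0)).
by apply: H; rewrite gt_eqF// powR_gt0.
Qed.

Lemma exp_integral_radial (u : 'rV[R]_N -> R) (g : R -> R) (gamma alpha : R) :
  measurable_fun (eball r) u -> measurable_fun setT g ->
  {ae lam, forall x, eball r x -> u x = g (enorm x)} ->
  exp_integral p r gamma alpha u =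
  ((omega m * c `^ q)%:E * \int[mu]_(s in dom)
     (expR (alpha * `|g s| `^ gamma - T s) * s `^ (- b - 1))%:E)%E.
Proof.
move=> mu_ mg ug; have mB := @measurable_eball R N r.
have mV : measurable_fun setT (fun t : R => V N p r t).
  rewrite /V; apply: measurable_funM.
    by apply: measurable_funM => //; exact: measurable_powR.
  apply: measurableT_comp => //; apply: measurable_funN => //.
  apply: measurable_funM => //; apply: measurable_funB => //; exact: measurable_powR.
have mVx : measurable_fun (eball r) (fun x : 'rV[R]_N => V N p r (enorm x)).
  by apply: measurable_funTS; apply: (measurableT_comp mV); exact: measurable_enorm.
have V0 t : 0 <= V N p r t by rewrite /V !mulr_ge0 ?powR_ge0 ?expR_ge0.
have mE (D : set 'rV[R]_N) (f : 'rV[R]_N -> R) : measurable_fun D f ->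
    measurable_fun D (fun x => expR (alpha * `|f x| `^ gamma)).
  move=> mf; apply: measurableT_comp => //; apply: measurable_funM => //.
  apply: (measurableT_comp (@measurable_powR R gamma)).
  exact: measurableT_comp.
have mge : measurable_fun (eball r) (fun x : 'rV[R]_N => g (enorm x)).
  by apply: measurable_funTS; apply: (measurableT_comp mg); exact: measurable_enorm.
pose F (s : R) : \bar R := ((\1_(dom) s) * (expR (alpha * `|g s| `^ gamma) * V N p r s))%:E.
have mdom : measurable dom by exact: measurable_ray_dom.
have mgE : measurable_fun setT (fun s : R => expR (alpha * `|g s| `^ gamma)).
  apply: measurableT_comp => //; apply: measurable_funM => //.
  apply: (measurableT_comp (@measurable_powR R gamma)).
  exact: measurableT_comp.
have mF : measurable_fun setT F.
  apply/measurable_EFinP; apply: measurable_funM; first exact: measurable_indic.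
  exact: measurable_funM.
have F0 s : (0 <= F s)%E.
  by rewrite lee_fin mulr_ge0// ?indicE// mulr_ge0 ?expR_ge0.
transitivity (\int[lam]_x F (enorm x))%E.
  transitivity (\int[lam]_(x in eball r) (expR (alpha * `|g (enorm x)| `^ gamma) * V N p r (enorm x))%:E)%E.
    apply: ge0_ae_eq_integral => //.
    - by apply/measurable_EFinP; apply: measurable_funM => //; exact: mE.
    - by apply/measurable_EFinP; apply: measurable_funM => //; exact: mE.
    - by move=> x _; rewrite lee_fin mulr_ge0 ?expR_ge0.
    - by move=> x _; rewrite lee_fin mulr_ge0 ?expR_ge0.
    - by apply: filterS ug => x ugx Bx; rewrite ugx.
  (* The origin belongs to the ball but not to [dom], so the two integrands are compared off a null
     set. *)
  have o1 : lam [set 0] = 0%E by exact: lebesgue_rV_set0.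
  rewrite integral_mkcond; apply: ge0_ae_eq_integral => //.
  - apply/(measurable_restrictT _ _).1 => //; apply/measurable_EFinP.
    by apply: measurable_funM => //; exact: mE.
  - by apply: (measurableT_comp mF); exact: measurable_enorm.
  - move=> x _; rewrite patchE; case: ifPn => // _.
    by rewrite lee_fin mulr_ge0 ?expR_ge0.
  - exists [set 0]; split => //.
      rewrite (_ : [set 0] = @enorm R N @^-1` [set 0]).
        by have := @measurable_enorm R N measurableT _ (measurable_set1 0); rewrite setTI.
      by apply/seteqP; split => x /= => [->|/eqP]; rewrite ?enorm0// enorm_eq0 => /eqP.
    move=> x /=; apply: contra_notP => /eqP x0 _.
    rewrite -enorm_gt0 in x0; rewrite patchE /F indicE.
    have -> : (enorm x \in dom) = (x \in eball r).
      apply/idP/idP; rewrite !inE.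
        by move/(ray_domE _ p1 pN r0) => -[].
      by move=> Bx; apply/(ray_domE _ p1 pN r0).
    by case: (x \in _); rewrite ?mul1r// mul0r.
rewrite ge0_integral_radial//.
have -> : ((omega m * c `^ q)%:E = (omega m)%:E * (c `^ q)%:E)%E by [].
rewrite -muleA; congr (_ * _)%E.
have mG : measurable_fun dom (fun s => (expR (alpha * `|g s| `^ gamma - T s) * s `^ (- b - 1))%:E).
  apply: measurable_funTS; apply/measurable_EFinP; apply: measurable_funM; last exact: measurable_powR.
  apply: measurableT_comp => //; apply: measurable_funB.
    apply: measurable_funM => //; apply: (measurableT_comp (@measurable_powR R gamma)).
    exact: measurableT_comp.
  by apply: measurable_funM => //; apply: measurable_funB => //; exact: measurable_powR.
have G0 s : dom s -> (0 <= (expR (alpha * `|g s| `^ gamma - T s) * s `^ (- b - 1))%:E)%E.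
  by move=> _; rewrite lee_fin mulr_ge0 ?expR_ge0 ?powR_ge0.
have cq0 : (0 <= (c `^ q)%:E)%E by rewrite lee_fin powR_ge0.
rewrite -(ge0_integralZl mu mdom mG G0 cq0).
rewrite [LHS]integral_mkcond [RHS]integral_mkcond; apply: eq_integral => s _.
rewrite !patchE; have [sd|sd] := boolP (s \in dom); last first.
  case: ifPn => // _; rewrite /F indicE (negbTE sd) mul0r mule0//.
have s0 : 0 < s by move: sd; rewrite inE => -[].
rewrite mem_set; last by rewrite /= in_itv/= s0.
rewrite /F indicE sd mul1r -!EFinM; congr EFin.
rewrite /V -/m -/b -/c -/rb -/q -/(T s) expRD.
have -> : s `^ (- b - 1) = s `^ (m - 1) * s `^ (- ((m - 1) * q)).
  rewrite -powRD; last by rewrite (gt_eqF s0) implybT.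
  congr (_ `^ _); rewrite /b /q /conj_exp; field; rewrite gt_eqF//.
by rewrite /T; ring.
Qed.

Lemma measurable_gradB (f h : 'rV[R]_N -> R) : smooth f -> smooth h ->
  measurable_fun setT (fun x => grad f x - grad h x).
Proof.
move=> sf sh; apply: measurable_fun_rV => i.
rewrite [X in measurable_fun _ X](_ : _ = (fun x => grad f x ord0 i - grad h x ord0 i)).
  apply: measurable_funB.
    by have := measurableT_comp (@measurable_coord R N i) (measurable_grad sf).
  by have := measurableT_comp (@measurable_coord R N i) (measurable_grad sh).
by apply/funext => x; rewrite !mxE.
Qed.

Let C : \bar R := (6 * gap_const p / (A * b) / (1 - expR (- 2^-1)))%:E.

(** [psi] is subtracted to make the energy small: it is 0 for (II) and a member of the approximating
    sequence for (I). The norm of exponent [s'] provides a pointwise limit, and the gap between [M]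
    and [M'] is the margin needed to find one good direction. *)
Lemma ray_estimate (phi : nat -> 'rV[R]_N -> R) (u psi : 'rV[R]_N -> R) (g : R -> R)
    (s' M M' alpha : R) (k0 : nat) :
  (forall k, test_fun r (phi k)) -> test_fun r psi ->
  measurable_fun (eball r) u -> measurable_fun setT g ->
  {ae lam, forall x, eball r x -> u x = g (enorm x)} -> 0 < s' ->
  ball_norm r s' (fun x => phi k x - u x) @[k --> \oo] --> 0%E ->
  (forall k, (k0 <= k)%N ->
    (ball_norm r p (fun x => enorm (grad (phi k) x - grad psi x)) <= M%:E)%E) ->
  0 <= M -> M < M' -> 0 <= alpha -> alpha * M' `^ q <= alpha_crit p ->
  exists w : 'rV[R]_N, (\int[mu]_(s in dom)
    (expR (alpha * `|g s - psi (s *: w)| `^ q - T s) * s `^ (- b - 1))%:E <= C)%E.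
Proof.
move=> tphi tpsi mu_ mg ug s'0 cphi gM M0 MM' al0 alM.
have M'0 : 0 <= M' by exact: ltW (le_lt_trans M0 MM').
have sphi k : smooth (phi k) by case: (tphi k).
have spsi : smooth psi by case: tpsi.
have mphi k : measurable_fun (eball r) (phi k).
  by apply: measurable_funTS; apply: continuous_measurable_rV; exact: smooth_continuous.
have [sg sgk0 sgu] := ae_cvg_subsequence k0 s'0 mphi mu_ cphi.
have /= [B [mB B0 hB]] : {ae lam, forall x, eball r x ->
    phi (sg j) x @[j --> \oo] --> u x /\ u x = g (enorm x)}.
  by near=> x => Bx; split; [exact: (near sgu x)|exact: (near ug x)].
pose h j (x : 'rV[R]_N) : \bar R := (enorm (grad (phi (sg j)) x - grad psi x) `^ p)%:E.
have mh j : measurable_fun setT (h j).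
  apply/measurable_EFinP; apply: (measurableT_comp (@measurable_powR R p)).
  apply: (measurableT_comp (@measurable_enorm R N)).
  exact: measurable_gradB.
have h0 j x : (0 <= h j x)%E by rewrite lee_fin powR_ge0.
(* Gradients of test functions vanish outside the ball, so the energy can be integrated over the
   whole space, as polar coordinates require. *)
have hM j : (\int[lam]_x h j x <= (M `^ p)%:E)%E.
  have /ball_norm_leP := gM _ (sgk0 j); move=> /(_ p0 M0); apply: le_trans.
  rewrite [leRHS]integral_mkcond; apply: ge0_le_integral => //.
  - apply/(measurable_restrictT _ _).1; first exact: measurable_eball.
    apply: measurable_funTS; apply/measurable_EFinP.
    apply: (measurableT_comp (@measurable_powR R p)); apply: measurableT_comp => //.
    apply: (measurableT_comp (@measurable_enorm R N)).
    exact: measurable_gradB.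
  move=> x _; rewrite patchE; case: ifPn => [_|].
    by rewrite ger0_norm ?enorm_ge0.
  rewrite notin_setE => nBx.
  have [y1 [y10 y1r hy1]] := test_fun_support r0 (tphi (sg j)).
  have [y2 [y20 y2r hy2]] := test_fun_support r0 tpsi.
  have xr : (r <= (enorm x)%:E)%E by rewrite leNgt; apply/negP.
  have [_ g1] := hy1 x (ltW (lt_le_trans y1r xr) : (y1%:E <= (enorm x)%:E)%E).
  have [_ g2] := hy2 x (ltW (lt_le_trans y2r xr) : (y2%:E <= (enorm x)%:E)%E).
  by rewrite /h g1 g2 subr0 enorm0 powR0// gt_eqF.
have MM'p : M `^ p < M' `^ p by apply: gt0_ltr_powR; rewrite ?nnegrE.
have [y [/andP[y0 y1] yB yJ]] := good_ray mh h0 hM MM'p (powR_ge0 _ _) mB B0.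
exists (dir y).
set w := dir y.
have w1 : enorm w = 1 by exact: enorm_dir.
(* Infinitely many members of the sequence respect the energy bound along [w], and [tau] picks
   them. *)
have /choice[tau htau] : forall k, exists j, (k <= j)%N /\ (\int[mu]_(s in `]0%R, +oo[)
    ((s `^ (m - 1))%:E * h j (s *: w)%R) <= (M' `^ p / omega m)%:E)%E.
  by move=> k; have [j kj hj] := yJ k; exists j.
pose wk k (s : R) := phi (sg (tau k)) (s *: w) - psi (s *: w).
have swk f : smooth f -> continuous (fun s : R => f (s *: w)).
  move=> sf s; apply: (@continuous_comp _ _ _ (fun s : R => s *: w) f).
    exact: continuous_ray.
  exact: smooth_continuous.
have mf_ (v : R -> R) : measurable_fun setT v ->
    measurable_fun dom (fun s => (expR (alpha * `|v s| `^ q - T s) * s `^ (- b - 1))%:E).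
  move=> mv; apply: measurable_funTS; apply/measurable_EFinP; apply: measurable_funM; last exact: measurable_powR.
  apply: measurableT_comp => //; apply: measurable_funB.
    apply: measurable_funM => //; apply: (measurableT_comp (@measurable_powR R q)).
    exact: measurableT_comp.
  by apply: measurable_funM => //; apply: measurable_funB => //; exact: measurable_powR.
have mpsi : measurable_fun setT (fun s : R => psi (s *: w)).
  by apply: continuous_measurable_fun; exact: swk.
pose F k (s : R) := (expR (alpha * `|wk k s| `^ q - T s) * s `^ (- b - 1))%:E.
apply: (@fatou_ae _ _ R mu dom F).
- exact: measurable_ray_dom.
- move=> k; apply: mf_; apply: measurable_funB => //.
  by apply: continuous_measurable_fun; exact: swk.
- by apply: mf_; exact: measurable_funB.
- by move=> k s; rewrite lee_fin mulr_ge0 ?expR_ge0 ?powR_ge0.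
- by move=> s; rewrite lee_fin mulr_ge0 ?expR_ge0 ?powR_ge0.
- apply: filterS yB; first exact: (ae_filter_ringOfSetsType mu).
  move=> s nB sd; have [s0 sr] := (ray_domE s p1 pN r0).1 sd.
  have esw : enorm (s *: w) = s by rewrite enormZ w1 mulr1 gtr0_norm.
  have [cs us] : phi (sg j) (s *: w) @[j --> \oo] --> u (s *: w) /\
      u (s *: w) = g (enorm (s *: w)).
    apply: contrapT => nc; apply: (nB s0); apply: hB => /= hh; apply: nc.
    by apply: hh; rewrite /eball/= esw.
  rewrite us esw in cs.
  have ctau : tau k @[k --> \oo] --> \oo.
    apply/cvgnyPge => K; exists K => // k /= Kk; apply: leq_trans Kk _.
    by have [] := htau k.
  have cw : wk k s @[k --> \oo] --> g s - psi (s *: w).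
    apply: cvgB; last exact: cvg_cst.
    exact: (cvg_comp _ _ ctau cs).
  apply/fine_cvgP; split; first exact: nearW.
  apply: cvgMr_tmp.
  apply: (@cvg_comp _ _ _ (fun k => alpha * `|wk k s| `^ q - T s) (@expR R) _ _ _ _ (@continuous_expR R _)).
  apply: cvgB; last exact: cvg_cst.
  by apply: cvgMl_tmp; exact: cvg_norm_powR.
move=> k; have [_ Jk] := htau k.
have [z1 [z10 z1r hy1]] := test_fun_support r0 (tphi (sg (tau k))).
have [z2 [z20 z2r hy2]] := test_fun_support r0 tpsi.
pose dw (s : R) := \sum_(i < N) w ord0 i * grad (phi (sg (tau k))) (s *: w) ord0 i
  - \sum_(i < N) w ord0 i * grad psi (s *: w) ord0 i.
have y120 : 0 < Num.max z1 z2 by rewrite lt_max z10.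
have y12r : ((Num.max z1 z2)%:E < r)%E by rewrite EFin_max gt_max z1r z2r.
have M'm0 : 0 <= M' `^ p / omega m by apply: divr_ge0; [exact: powR_ge0|exact: ltW].
apply: (@moser_ray_bound R p m A rb p1 pN A0 rb0 (wk k) dw alpha (M' `^ p / omega m) (Num.max z1 z2)
  _ _ _ _ al0 M'm0).
- move=> s _; apply: is_deriveB; exact: is_derive_smooth_ray.
- move=> s _; apply: cvgB; exact: continuous_smooth_ray.
- have /(ray_domE _ p1 pN r0) [_] : 0 < Num.max z1 z2 /\ ((Num.max z1 z2)%:E < r)%E by [].
  by move/ltW.
- move=> s; rewrite ge_max => /andP[h1 h2]; rewrite /wk.
  have s0 : 0 < s by exact: lt_le_trans h1.
  have esw : enorm (s *: w) = s by rewrite enormZ w1 mulr1 gtr0_norm.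
  by rewrite (hy1 _ _).1 ?esw// (hy2 _ _).1 ?esw// subrr.
- have rd0 (s : R) : (0 <= (ray_density p m dw s)%:E)%E by rewrite lee_fin ray_density_ge0.
  have hh0 (s : R) : (0 <= (s `^ (m - 1))%:E * h (tau k) (s *: w))%E.
    by rewrite mule_ge0// lee_fin powR_ge0.
  apply: le_trans Jk; apply: ge0_le_integral => //.
  + apply/measurable_EFinP; apply: measurable_ray_density => s _.
    by apply: cvgB; exact: continuous_smooth_ray.
  + apply: measurable_funTS; apply: emeasurable_funM.
      by apply/measurable_EFinP; exact: measurable_powR.
    by apply: (measurableT_comp (mh _)); exact: measurable_ray.
  move=> s _; rewrite /h -EFinM lee_fin /ray_density mulrC ler_wpM2l ?powR_ge0//.
  apply: ge0_ler_powR; rewrite ?nnegrE ?enorm_ge0 ?(ltW p0)//.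
  rewrite -[leRHS]mul1r -w1; apply: le_trans (CauchySchwarz_enorm _ _).
  rewrite /dw -sumrB; under [in leRHS]eq_bigr do rewrite !mxE mulrBr.
  by under [in leLHS]eq_bigr do rewrite !mxE.
(* The energy bound M'^p / omega_m to the power 1/(p-1) is M'^q / omega_m^(1/(p-1)). The denominator
   is the one in [rate_mul]. *)
- rewrite -/b rate_mul powR_div ?powR_ge0 ?(ltW omm0)// -powRrM mulrA.
  by rewrite ler_pM2r// invr_gt0 powR_gt0.
Unshelve. all: by end_near. Qed.

End upper_bound.

Lemma measurable_fun_rV_on {R : realType} d (T : measurableType d) k (D : set T)
    (f : T -> 'rV[R]_k) :
  measurable D ->
  (forall i, measurable_fun D ((fun x => f x ord0 i) : _ -> measurableTypeR R)) ->
  measurable_fun D f.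
Proof.
move=> mD mf; apply: measurability => /=; first reflexivity.
move=> _ [B + <-]; rewrite -bigcup_seq/= => -[i _ [Y mY <-]].
by have := mf i mD Y mY; rewrite setTI.
Qed.

(** * Finiteness up to the critical exponents *)

Section sufficiency.
Context {R : realType} {n : nat}.
Notation mu := (@lebesgue_measure R).
Notation N := n.+1.
Notation lam := (@lebesgue_rV R N).
Variables (p : R) (r : \bar R).
Hypotheses (p1 : 1 < p) (pN : p < N%:R) (r0 : (0 < r)%E).
Let m : R := N%:R.
Let b := (m - p) / (p - 1).
Let q := conj_exp p.
Let c := omega p / omega m.
Let A := (p - 1) / (m - p) * p * c `^ (p - 1)^-1.
Let rb := neg_pow r (- b).
Let dom := ray_dom p m rb.
Let T (s : R) := A * (s `^ (- b) - rb).
Let C : \bar R := (6 * gap_const p / (A * b) / (1 - expR (- 2^-1)))%:E.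

Let p0 : 0 < p. Proof. by rewrite (lt_trans _ p1). Qed.
Let q0 : 0 < q. Proof. by rewrite (lt_trans _ (conj_exp_gt1 p1)). Qed.
Let mdom : measurable dom. Proof. exact: measurable_ray_dom. Qed.

Lemma alpha_crit_gt0 : 0 < alpha_crit p.
Proof. by rewrite mulr_gt0// powR_gt0// omega_gt0. Qed.

Lemma sobolev_exponent_gt0 : 0 < @sobolev_exponent R N p.
Proof. by rewrite divr_gt0 ?subr_gt0// mulr_gt0. Qed.

Let J (g : R -> R) (gamma alpha : R) : \bar R :=
  (\int[mu]_(s in dom) (expR (alpha * `|g s| `^ gamma - T s) * s `^ (- b - 1))%:E)%E.

Let mJ (v : R -> R) gamma alpha : measurable_fun setT v ->
  measurable_fun dom (fun s => (expR (alpha * `|v s| `^ gamma - T s) * s `^ (- b - 1))%:E).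
Proof.
move=> mv; apply: measurable_funTS; apply/measurable_EFinP.
apply: measurable_funM; last exact: measurable_powR.
apply: measurableT_comp => //; apply: measurable_funB.
  apply: measurable_funM => //; apply: (measurableT_comp (@measurable_powR R gamma)).
  exact: measurableT_comp.
by apply: measurable_funM => //; apply: measurable_funB => //; exact: measurable_powR.
Qed.

Let J0 (v : R -> R) gamma alpha s : (0 <= (expR (alpha * `|v s| `^ gamma - T s) * s `^ (- b - 1))%:E)%E.
Proof. by rewrite lee_fin mulr_ge0 ?expR_ge0 ?powR_ge0. Qed.

(** The approximating gradients are only known to have norm at most M for a given M > 1, which
    forces an exponent below the critical one. With M' = ((j+2)/(j+1))^(1/q) one has al_j M'^q =
    alpha_crit, and as [C] does not depend on j, Fatou's lemma lets j tend to infinity. *)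
Let J_critical (u : 'rV[R]_N -> R) (g : R -> R) (G : 'rV[R]_N -> 'rV[R]_N) :
  measurable_fun (eball r) u -> measurable_fun setT g ->
  {ae lam, forall x, eball r x -> u x = g (enorm x)} ->
  is_grad p r u G -> (ball_norm r p (fun x => enorm (G x)) <= 1)%E ->
  (J g q (alpha_crit p) <= C)%E.
Proof.
move=> mu_ mg ug [mG [phi [[tphi _ cphi] cgrad]]] G1.
have sphi k : smooth (phi k) by case: (tphi k).
pose z0 : 'rV[R]_N -> R := cst 0.
have grad0 (x : 'rV[R]_N) : grad z0 x = 0.
  by apply/rowP => i; rewrite !mxE /partial derive_cst.
pose al (j : nat) := alpha_crit p * (j.+1%:R / j.+2%:R).
have al0 j : 0 < al j by rewrite mulr_gt0 ?alpha_crit_gt0// divr_gt0.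
have Jal j : (J g q (al j) <= C)%E.
  pose M' := (j.+2%:R / j.+1%:R : R) `^ q^-1.
  have M'1 : 1 < M'.
    apply: (@le_lt_trans _ _ (1 `^ q^-1)); first by rewrite powR1.
    apply: gt0_ltr_powR; rewrite ?invr_gt0 ?nnegrE ?divr_ge0//.
    by rewrite ltr_pdivlMr// mul1r ltr_nat.
  pose M := (1 + M') / 2.
  have M1 : 1 < M by rewrite /M; lra.
  have MM' : M < M' by rewrite /M; lra.
  have e0 : 0 < M - 1 by rewrite subr_gt0.
  have [k0 _ hk0] := cvge0_near_lt cgrad e0.
  have hM k : (k0 <= k)%N -> (ball_norm r p (fun x => enorm (grad (phi k) x - grad z0 x)) <= M%:E)%E.
    move=> kk; have -> : M%:E = ((M - 1)%:E + 1)%E by rewrite -EFinD subrK.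
    have hk := hk0 k kk; rewrite /= in hk.
    apply: le_trans (leeD hk G1).
    have mgr : measurable_fun (eball r) (grad (phi k)) by apply: measurable_funTS; exact: measurable_grad.
    apply: (@Lnorm_ball_triangle R N r p (fun x => enorm (grad (phi k) x - grad z0 x)) (fun x => enorm (grad (phi k) x - G x)) (fun x => enorm (G x))); first exact: ltW.
    - apply: measurable_funTS; apply: (measurableT_comp (@measurable_enorm R N)).
      by apply: measurable_gradB => //; have [] := @test_fun_cst0 R n r.
    - apply: (measurableT_comp (@measurable_enorm R N)).
      apply: measurable_fun_rV_on => [|i]; first exact: measurable_eball.
      rewrite [X in measurable_fun _ X](_ : _ = (fun x => grad (phi k) x ord0 i - G x ord0 i)).
        apply: measurable_funB.
          by have := measurableT_comp (@measurable_coord R N i) mgr.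
        by have := measurableT_comp (@measurable_coord R N i) mG.
      by apply/funext => x; rewrite !mxE.
    - exact: (measurableT_comp (@measurable_enorm R N) mG).
    - move=> x; rewrite grad0 subr0 !ger0_norm ?enorm_ge0//.
      by apply: le_trans (enormD _ _); rewrite subrK.
  have alM : al j * M' `^ q <= alpha_crit p.
    rewrite /M' -powRrM mulVf ?gt_eqF// powRr1 ?divr_ge0// /al.
    by rewrite -mulrA mulrA -[leRHS]mulr1 -mulrA ler_wpM2l ?(ltW alpha_crit_gt0)// mulrA divfK// divff.
  have [w] := ray_estimate p1 pN r0 tphi (test_fun_cst0 r) mu_ mg ug sobolev_exponent_gt0 cphi hM
    (ltW (lt_trans ltr01 M1)) MM' (ltW (al0 j)) alM.
  by rewrite /J; under eq_integral do rewrite /= subr0.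
apply: (@fatou_ae _ _ R mu dom (fun j s => (expR (al j * `|g s| `^ q - T s) * s `^ (- b - 1))%:E)) => //.
- by move=> j; exact: mJ.
- exact: mJ.
- apply: aeW => s _; apply/fine_cvgP; split; first exact: nearW.
  apply: cvgMr_tmp.
  apply: (@cvg_comp _ _ _ (fun k => al k * `|g s| `^ q - T s) (@expR R) _ _ _ _ (@continuous_expR R _)).
  apply: cvgB; last exact: cvg_cst.
  apply: cvgMr_tmp; rewrite -[X in _ --> X]mulr1; apply: cvgMl_tmp.
  have -> : (fun j : nat => j.+1%:R / j.+2%:R : R) = (fun j => 1 - j.+2%:R^-1).
    apply/funext => j; have -> : j.+1%:R = j.+2%:R - 1 :> R by rewrite -[j.+2%:R]natr1 addrK.
    by rewrite mulrBl divff// mul1r.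
  rewrite -[X in _ --> X]subr0; apply: cvgB; first exact: cvg_cst.
  by rewrite (cvg_shiftS (fun j : nat => j.+1%:R^-1 : R)); exact: cvg_harmonic.
Qed.

Lemma exp_integral_monotone (u : 'rV[R]_N -> R) gamma (al1 al2 : R) :
  measurable_fun (eball r) u -> al1 <= al2 ->
  (exp_integral p r gamma al1 u <= exp_integral p r gamma al2 u)%E.
Proof.
move=> mu_ a12.
have mV : measurable_fun setT (fun x : 'rV[R]_N => V N p r (enorm x)).
  apply: (@measurableT_comp _ _ _ _ _ _ (fun t : R => V N p r t)); last exact: measurable_enorm.
  rewrite /V; apply: measurable_funM.
    by apply: measurable_funM => //; exact: measurable_powR.
  apply: measurableT_comp => //; apply: measurableT_comp => //.
  by apply: measurable_funM => //; apply: measurable_funB => //; exact: measurable_powR.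
have V0 t : 0 <= V N p r t by rewrite /V !mulr_ge0 ?powR_ge0 ?expR_ge0.
have me al : measurable_fun (eball r) (fun x : 'rV[R]_N => (expR (al * `|u x| `^ gamma) * V N p r (enorm x))%:E).
  apply/measurable_EFinP; apply: measurable_funM; last exact: measurable_funTS.
  apply: measurableT_comp => //; apply: measurable_funM => //.
  apply: (measurableT_comp (@measurable_powR R gamma)).
  exact: measurableT_comp.
apply: ge0_le_integral => //.
- exact: measurable_eball.
- by move=> x _; rewrite lee_fin mulr_ge0 ?expR_ge0.
- by move=> x _; rewrite lee_fin ler_wpM2r// ler_expR ler_wpM2r// powR_ge0.
Qed.

(** Monotonicity in [alpha] reduces every exponent, negative ones included, to the critical one. *)
Lemma T_rad_lty (alpha : R) : alpha <= alpha_crit p -> (T_rad N p r alpha < +oo)%E.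
Proof.
move=> ha; apply: (@le_lt_trans _ _ ((omega m * c `^ q)%:E * C)%E); last exact: ltry.
apply: ge_ereal_sup => _ [u [[[mu_ _] [g mg ug]] [G [uG G1]]] <-].
apply: le_trans (exp_integral_monotone q mu_ ha) _.
rewrite (exp_integral_radial p1 pN r0 q _ mu_ mg ug).
apply: lee_pmul => //.
- by rewrite lee_fin mulr_ge0 ?powR_ge0// (ltW (omega_gt0 _)).
- by apply: integral_ge0 => s _; exact: J0.
- exact: J_critical uG G1.
Qed.

(** Far enough in the Cauchy sequence, the energy of the differences from [phi k0] is so small that
    the exponent alpha 2^q is admissible for the difference, while [phi k0] itself is bounded. The
    factor 2^q is the price of |a + b|^q <= 2^q (|a|^q + |b|^q). *)
Lemma exp_integral_lty (u : 'rV[R]_N -> R) (gamma alpha : R) : 0 < gamma -> gamma <= q ->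
  0 < alpha -> dotW0_rad p r u -> (exp_integral p r gamma alpha u < +oo)%E.
Proof.
move=> g0 gq a0 [[mu_ [phi [tphi cphi lphi]]] [g mg ug]].
pose al := alpha * 2 `^ q.
have al0 : 0 < al by rewrite mulr_gt0// powR_gt0.
pose M' := (alpha_crit p / al) `^ q^-1.
have M'0 : 0 < M' by rewrite powR_gt0// divr_gt0// alpha_crit_gt0.
have M0 : 0 < M' / 2 by rewrite divr_gt0.
have MM' : M' / 2 < M' by rewrite ltr_pdivrMr// ltr_pMr// ltr1n.
have [k0 hk0] := cphi _ M0.
have alM : al * M' `^ q <= alpha_crit p.
  rewrite /M' -powRrM mulVf ?gt_eqF// powRr1 ?divr_ge0 ?(ltW al0) ?(ltW alpha_crit_gt0)//.
  by rewrite mulrC divfK// gt_eqF.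
have hM k : (k0 <= k)%N -> (ball_norm r p (fun x => enorm (grad (phi k) x - grad (phi k0) x)) <= (M' / 2)%:E)%E.
  by move=> kk; exact: hk0.
have [w hw] := ray_estimate p1 pN r0 tphi (tphi k0) mu_ mg ug sobolev_exponent_gt0 lphi hM
  (ltW M0) MM' (ltW al0) alM.
have [S S0 hS] := test_fun_bounded r0 (tphi k0).
(* Collects the 1 from |g|^gamma <= 1 + |g|^q and the bound [S] of the test function. *)
pose D := expR (alpha * (1 + 2 `^ q * S `^ q)).
rewrite (exp_integral_radial p1 pN r0 gamma alpha mu_ mg ug).
apply: lte_mul_pinfty => //; first by rewrite lee_fin mulr_ge0 ?powR_ge0// (ltW (omega_gt0 _)).
have mH : measurable_fun dom (fun s => (expR (al * `|g s - phi k0 (s *: w)| `^ q - T s) * s `^ (- b - 1))%:E).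
  apply: mJ; apply: measurable_funB => //.
  apply: continuous_measurable_fun => s; apply: (@continuous_comp _ _ _ (fun s : R => s *: w) (phi k0)).
    exact: continuous_ray.
  by apply: smooth_continuous; case: (tphi k0).
apply: (@le_lt_trans _ _ (D%:E * C)%E); last exact: ltry.
apply: le_trans (lee_wpmul2l _ hw); last by rewrite lee_fin expR_ge0.
have D0 : 0 <= D by exact: expR_ge0.
rewrite -(ge0_integralZl mu mdom mH (fun s _ => J0 (fun s => g s - phi k0 (s *: w)) q al s)); last by rewrite lee_fin.
apply: ge0_le_integral => //.
- exact: mJ.
- by apply: measurable_funeM.
move=> s _; rewrite -EFinM lee_fin mulrA ler_wpM2r ?powR_ge0// -expRD ler_expR addrA lerD2r.
have step1 : `|g s| `^ gamma <= 1 + `|g s| `^ q.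
  have [g1|g1] := leP `|g s| 1.
    apply: (@le_trans _ _ 1); last by rewrite lerDl powR_ge0.
    suff : `|g s| `^ gamma <= 1 `^ gamma by rewrite powR1.
    by apply: (ge0_ler_powR (ltW g0)) => //; rewrite nnegrE ?ler01.
  apply: (@le_trans _ _ (`|g s| `^ q)); last by rewrite lerDr.
  by apply: ler_powR => //; exact: ltW.
have step2 : `|g s| `^ q <= 2 `^ q * (`|g s - phi k0 (s *: w)| `^ q + S `^ q).
  set x := `|g s - _|.
  have x0 : 0 <= x by exact: normr_ge0.
  have gx : `|g s| <= x + S.
    have -> : g s = (g s - phi k0 (s *: w)) + phi k0 (s *: w) by rewrite subrK.
    by apply: le_trans (ler_normD _ _) _; rewrite lerD2l.
  have [xS|xS] := leP x S.
    apply: (@le_trans _ _ ((2 * S) `^ q)).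
      apply: (ge0_ler_powR (ltW q0)); rewrite ?nnegrE; [exact: normr_ge0|by rewrite mulr_ge0|].
      by apply: le_trans gx _; lra.
    by rewrite powRM// ler_wpM2l ?powR_ge0// lerDr powR_ge0.
  apply: (@le_trans _ _ ((2 * x) `^ q)).
    apply: (ge0_ler_powR (ltW q0)); rewrite ?nnegrE; [exact: normr_ge0|by rewrite mulr_ge0|].
    by apply: le_trans gx _; lra.
  by rewrite powRM// ler_wpM2l ?powR_ge0// lerDl powR_ge0.
have := ler_wpM2l (ltW a0) (le_trans step1 (lerD (lexx 1) step2)).
rewrite /al; set X := _ `^ q; set Y := _ `^ q; set Z := _ `^ q; set W := _ `^ gamma => h.
by apply: le_trans h _; lra.
Qed.

End sufficiency.

(** * Sharpness *)

Section radial_functions.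
Context {R : realType} {n : nat}.
Notation mu := (@lebesgue_measure R).
Notation N := n.+1.
Notation lam := (@lebesgue_rV R N).
Implicit Types (x : 'rV[R]_N) (F : R -> R).

Lemma grad_radial F x (d : R) : is_derive (enorm x ^+ 2) 1 F d ->
  grad (fun y => F (enorm y ^+ 2)) x = (2 * d) *: x.
Proof.
move=> dF; apply/rowP => i; rewrite !mxE /partial.
have dFi := @is_derive_comp_fun R _ (fun y : 'rV[R]_N => enorm y ^+ 2) F x (delta_mx ord0 i) d _ dF (is_derive_enorm2 x (delta_mx ord0 i)).
rewrite (_ : (fun y => _) = F \o (fun y => enorm y ^+ 2))// (@derive_val _ _ _ _ _ _ _ dFi).
rewrite (bigD1 i)//= big1 => [|j ji]; first by rewrite mxE !eqxx mulr1 addr0; ring.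
by rewrite mxE eqxx/= (negbTE ji) mulr0.
Qed.

(** Radial functions are written through |x|^2, a polynomial, rather than |x|. Two open sets cover
    the space: where |x|^2 > 0 the composition rule applies, and near the origin the function is
    constant. *)
Lemma test_fun_radial (r : \bar R) F (delta rho : R) : (forall k, Cn1 k [set s | 0 < s] F) ->
  0 < delta -> (forall s, s < delta -> F s = F 0) ->
  (rho%:E < r)%E -> 0 <= rho -> (forall s, rho ^+ 2 <= s -> F s = 0) ->
  test_fun r (fun x => F (enorm x ^+ 2)).
Proof.
move=> CF d0 Fd rr rho0 F0; set f := (fun x => _).
have ce2 : continuous (fun x : 'rV[R]_N => enorm x ^+ 2 : R).
  move=> x; apply: (@continuous_comp _ _ _ (@enorm R N) (fun s : R => s ^+ 2)).
    exact: continuous_enorm.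
  exact: exprn_continuous.
have clB : closed [set x : 'rV[R]_N | enorm x <= rho].
  exact: (proj1 (continuous_closedP (@enorm R N)) (@continuous_enorm R N) _ (@closed_le R rho)).
have KB : closure [set x | f x != 0] `<=` [set x : 'rV[R]_N | enorm x <= rho].
  rewrite [X in _ `<=` X](_ : _ = closure [set x : 'rV[R]_N | enorm x <= rho]); last exact/closure_id.
  apply: closure_subset => x /=; apply: contraNT; rewrite -ltNge => rx.
  by rewrite /f F0// lerXn2r ?nnegrE ?enorm_ge0 ?(ltW rx).
split.
- apply: smooth_Cn => k.
  have oU : open [set x : 'rV[R]_N | 0 < enorm x ^+ 2].
    apply: (@open_comp _ _ (fun x : 'rV[R]_N => enorm x ^+ 2) [set s | 0 < s]) => [x _|]; [exact: ce2|exact: open_gt].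
  have oW : open [set x : 'rV[R]_N | enorm x ^+ 2 < delta].
    apply: (@open_comp _ _ (fun x : 'rV[R]_N => enorm x ^+ 2) [set s | s < delta]) => [x _|]; [exact: ce2|exact: open_lt].
  apply: (@Cn_sub _ _ _ _ _ ([set x : 'rV[R]_N | 0 < enorm x ^+ 2] `|` [set x : 'rV[R]_N | enorm x ^+ 2 < delta])).
    move=> x _ /=; have [->|] := eqVneq (enorm x ^+ 2) 0; first by right.
    by move=> x0; left; rewrite lt0r x0 exprn_ge0// enorm_ge0.
  apply: Cn_setU.
    apply: (Cn_comp oU (W := [set s | 0 < s])) => //.
    by apply: Cn_sub (Cn_enorm2 _ _).
  by apply: (Cn_ext oW _ (Cn_cst _ _ _ (F 0))) => x xd; rewrite /f Fd.
- apply: bounded_closed_compact; last exact: closed_closure.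
  exists rho; split; first exact: num_real.
  move=> y ry x /KB /= xr; apply: le_trans (ltW ry); apply: le_trans xr.
  rewrite [leLHS]/Num.norm /= mx_normrE; apply: bigmax_le => [|[i j] _]; first exact: enorm_ge0.
  by rewrite (ord1 i); exact: le_coord_enorm.
- by move=> x /KB /= xr; apply: le_lt_trans rr; rewrite lee_fin.
Qed.

Lemma ball_norm_radial_le (r : \bar R) (q M : R) (f : 'rV[R]_N -> R) (H : R -> R) :
  0 < q -> 0 <= M -> measurable_fun (eball r) f -> measurable_fun setT H ->
  (forall s, 0 <= H s) -> (forall x, 0 < enorm x -> `|f x| <= H (enorm x)) ->
  ((omega N%:R)%:E * \int[mu]_(s in `]0%R, +oo[) ((s `^ (N%:R - 1))%:E * (H s `^ q)%:E) <= (M `^ q)%:E)%E ->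
  (ball_norm r q f <= M%:E)%E.
Proof.
move=> q0 M0 mf mH H0 fH hM; apply/ball_norm_leP => //; apply: le_trans hM.
(* The bound on [f] holds off the origin. Changing [H] at 0 and below makes it hold everywhere
   without affecting the radial integral. *)
pose H' (s : R) := if 0 < s then H s else `|f 0|.
have mH' : measurable_fun setT H'.
  by apply: measurable_fun_ifT => //; exact: measurable_fun_ltr.
have H'0 s : 0 <= H' s by rewrite /H'; case: ifP.
have mH'q : measurable_fun setT (fun s => (H' s `^ q)%:E).
  by apply/measurable_EFinP; exact: (measurableT_comp (@measurable_powR R q)).
have -> : (\int[mu]_(s in `]0%R, +oo[) ((s `^ (N%:R - 1))%:E * (H s `^ q)%:E) =
    \int[mu]_(s in `]0%R, +oo[) ((s `^ (N%:R - 1))%:E * (H' s `^ q)%:E))%E.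
  by apply: eq_integral => s; rewrite inE/= in_itv/= andbT /H' => ->.
rewrite -(ge0_integral_radial n mH'q); last by move=> s; rewrite lee_fin powR_ge0.
have mB := @measurable_eball R N r.
have mHe : measurable_fun setT (fun x : 'rV[R]_N => (H' (enorm x) `^ q)%:E).
  exact: (measurableT_comp mH'q (@measurable_enorm R N)).
apply: (@le_trans _ _ (\int[lam]_(x in eball r) (H' (enorm x) `^ q)%:E)%E).
  apply: ge0_le_integral => //.
  - apply/measurable_EFinP; apply: (measurableT_comp (@measurable_powR R q)).
    exact: measurableT_comp.
  - exact: measurable_funTS.
  move=> x _; rewrite lee_fin; apply: (ge0_ler_powR (ltW q0)); rewrite ?nnegrE// /H'.
  have [x0|x0] := boolP (0 < enorm x); first exact: fH.
  have /eqP : enorm x = 0 by apply/le_anti; rewrite leNgt x0 enorm_ge0.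
  by rewrite enorm_eq0 => /eqP ->.
apply: ge0_subset_integral => //.
by move=> x _; rewrite lee_fin powR_ge0.
Qed.

End radial_functions.

Lemma cvge0_le {R : realType} (a : nat -> \bar R) : (forall k, 0 <= a k)%E ->
  (forall e : R, 0 < e -> exists k0, forall k, (k0 <= k)%N -> (a k <= e%:E)%E) ->
  a k @[k --> \oo] --> 0%E.
Proof.
move=> a0 h; apply/fine_cvgP; split.
  have [k0 hk] := h 1 ltr01; exists k0 => // k /= /hk ak.
  by rewrite ge0_fin_numE// (le_lt_trans ak) ?ltry.
apply/cvgrPdist_le => e e0; have [k0 hk] := h e e0; exists k0 => // k /= /hk ak.
rewrite sub0r normrN /= ger0_norm ?fine_ge0//.
by rewrite -lee_fin fineK// ge0_fin_numE// (le_lt_trans ak) ?ltry.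
Qed.

(** * Smoothed truncations of the fundamental solution *)

Section plateau.
Context {R : realType}.
Implicit Types M K y : R.

(** A smooth version of the minimum of M and the positive part of y - K + M. It vanishes for y <= K
    - M - 1 and equals [ramp M] for y >= K, with slope between 0 and 1. *)
Definition plateau (M K y : R) : R := ramp (M - ramp (K - y)).
Definition dplateau (M K y : R) : R := dramp (M - ramp (K - y)) * dramp (K - y).

Lemma is_derive_plateau M K y : is_derive y 1 (plateau M K) (dplateau M K y).
Proof.
have d1 : is_derive y (1:R) (fun y => K - y) (- 1).
  have := @is_deriveB _ _ _ (cst K) id y 1 0 1 (is_derive_cst _ _ _) (is_derive_id _ _).
  by rewrite sub0r.
have d2 : is_derive y (1:R) (fun y => ramp (K - y)) (dramp (K - y) * - 1).
  exact: is_derive_comp_fun (is_derive_ramp _) d1.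
have d3 : is_derive y (1:R) (fun y => M - ramp (K - y)) (0 - dramp (K - y) * - 1).
  exact: (@is_deriveB _ _ _ (cst M) _ y 1 0 _ (is_derive_cst _ _ _) d2).
have := is_derive_comp_fun (is_derive_ramp _) d3.
by rewrite sub0r mulrN1 opprK.
Qed.

Lemma Cn1_affine k (M s : R) : Cn1 k setT (fun y : R => M + s * y).
Proof.
apply: (Cn_add openT (f := cst M)); first exact: Cn_cst.
by apply: (Cn_scale _ openT); exact: Cn1_id.
Qed.

Lemma Cn1_plateau k M K : Cn1 k setT (plateau M K).
Proof.
have C1 : Cn1 k setT (fun y => ramp (K + - 1 * y)).
  by apply: (Cn_comp openT (W := setT)); [by []|exact: Cn1_ramp|exact: Cn1_affine].
have C2 : Cn1 k setT (fun y => M + - 1 * ramp (K + - 1 * y)).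
  by apply: (Cn_comp openT (W := setT) (h := fun y => M + - 1 * y)); [by []|exact: Cn1_affine|exact: C1].
have : Cn1 k setT (fun y => ramp (M + - 1 * ramp (K + - 1 * y))).
  by apply: (Cn_comp openT (W := setT)); [by []|exact: Cn1_ramp|exact: C2].
by apply: Cn_ext; [exact: openT|move=> y _; rewrite /plateau !mulN1r].
Qed.

Lemma plateau_le0 M K y : y + M + 1 <= K -> plateau M K y = 0.
Proof. by move=> h; rewrite /plateau ramp_le0//; have := ramp_ge (K - y); lra. Qed.

Lemma plateau_max M K y : K <= y -> plateau M K y = ramp M.
Proof. by move=> h; rewrite /plateau (@ramp_le0 _ (K - y)) ?subr0//; lra. Qed.

Lemma dplateau_le M K y : 0 <= dplateau M K y <= 1.
Proof.
by rewrite /dplateau mulr_ge0 ?dramp_ge0//= mulr_ile1 ?dramp_ge0 ?dramp_le1.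
Qed.

Lemma dplateau_eq0 M K y : y + M + 1 <= K \/ K <= y -> dplateau M K y = 0.
Proof.
move=> [h|h]; rewrite /dplateau; last by rewrite (@dramp_le0 _ (K - y)) ?mulr0//; lra.
by rewrite dramp_le0 ?mul0r//; have := ramp_ge (K - y); lra.
Qed.

Lemma measurable_plateau M K : measurable_fun setT (plateau M K).
Proof.
apply: continuous_measurable_fun => z.
exact: (Cn_continuous (Cn1_plateau 0 M K)).
Qed.

End plateau.

Section necessity.
Context {R : realType} {n : nat}.
Notation mu := (@lebesgue_measure R).
Notation N := n.+1.
Notation lam := (@lebesgue_rV R N).
Variables (p : R) (r : \bar R).
Hypotheses (p1 : 1 < p) (pN : p < N%:R) (r0 : (0 < r)%E).
Let m : R := N%:R.
Let b := (m - p) / (p - 1).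
Let q := conj_exp p.
Let c := omega p / omega m.
Let A := (p - 1) / (m - p) * p * c `^ (p - 1)^-1.
Let rb := neg_pow r (- b).
Let dom := ray_dom p m rb.
Let T (s : R) := A * (s `^ (- b) - rb).

Let b0 : 0 < b. Proof. by rewrite divr_gt0// subr_gt0. Qed.
Let p0 : 0 < p. Proof. by rewrite (lt_trans _ p1). Qed.
Let q0 : 0 < q. Proof. by rewrite (lt_trans _ (conj_exp_gt1 p1)). Qed.
Let c0 : 0 < c. Proof. by rewrite divr_gt0// omega_gt0. Qed.
Let A0 : 0 < A. Proof. by rewrite !mulr_gt0 ?powR_gt0 ?invr_gt0 ?subr_gt0. Qed.

Let powRNb (y k : R) : 0 < y -> k != 0 -> (y `^ (- k^-1)) `^ (- k) = y.
Proof. by move=> y0 k0; rewrite -powRrM mulrNN mulVf// powRr1// ltW. Qed.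

(** Only the slab where s^(-b) lies in [y, y + 1] is kept: its weight is 1 / b, and there T <= A (y
    + 1 - rb). *)
Lemma exp_integral_ge (u : 'rV[R]_N -> R) (g : R -> R) (gamma alpha y E : R) :
  measurable_fun (eball r) u -> measurable_fun setT g ->
  {ae lam, forall x, eball r x -> u x = g (enorm x)} -> 0 < y -> rb < y ->
  (forall s, 0 < s -> y <= s `^ (- b) -> E <= alpha * `|g s| `^ gamma) ->
  ((omega m * c `^ q * (expR (E - A * (y + 1 - rb)) / b))%:E <= exp_integral p r gamma alpha u)%E.
Proof.
move=> mu_ mg ug y0 rby hE; rewrite (exp_integral_radial p1 pN r0 gamma alpha mu_ mg ug).
have Nb : - b^-1 < 0 by rewrite oppr_lt0 invr_gt0.
pose s2 := y `^ (- b^-1); pose s1 := (y + 1) `^ (- b^-1).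
have y10 : 0 < y + 1 by rewrite addr_gt0.
have s10 : 0 < s1 by exact: powR_gt0.
have s20 : 0 < s2 by exact: powR_gt0.
have s2E : s2 `^ (- b) = y by rewrite powRNb// gt_eqF.
have s1E : s1 `^ (- b) = y + 1 by rewrite powRNb// gt_eqF.
have Nb0 : - b <= 0 by rewrite oppr_le0 ltW.
have s12 : s1 < s2.
  rewrite ltNge; apply/negP => h; have := ler_powRN Nb0 s20 h.
  by rewrite s1E s2E gerDl ler10.
have sub : `[s1, s2]%classic `<=` dom.
  move=> s /=; rewrite in_itv/= => /andP[h1 h2]; have s0 := lt_le_trans s10 h1.
  by split => //; apply: (lt_le_trans rby); rewrite -s2E; exact: ler_powRN.
rewrite EFinM; apply: lee_wpmul2l.
  by rewrite lee_fin mulr_ge0 ?powR_ge0// (ltW (omega_gt0 _)).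
have mI : measurable (`[s1, s2]%classic : set R) by [].
pose K := expR (E - A * (y + 1 - rb)).
have mf : measurable_fun setT (fun s => (expR (alpha * `|g s| `^ gamma - T s) * s `^ (- b - 1))%:E).
  apply/measurable_EFinP.
  apply: measurable_funM; last exact: measurable_powR.
  apply: measurableT_comp => //; apply: measurable_funB.
    apply: measurable_funM => //; apply: (measurableT_comp (@measurable_powR R gamma)).
    exact: measurableT_comp.
  by apply: measurable_funM => //; apply: measurable_funB => //; exact: measurable_powR.
apply: (@le_trans _ _ (\int[mu]_(s in `[s1, s2]) (expR (alpha * `|g s| `^ gamma - T s) * s `^ (- b - 1))%:E)%E); last first.
  apply: ge0_subset_integral => //.
  - exact: measurable_ray_dom.
  - exact: measurable_funTS.
  - by move=> s _; rewrite lee_fin mulr_ge0 ?expR_ge0 ?powR_ge0.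
have mk : measurable_fun (`[s1, s2]%classic : set R) (fun s : R => (s `^ (- b - 1))%:E).
  by apply: measurable_funTS; apply/measurable_EFinP; exact: measurable_powR.
have -> : ((K / b)%:E = \int[mu]_(s in `[s1, s2]) (K%:E * (s `^ (- b - 1))%:E))%E.
  rewrite (ge0_integralZl mu mI mk); [|by move=> s _; rewrite lee_fin powR_ge0|by rewrite lee_fin expR_ge0].
  rewrite integral_powR_itvcc ?oppr_eq0 ?gt_eqF// s1E s2E -EFinM; congr (_%:E).
  by congr (_ * _); rewrite invrN opprD addrA subrr sub0r mulrNN mul1r.
apply: ge0_le_integral => //.
- by move=> s _; rewrite mule_ge0// lee_fin ?expR_ge0 ?powR_ge0.
- by apply: measurable_funeM.
- exact: measurable_funTS.
move=> s /=; rewrite in_itv/= => /andP[h1 h2]; have s0 := lt_le_trans s10 h1.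
rewrite lee_fin ler_wpM2r ?powR_ge0// ler_expR lerB//.
  by apply: hE => //; rewrite -s2E; exact: ler_powRN.
by rewrite ler_pM2l// lerD2r -s1E; exact: ler_powRN.
Qed.

Lemma integral_radial_power (I : set R) (k e a : R) : 0 < a -> 0 <= k ->
  measurable I -> I `<=` `]0, +oo[%classic ->
  (\int[mu]_(s in `]0%R, +oo[) ((s `^ (m - 1))%:E * ((k * s `^ e * \1_I s) `^ a)%:E) =
   (k `^ a)%:E * \int[mu]_(s in I) (s `^ (m - 1 + e * a))%:E)%E.
Proof.
move=> a0 k0 mI I0.
have mk : measurable_fun I (fun s : R => (s `^ (m - 1 + e * a))%:E).
  by apply: measurable_funTS; apply/measurable_EFinP; exact: measurable_powR.
rewrite -(ge0_integralZl mu mI mk); [|by move=> s _; rewrite lee_fin powR_ge0|by rewrite lee_fin powR_ge0].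
rewrite [RHS](_ : _ = \int[mu]_(s in `]0%R, +oo[ `&` I) ((k `^ a)%:E * (s `^ (m - 1 + e * a))%:E))%E; last first.
  by congr (integral _ _ _); apply/seteqP; split => s; [move=> Is; split => //; exact: I0|case].
rewrite [RHS]integral_mkcondr; apply: eq_integral => s; rewrite inE/= in_itv/= andbT => s0.
rewrite patchE; case: ifPn => sI.
  rewrite indicE sI mulr1 powRM ?powR_ge0// -powRrM -!EFinM mulrCA -powRD//.
  by apply/implyP => _; rewrite gt_eqF.
by rewrite indicE (negbTE sI) mulr0 powR0 ?gt_eqF// mule0.
Qed.

Lemma ball_norm_cst0 (a : R) : 0 < a -> ball_norm r a (fun _ : 'rV[R]_N => 0) = 0%E.
Proof.
move=> a0; apply/eqP; rewrite eq_le ball_norm_ge0 andbT; apply/ball_norm_leP => //.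
by under eq_integral do rewrite normr0 powR0 ?gt_eqF//; rewrite integral0 powR0 ?gt_eqF.
Qed.

Lemma represents_test_fun (u : 'rV[R]_N -> R) : test_fun r u -> represents p r (fun=> u) u.
Proof.
move=> tu; split => // [e e0|].
  exists 0%N => k l _ _.
  rewrite (_ : (fun x => _) = (fun=> 0)) ?ball_norm_cst0 ?lee_fin ?(ltW e0)//.
  by apply/funext => x; rewrite subrr enorm0.
rewrite (_ : (fun k : nat => _) = (fun=> 0%E)); first exact: cvg_cst.
apply/funext => k; rewrite (_ : (fun x => _) = (fun=> 0)).
  by rewrite ball_norm_cst0// sobolev_exponent_gt0.
by apply/funext => x; rewrite subrr.
Qed.

Lemma radius_lt : exists2 rho : R, 0 < rho & (rho%:E < r)%E.
Proof.
case: r r0 => [s| |]//; rewrite ?lte_fin => s0.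
  by exists (s / 2); rewrite ?lte_fin; lra.
by exists 1; rewrite ?ltry.
Qed.

Let omm0 : 0 < omega m. Proof. exact: omega_gt0. Qed.
Let AbE : A * b = alpha_crit p / omega m `^ (p - 1)^-1.
Proof. exact: rate_mul. Qed.

(** A function of s^(-b) with slope at most h, varying over an interval of length L, has energy at
    most omega_m h^p b^(p-1) L, and [h] makes this 1. The plateau has height at least h (L - 2), as
    smoothing costs 1 twice. Since h^q = (A / alpha_crit) L^(1-q), its q-th power is at least (A /
    alpha_crit) L (1 - 2/L)^q, which [powR_ge1Bx] bounds below by (A / alpha_crit) (L - 4 q). The
    condition L >= 4 is its condition on 2/L. *)
Lemma moser_function (alpha L rho : R) : 4 <= L -> 0 < rho -> (rho%:E < r)%E -> 0 <= alpha ->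
  exists u : 'rV[R]_N -> R, [/\ dotW0_rad p r u,
    exists G, is_grad p r u G /\ (ball_norm r p (fun x => enorm (G x)) <= 1)%E &
    ((omega m * c `^ q * (expR (alpha / alpha_crit p * A * (L - 4 * q)
        - A * (rho `^ (- b) + L + 1 - rb)) / b))%:E <= exp_integral p r q alpha u)%E].
Proof.
have half (x : R) : 2%:R * - (x / 2) = - x by field.
have half1 (x : R) : 2%:R * (- (x / 2) - 1) = - x - 2 by field.
have sqr_powR (s k : R) : 0 < s -> (s ^+ 2) `^ k = s `^ (2%:R * k).
  by move=> s0; rewrite -powR_mulrn ?(ltW s0)// -powRrM.
have powRDp (x k l : R) : 0 < x -> x `^ (k + l) = x `^ k * x `^ l.
  by move=> x0; rewrite powRD//; apply/implyP => _; rewrite gt_eqF.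
move=> L4 rho0 rhor al0.
pose y1 := rho `^ (- b); pose K := y1 + L; pose M := L - 1.
have y10 : 0 < y1 by exact: powR_gt0.
have K0 : 0 < K by rewrite addr_gt0//; lra.
have Nb0 : - b <= 0 by rewrite oppr_le0 ltW.
have rby1 : rb < y1.
  have := proj2 (ray_domE rho p1 pN r0) (conj rho0 rhor).
  by case.
pose h := (omega m * b `^ (p - 1) * L) `^ (- p^-1).
have L0 : 0 < L by lra.
have Z0 : 0 < omega m * b `^ (p - 1) * L by apply: mulr_gt0 => //; apply: mulr_gt0 => //; exact: powR_gt0.
have h0 : 0 < h by exact: powR_gt0.
(* The argument stands for |x|^2, hence the exponent b / 2. At 0 and below the plateau value is
   imposed, which makes [F] constant near 0. *)
pose F (s : R) := h * (if 0 < s then plateau M K (s `^ (- (b / 2))) else ramp M).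
have F_sqr s : 0 < s -> F (s ^+ 2) = h * plateau M K (s `^ (- b)).
  by move=> s0; rewrite /F (exprn_gt0 2 s0) (sqr_powR _ _ s0) half.
have mF : measurable_fun setT F.
  apply: measurable_funM => //; apply: measurable_fun_ifT => //; first exact: measurable_fun_ltr.
  exact: (measurableT_comp (measurable_plateau M K) (@measurable_powR R _)).
have CF k : Cn1 k [set s | 0 < s] F.
  have o0 : open [set s : R | 0 < s] by exact: open_gt.
  apply: (Cn_ext o0 (f := fun s => h * (plateau M K \o (@powR R ^~ (- (b / 2)))) s)).
    by move=> s /= s0; rewrite /F s0.
  apply: (Cn_scale _ o0); apply: (Cn_comp o0 (W := setT)) => //; first exact: Cn1_plateau.
  exact: Cn1_powR.
have dF (s : R) : 0 < s -> is_derive s (1:R) F (h * (dplateau M K (s `^ (- (b / 2))) * (- (b / 2) * s `^ (- (b / 2) - 1)))).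
  move=> s0.
  have d1 : is_derive s (1:R) (@powR R ^~ (- (b / 2))) (- (b / 2) * s `^ (- (b / 2) - 1)).
    exact: is_derive1_powR.
  have d2 := @is_derive_comp_fun R R (fun t : R => t `^ (- (b / 2))) (plateau M K) s 1 _ _ (is_derive_plateau M K (s `^ (- (b / 2)))) d1.
  have d3 := @is_deriveZ _ _ _ (plateau M K \o (@powR R ^~ (- (b / 2)))) h s 1 _ d2.
  apply: (near_eq_is_derive _ d3).
  by near=> z; rewrite /= /F ifT//; near: z; exact: lt_nbhsr.
have Flow s : s < K `^ (- (b / 2)^-1) -> F s = F 0.
  move=> sK; rewrite /F ltxx; case: ifPn => [s0|_]; last by [].
  rewrite plateau_max; first by [].
  have b20 : 0 < b / 2 by rewrite divr_gt0.
  rewrite -[leLHS](@powRNb K (b / 2) K0 (lt0r_neq0 b20)).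
  by apply: ler_powRN => //; [rewrite oppr_le0 (ltW b20)|exact: ltW].
have Fhigh s : rho ^+ 2 <= s -> F s = 0.
  move=> rs; have s0 : 0 < s by apply: lt_le_trans rs; rewrite exprn_gt0.
  rewrite /F s0 plateau_le0 ?mulr0// /M /K.
  suff : s `^ (- (b / 2)) <= y1 by lra.
  have b20 : - (b / 2) <= 0 by rewrite oppr_le0 divr_ge0 ?(ltW b0).
  apply: le_trans (ler_powRN b20 (exprn_gt0 2 rho0) rs) _.
  by rewrite (sqr_powR _ _ rho0) half.
have hE : h = (omega m * b `^ (p - 1) * L) `^ (- p^-1) by [].
clearbody F h.
pose u (x : 'rV[R]_N) := F (enorm x ^+ 2).
have tu : test_fun r u.
  exact: (@test_fun_radial _ _ r F (K `^ (- (b / 2)^-1)) rho CF (powR_gt0 _ K0) Flow rhor (ltW rho0) Fhigh).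
have su : smooth u by case: tu.
have mu_ : measurable_fun setT u.
  exact: (measurableT_comp mF (measurable_funX 2 (@measurable_enorm R N))).
have repu := represents_test_fun tu.
have mgu : measurable_fun setT (grad u) by exact: measurable_grad.
exists u; split.
- split; first by split; [exact: measurable_funTS|exists (fun=> u)].
  exists (fun s => F (s ^+ 2)); last by apply: aeW.
  exact: (measurableT_comp mF (measurable_funX 2 (@measurable_id _ _ _))).
- exists (grad u); split.
    split; first exact: measurable_funTS.
    exists (fun=> u); split => //.
    rewrite (_ : (fun k : nat => _) = (fun=> 0%E)); first exact: cvg_cst.
    apply/funext => k; rewrite (_ : (fun x => _) = (fun=> 0)); first by rewrite ball_norm_cst0.
    by apply/funext => x; rewrite subrr enorm0.
  pose s1 := K `^ (- b^-1).
  have s10 : 0 < s1 by exact: powR_gt0.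
  pose I : set R := `[s1, rho]%classic.
  have s1E : s1 `^ (- b) = K by rewrite powRNb// gt_eqF.
  have s1rho : s1 < rho.
    rewrite ltNge; apply/negP => hh; have := ler_powRN Nb0 rho0 hh.
    by rewrite s1E -/y1 /K; lra.
  have mI : measurable I by exact: measurable_itv.
  have hb0 : 0 <= h * b by rewrite mulr_ge0 ?(ltW h0) ?(ltW b0).
  apply: (@ball_norm_radial_le _ _ _ _ _ _ (fun s => h * b * s `^ (- b - 1) * \1_I s)) => //.
  - by apply: measurable_funTS; apply: (measurableT_comp (@measurable_enorm R N)).
  - apply: measurable_funM; last by apply: measurable_indic; exact: mI.
    by apply: measurable_funM => //; exact: measurable_powR.
  - by move=> s; apply: mulr_ge0; [apply: mulr_ge0; [exact: hb0|exact: powR_ge0]|rewrite indicE].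
  - move=> x x0; have x20 : 0 < enorm x ^+ 2 := exprn_gt0 2 x0.
    rewrite (grad_radial (dF _ x20)) enormZ [leLHS]ger0_norm; last by apply: mulr_ge0; [exact: normr_ge0|exact: enorm_ge0].
    have -> : (enorm x ^+ 2) `^ (- (b / 2)) = enorm x `^ (- b).
      by rewrite (sqr_powR _ _ x0) half.
    have -> : (enorm x ^+ 2) `^ (- (b / 2) - 1) = enorm x `^ (- b - 2).
      by rewrite (sqr_powR _ _ x0) half1.
    have E : enorm x `^ (- b - 1) = enorm x `^ (- b - 2) * enorm x.
      rewrite -{3}(powRr1 (ltW x0)) -(powRDp _ _ _ x0).
      by congr (_ `^ _); lra.
    set D := dplateau _ _ _.
    have [D0 D1] : 0 <= D /\ D <= 1 by apply/andP; exact: dplateau_le.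
    have fac (x1 x2 x3 x4 : R) : 2 * (x1 * (x2 * (- (x3 / 2) * x4))) = - (x1 * x3 * x2 * x4) by field.
    rewrite fac.
    rewrite normrN ger0_norm; last by apply: mulr_ge0; [exact: mulr_ge0|exact: powR_ge0].
    rewrite E indicE; have [xI|xI] := boolP (enorm x \in I).
      rewrite mulr1 mulrA ler_wpM2r ?(ltW x0)// ler_wpM2r ?powR_ge0//.
      by rewrite -[leRHS]mulr1 ler_wpM2l.
    suff -> : D = 0 by rewrite !mulr0 !mul0r.
    have : ~~ (enorm x \in `[s1, rho]) by apply: contra xI => h1; rewrite inE.
    rewrite in_itv /= negb_and -!ltNge => /orP[xs|xs]; apply: dplateau_eq0.
      by right; rewrite -s1E; apply: ler_powRN => //; exact: ltW.
    left; have : enorm x `^ (- b) <= y1 by apply: ler_powRN => //; exact: ltW.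
    by rewrite /M /K; lra.
  - have I0 : I `<=` `]0, +oo[%classic.
      by move=> s /=; rewrite !in_itv/= andbT => /andP[/(lt_le_trans s10)].
    rewrite (integral_radial_power _ p0 hb0 mI I0).
    have -> : m - 1 + (- b - 1) * p = - b - 1.
      have H (x1 x2 : R) : x2 - 1 != 0 -> x1 - 1 + (- ((x1 - x2) / (x2 - 1)) - 1) * x2 = - ((x1 - x2) / (x2 - 1)) - 1 by move=> ?; field.
      by apply: H; rewrite gt_eqF// subr_gt0.
    rewrite integral_powR_itvcc ?oppr_eq0 ?gt_eqF// s1E -/y1 -!EFinM lee_fin powR1.
    have -> : (y1 - K) / - b = L / b.
      have H (x1 x2 x3 : R) : (x1 - (x1 + x2)) / - x3 = x2 / x3 by rewrite opprD addrA subrr sub0r invrN mulrNN.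
      exact: H.
    rewrite powRM ?(ltW h0) ?(ltW b0)// hE -powRrM mulNr mulVf ?gt_eqF// powR_inv1 ?(ltW Z0)//.
    have -> : b `^ p = b `^ (p - 1) * b.
      by rewrite -[X in _ * X](powRr1 (ltW b0)) -(powRDp _ _ _ b0) subrK.
    have : b `^ (p - 1) != 0 by rewrite gt_eqF// powR_gt0.
    have : omega m != 0 by rewrite gt_eqF.
    have bn0 : b != 0 by rewrite gt_eqF.
    have Ln0 : L != 0 by rewrite gt_eqF.
    move: (b `^ (p - 1)) (omega m) b bn0 => B W b' bn0 W0 B0.
    rewrite le_eqVlt; apply/orP; left; apply/eqP; field.
    by rewrite W0 B0 bn0 Ln0.
- have -> : rho `^ (- b) + L + 1 = K + 1 by [].
  apply: (@exp_integral_ge _ (fun s => F (s ^+ 2))) => //.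
  - exact: measurable_funTS.
  - exact: (measurableT_comp mF (measurable_funX 2 (@measurable_id _ _ _))).
  - exact: aeW.
  - by apply: lt_trans rby1 _; rewrite /K; lra.
  move=> s s0 Ks; rewrite F_sqr// plateau_max//.
  have rM : L - 2 <= ramp M by have := ramp_ge M; rewrite /M; lra.
  have L20 : 0 <= L - 2 by lra.
  apply: (@le_trans _ _ (alpha * (h * (L - 2)) `^ q)); last first.
    apply: ler_wpM2l => //; apply: (ge0_ler_powR (ltW q0)); rewrite ?nnegrE ?mulr_ge0 ?(ltW h0)//.
    by apply: le_trans (ler_norm _); rewrite ler_pM2l.
  have hq : h `^ q = (A / alpha_crit p) * L `^ (1 - q).
    have qE : q = 1 + (p - 1)^-1.
      by rewrite /q /conj_exp; field; rewrite gt_eqF// subr_gt0.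
    have -> : A / alpha_crit p = (omega m `^ (p - 1)^-1 * b)^-1.
      rewrite -[A](mulfK (x := b)) ?gt_eqF// AbE.
      by field; rewrite !gt_eqF ?powR_gt0 ?(alpha_crit_gt0 p1)//.
    rewrite hE -powRrM mulNr.
    have -> : p^-1 * q = (p - 1)^-1.
      by rewrite /q /conj_exp; field; rewrite !gt_eqF// subr_gt0.
    have W0 : 0 <= omega m by exact: ltW.
    have p10 : p - 1 != 0 by rewrite gt_eqF// subr_gt0.
    rewrite powRN (powRM _ (mulr_ge0 W0 (powR_ge0 _ _)) (ltW L0)) (powRM _ W0 (powR_ge0 _ _)).
    rewrite -powRrM (mulfV p10).
    have q1E : 1 - q = - (p - 1)^-1 by rewrite qE opprD addrA subrr sub0r.
    by rewrite (powRr1 (ltW b0)) q1E powRN invfM.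
  rewrite powRM ?(ltW h0)// hq.
  have -> : L - 2 = L * (1 - 2 / L) by field; rewrite gt_eqF.
  have e1 : 0 <= 2 / L <= 2^-1.
    by rewrite divr_ge0 ?(ltW L0)//= ler_pdivrMr//; lra.
  have LV0 : 0 <= 1 - 2 / L by lra.
  rewrite powRM ?(ltW L0)//.
  have EL : L `^ (1 - q) * L `^ q = L.
    by rewrite -(powRDp _ _ _ L0) subrK powRr1// ltW.
  have -> : alpha * (A / alpha_crit p * L `^ (1 - q) * (L `^ q * (1 - 2 / L) `^ q)) =
    alpha / alpha_crit p * A * (L * (1 - 2 / L) `^ q).
    by rewrite -[X in _ = _ * (X * _)]EL; ring.
  apply: ler_wpM2l; first by rewrite mulr_ge0 ?divr_ge0 ?(ltW A0) ?(ltW (alpha_crit_gt0 p1)).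
  have := ler_wpM2l (ltW L0) (powR_ge1Bx q0 e1).
  suff -> : L * (1 - 2 * q * (2 / L)) = L - 4 * q by [].
  by field; rewrite gt_eqF.
Unshelve. all: by end_near. Qed.

Lemma T_rad_pinfty (alpha : R) : alpha_crit p < alpha -> T_rad N p r alpha = +oo%E.
Proof.
move=> ha; apply/eqP; rewrite -leye_eq leNgt; apply/negP => Tfin.
have ac0 := alpha_crit_gt0 p1.
have [rho rho0 rhor] := radius_lt.
pose D := omega m * c `^ q / b.
have D0 : 0 < D by rewrite divr_gt0// mulr_gt0// powR_gt0.
pose ka := alpha / alpha_crit p.
have ka1 : 0 < ka - 1 by rewrite subr_gt0 ltr_pdivlMr// mul1r.
have al0 : 0 <= alpha by rewrite ltW// (lt_trans ac0).
pose d := 4 * ka * q + rho `^ (- b) + 1 - rb.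
have lb L : 4 <= L -> ((D * expR (A * ((ka - 1) * L - d)))%:E <= T_rad N p r alpha)%E.
  move=> L4; have [u [du Gu hu]] := moser_function L4 rho0 rhor al0.
  apply: (@le_trans _ _ (exp_integral p r q alpha u)); last by apply: ereal_sup_ubound; exists u.
  apply: le_trans hu; rewrite lee_fin -/ka le_eqVlt; apply/orP; left; apply/eqP.
  have -> : ka * A * (L - 4 * q) - A * (rho `^ (- b) + L + 1 - rb) = A * ((ka - 1) * L - d).
    by rewrite /d; move: (rho `^ _) (A) (q) (rb) => *; ring.
  by rewrite /D; move: (expR _) (omega m) (c `^ q) (b) => *; ring.
have [t Tt] : exists t, T_rad N p r alpha = t%:E.
  have := lb 4 (lexx _); move: (T_rad N p r alpha) Tfin => [t| |]//; first by exists t.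
clearbody D d ka.
(* Large enough for the exponent to reach |t| / D, where t is the supposed finite value of the
   supremum. Then 1 + x <= e^x gives more than t. *)
pose L := Num.max 4 ((d + `|t| / (D * A)) / (ka - 1)).
have L4 : 4 <= L by rewrite /L le_max lexx.
have L1 : d + `|t| / (D * A) <= (ka - 1) * L.
  by rewrite [leRHS]mulrC -ler_pdivrMr// /L le_max lexx orbT.
have := lb L L4; rewrite Tt lee_fin leNgt => /negP; apply.
have e1 : `|t| / D <= A * ((ka - 1) * L - d).
  have -> : `|t| / D = A * (`|t| / (D * A)).
    by move: (A) A0 => A' A'0; field; rewrite !gt_eqF.
  by rewrite ler_pM2l//; lra.
apply: (@lt_le_trans _ _ (D * (1 + `|t| / D))).
  rewrite mulrDr mulr1 mulrC divfK ?gt_eqF//.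
  by apply: le_lt_trans (ler_norm t) _; rewrite ltrDr.
rewrite ler_pM2l//; apply: le_trans (expR_ge1Dx _); lra.
Qed.

End necessity.

(** * A smooth dyadic power with a singularity at the origin *)

Section dyadic.
Context {R : realType}.
Implicit Types a s rho : R.

Lemma pow2_large (Q : R) : exists j0, forall j, (j0 <= j)%N -> Q <= 2 ^+ j.
Proof.
exists (Num.bound Q) => j hj; apply: (le_trans (ltW (le_lt_trans (ler_norm Q) (archi_boundP (normr_ge0 Q))))).
rewrite -natrX ler_nat; apply: leq_trans (leq_trans hj (ltnW (ltn_expl j (ltnSn 1)))).
by rewrite /Num.bound normr_id.
Qed.

Lemma pow2_powR a j : (2 ^+ j) `^ a = (2 `^ a) ^+ j :> R.
Proof. by rewrite -!powR_mulrn ?powR_ge0// -!powRrM mulrC. Qed.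

Lemma powR2_gt1 a : 0 < a -> 1 < 2 `^ a :> R.
Proof. by move=> a0; rewrite /powR pnatr_eq0/= expR_gt1 mulr_gt0// ln_gt0// ltr1n. Qed.

Definition dyadic_const a : R := 2 `^ a / (2 `^ a - 1).

(** The bounds form a geometric progression that stops at the last j with 2^j s < rho, whose term is
    at most (rho / s)^a. [dyadic_const] bounds the ratio of a geometric sum to its last term. *)
Lemma dyadic_sum_le a s rho (f : nat -> R) l k : 0 < a -> 0 < s -> 0 < rho ->
  (forall j, f j <= if 2 ^+ j * s < rho then (2 ^+ j) `^ a else 0) ->
  \sum_(l <= j < k) f j <= dyadic_const a * (rho / s) `^ a.
Proof.
move=> a0 s0 rho0 hf; set X : R := 2 `^ a.
have X1 : 1 < X := powR2_gt1 a0.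
have X10 : 0 < X - 1 by rewrite subr_gt0.
have X0 : 0 < X by rewrite (lt_trans _ X1).
have geom i : \sum_(l <= j < i) f j <= X ^+ i / (X - 1).
  elim: i => [|i IH]; first by rewrite big_geq// expr0 divr_ge0 ?ler01// ltW.
  have [li|li] := leqP l i; last by rewrite big_geq// divr_ge0 ?exprn_ge0 ?(ltW X0) ?(ltW X10).
  rewrite big_nat_recr//=; apply: (@le_trans _ _ (X ^+ i / (X - 1) + X ^+ i)).
    apply: lerD => //; apply: le_trans (hf i) _; rewrite -pow2_powR.
    by case: ifP => // _; exact: powR_ge0.
  rewrite le_eqVlt; apply/orP; left; apply/eqP; rewrite exprS.
  by field; rewrite gt_eqF.
have C0 : 0 <= dyadic_const a by rewrite divr_ge0 ?(ltW X0) ?(ltW X10).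
elim: k => [|k IH]; first by rewrite big_geq// mulr_ge0// powR_ge0.
have [lk|lk] := leqP l k; last by rewrite big_geq// mulr_ge0// powR_ge0.
have := hf k; case: ifPn => [ks _|_ fk].
  apply: le_trans (geom _) _; rewrite /dyadic_const exprS mulrAC ler_wpM2l//.
  rewrite -pow2_powR; apply: (ge0_ler_powR (ltW a0)); rewrite ?nnegrE ?exprn_ge0 ?divr_ge0 ?(ltW s0) ?(ltW rho0)//.
  by rewrite ler_pdivlMr// ltW.
by rewrite big_nat_recr//= -[leRHS]addr0 lerD.
Qed.

Lemma dyadic_sum_eq0 s rho (f : nat -> R) l k : 0 < s ->
  (forall j, rho <= 2 ^+ j * s -> f j = 0) -> rho <= 2 ^+ l * s ->
  \sum_(l <= j < k) f j = 0.
Proof.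
move=> s0 hf hl; rewrite big_nat big1// => j /andP[lj _]; apply: hf.
by apply: le_trans hl _; rewrite ler_pM2r// ler_weXn2l// ler1n.
Qed.

(** The reflected plateau: equal to [ramp 1] for y <= 1 and to 0 for y >= 3. *)
Definition cutoff (y : R) : R := plateau 1 (- 1) (- y).

Lemma cutoff_ge0 y : 0 <= cutoff y. Proof. exact: ramp_ge0. Qed.

Lemma ramp1_gt0 : 0 < ramp (1 : R).
Proof. by rewrite /ramp /flat ltr01 mul1r expr0 mul1r expR_gt0. Qed.

Lemma cutoff_le1 y : cutoff y <= 1.
Proof.
apply: (@le_trans _ _ (ramp 1)); first by apply: ramp_nd; rewrite gerBl ramp_ge0.
by rewrite /ramp /flat ltr01 mul1r expr0 mul1r expR_le1 invr1 lerN10.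
Qed.

Lemma cutoff_max y : y <= 1 -> cutoff y = ramp 1.
Proof. by move=> y1; rewrite /cutoff plateau_max// lerN2. Qed.

Lemma cutoff_eq0 y : 3 <= y -> cutoff y = 0.
Proof. by move=> y3; rewrite /cutoff plateau_le0//; lra. Qed.

Definition dcutoff (y : R) : R := - dplateau 1 (- 1) (- y).

Lemma normr_dcutoff y : `|dcutoff y| <= 1.
Proof. by have /andP[h0 h1] := dplateau_le 1 (- 1) (- y); rewrite normrN ger0_norm. Qed.

Lemma dcutoff_eq0 y : 3 <= y -> dcutoff y = 0.
Proof. by move=> y3; rewrite /dcutoff dplateau_eq0 ?oppr0//; left; lra. Qed.

Lemma is_derive_cutoff (t y : R) : is_derive y (1:R) (fun z => cutoff (t * z)) (t * dcutoff (t * y)).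
Proof.
have d1 : is_derive y (1:R) (fun z : R => - (t * z)) (- t).
  have -> : (fun z : R => - (t * z)) = (- t) \*: id by apply/funext => z; rewrite /= -mulNr.
  by have := @is_deriveZ _ _ _ id (- t) y 1 1 (is_derive_id _ _); rewrite /GRing.scale /= mulr1.
have := @is_derive_comp_fun R R (fun z => - (t * z)) (plateau 1 (- 1)) y 1 _ _ (is_derive_plateau _ _ _) d1.
by have -> : t * dcutoff (t * y) = dplateau 1 (- 1) (- (t * y)) * - t by rewrite /dcutoff mulrN mulrN mulrC.
Qed.

Lemma Cn1_cutoff k : Cn1 k setT cutoff.
Proof.
have := Cn_comp (U := setT) (f := fun y : R => 0 + - 1 * y) openT (W := setT) (fun _ _ => I) (Cn1_plateau k 1 (- 1)) (Cn1_affine k 0 (- 1)).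
by apply: Cn_ext; [exact: openT|move=> y _ /=; rewrite add0r mulN1r].
Qed.

End dyadic.

Section singular_function.
Context {R : realType} {n : nat}.
Notation mu := (@lebesgue_measure R).
Notation N := n.+1.
Notation lam := (@lebesgue_rV R N).
Variables (p : R) (r : \bar R).
Hypotheses (p1 : 1 < p) (pN : p < N%:R) (r0 : (0 < r)%E).
Variables (sig rho : R).
Hypotheses (sig0 : 0 < sig) (sigN : sig < (N%:R - p) / p).
Hypotheses (rho0 : 0 < rho) (rhor : (rho%:E < r)%E).
Let m : R := N%:R.
Let p0 : 0 < p. Proof. by rewrite (lt_trans _ p1). Qed.
(** Normalised so that theta_j s^2 = 3 (2^j s / rho)^2: the j-th cutoff vanishes once 2^j s >= rho
    and is still maximal when 2^j s <= rho / 2. *)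
Let theta (j : nat) : R := 3 / rho ^+ 2 * 4 ^+ j.

Let theta0 j : 0 < theta j.
Proof. by rewrite mulr_gt0 ?exprn_gt0// divr_gt0// exprn_gt0. Qed.

Let pow4 j : (4 : R) ^+ j = (2 ^+ j) ^+ 2.
Proof. by rewrite exprAC; congr (_ ^+ _); ring. Qed.

Let thetaE j s : theta j * s ^+ 2 = 3 * (2 ^+ j * s / rho) ^+ 2.
Proof. by rewrite /theta pow4 expr_div_n exprMn; field; rewrite gt_eqF. Qed.

(** At t = s^2 this imitates (rho / s)^sig down to the scale rho / 2^k. Being a finite sum of
    cutoffs, it is constant near 0. *)
Definition cutoff_sum (k : nat) (t : R) : R :=
  \sum_(0 <= j < k) (2 ^+ j) `^ sig * cutoff (theta j * t).

Let dcutoff_sum (k : nat) (t : R) : R :=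
  \sum_(0 <= j < k) (2 ^+ j) `^ sig * (theta j * dcutoff (theta j * t)).

Let theta_ge3 j s : 0 < s -> rho <= 2 ^+ j * s -> 3 <= theta j * s ^+ 2.
Proof.
move=> s0 h; rewrite thetaE.
have h1 : 1 <= 2 ^+ j * s / rho by rewrite ler_pdivlMr// mul1r.
by nra.
Qed.

Let theta_le1 j s : 0 < s -> 2 ^+ j * s <= rho / 2 -> theta j * s ^+ 2 <= 1.
Proof.
move=> s0 h; rewrite thetaE.
have h1 : 2 ^+ j * s / rho <= 2^-1 by rewrite ler_pdivrMr// [leRHS]mulrC.
have h2 : 0 <= 2 ^+ j * s / rho by apply: divr_ge0 (ltW rho0); apply: mulr_ge0 (ltW s0); exact: exprn_ge0.
by nra.
Qed.

Let is_derive_cutoff_sum k (t : R) : is_derive t (1:R) (cutoff_sum k) (dcutoff_sum k t).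
Proof.
elim: k => [|k IH].
  rewrite /dcutoff_sum big_geq//.
  have -> : cutoff_sum 0 = cst 0 by apply/funext => z; rewrite /cutoff_sum big_geq.
  exact: is_derive_cst.
have -> : cutoff_sum k.+1 = cutoff_sum k + ((2 ^+ k) `^ sig \*: (fun z => cutoff (theta k * z))).
  by apply/funext => z; rewrite /cutoff_sum big_nat_recr.
have -> : dcutoff_sum k.+1 t = dcutoff_sum k t + (2 ^+ k) `^ sig *: (theta k * dcutoff (theta k * t)).
  by rewrite /dcutoff_sum big_nat_recr.
exact: (is_deriveD IH (is_deriveZ _ (is_derive_cutoff (theta k) t))).
Qed.

Let Cn1_cutoff_sum i k : Cn1 i setT (cutoff_sum k).
Proof.
apply: (Cn_sum _ openT) => j; apply: (Cn_scale _ openT).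
have := Cn_comp (U := setT) (f := fun y : R => 0 + theta j * y) openT (W := setT) (fun _ _ => I) (Cn1_cutoff i) (Cn1_affine i 0 (theta j)).
by apply: Cn_ext; [exact: openT|move=> y _ /=; rewrite add0r].
Qed.

Let measurable_cutoff_sum k : measurable_fun setT (cutoff_sum k).
Proof. by apply: continuous_measurable_fun => z; exact: (Cn_continuous (Cn1_cutoff_sum 0 k)). Qed.

Let phi k (x : 'rV[R]_N) : R := cutoff_sum k (enorm x ^+ 2).

Let test_phi k : test_fun r (phi k).
Proof.
apply: (@test_fun_radial _ _ r (cutoff_sum k) (theta k)^-1 rho) => //.
- by move=> i; apply: Cn_sub (Cn1_cutoff_sum i k).
- by rewrite invr_gt0.
- move=> t tk; apply: eq_big_nat => j /andP[_ jk]; rewrite mulr0 !cutoff_max ?ler01//.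
  have [t0|t0] := leP t 0; first by apply: le_trans ler01; rewrite pmulr_rle0.
  apply: (@le_trans _ _ (theta k * t)); last by rewrite mulrC -ler_pdivlMr// mul1r ltW.
  rewrite ler_pM2r// /theta ler_pM2l ?divr_gt0 ?exprn_gt0//.
  by apply: ler_weXn2l; rewrite ?ler1n// ltnW.
- exact: ltW.
- move=> t rt; have t0 : 0 < t by apply: lt_le_trans rt; rewrite exprn_gt0.
  have st : 0 < Num.sqrt t by rewrite sqrtr_gt0.
  rewrite /cutoff_sum big1// => j _; rewrite cutoff_eq0 ?mulr0//.
  rewrite -(sqr_sqrtr (ltW t0)); apply: theta_ge3 => //.
  apply: (@le_trans _ _ (Num.sqrt t)).
    by rewrite -[leLHS](ger0_norm (ltW rho0)) -sqrtr_sqr (ler_sqrt _ (ltW t0)).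
  by rewrite ler_peMl ?(ltW st)// exprn_ege1// ler1n.
Qed.

Let diff_bound l k s : 0 < s -> (l <= k)%N ->
  0 <= cutoff_sum k (s ^+ 2) - cutoff_sum l (s ^+ 2) <=
  dyadic_const sig * (rho / s) `^ sig.
Proof.
move=> s0 lk; rewrite /cutoff_sum (@big_cat_nat _ _ _ l 0 k)//= addrAC subrr add0r.
apply/andP; split; first by apply: sumr_ge0 => j _; rewrite mulr_ge0 ?powR_ge0 ?cutoff_ge0.
apply: dyadic_sum_le => // j; case: ifPn => [_|].
  by rewrite -[leRHS]mulr1 ler_wpM2l ?powR_ge0// cutoff_le1.
by rewrite -leNgt => h; rewrite cutoff_eq0 ?mulr0// theta_ge3.
Qed.

Let diff_eq0 l k s : 0 < s -> (l <= k)%N -> rho <= 2 ^+ l * s ->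
  cutoff_sum k (s ^+ 2) = cutoff_sum l (s ^+ 2).
Proof.
move=> s0 lk h; apply/eqP; rewrite -subr_eq0 /cutoff_sum (@big_cat_nat _ _ _ l 0 k)//= addrAC subrr add0r.
rewrite (@dyadic_sum_eq0 _ s rho)// => j hj.
by rewrite cutoff_eq0 ?mulr0// theta_ge3.
Qed.

(** Each derivative carries a factor theta_j of order 4^j, so the dyadic sum has exponent sig + 2,
    and the factor s brings the bound back to s^(-sig-1). The 6 combines the 2 from the gradient of
    |x|^2 with the 3 in [theta]. *)
Let ddiff_bound l k s : 0 < s -> (l <= k)%N ->
  `|2 * (dcutoff_sum k (s ^+ 2) - dcutoff_sum l (s ^+ 2))| * s <=
  6 * dyadic_const (sig + 2) * rho `^ sig * s `^ (- sig - 1).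
Proof.
move=> s0 lk; rewrite /dcutoff_sum (@big_cat_nat _ _ _ l 0 k)//= addrAC subrr add0r.
have a0 : 0 < sig + 2 by rewrite addr_gt0.
have H : \sum_(l <= j < k) `|(2 ^+ j) `^ sig * (4 ^+ j * dcutoff (theta j * s ^+ 2))| <=
    dyadic_const (sig + 2) * (rho / s) `^ (sig + 2).
  apply: dyadic_sum_le => // j; case: ifPn => [_|].
    have p2 : (0 : R) < 2 ^+ j by rewrite exprn_gt0.
    rewrite powRD ?(gt_eqF p2) ?implybT// !normrM (ger0_norm (powR_ge0 _ _)) ler_wpM2l ?powR_ge0//.
    rewrite powR_mulrn ?(ltW p2)// -pow4 ger0_norm ?exprn_ge0//.
    by rewrite -[leRHS]mulr1 ler_wpM2l ?exprn_ge0// normr_dcutoff.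
  by rewrite -leNgt => h; rewrite dcutoff_eq0 ?mulr0 ?normr0// theta_ge3.
have -> : \sum_(l <= j < k) (2 ^+ j) `^ sig * (theta j * dcutoff (theta j * s ^+ 2)) =
    3 / rho ^+ 2 * \sum_(l <= j < k) (2 ^+ j) `^ sig * (4 ^+ j * dcutoff (theta j * s ^+ 2)).
  by rewrite big_distrr/=; apply: eq_bigr => j _; rewrite {1}/theta; ring.
set S := \sum_(l <= j < k) _ in H *; set S' := \sum_(l <= j < k) _.
have SS : `|S'| <= S by exact: ler_norm_sum.
have c0 : 0 < 3 / rho ^+ 2 by rewrite divr_gt0// exprn_gt0.
rewrite normrM (ger0_norm (ler0n _ _)) normrM (gtr0_norm c0).
apply: (@le_trans _ _ (2 * (3 / rho ^+ 2 * (dyadic_const (sig + 2) * (rho / s) `^ (sig + 2))) * s)).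
  rewrite ler_pM2r// ler_pM2l// (ler_pM2l c0).
  exact: le_trans SS H.
rewrite le_eqVlt; apply/orP; left; apply/eqP.
have s0' : s != 0 by rewrite gt_eqF.
have rho0' : rho != 0 by rewrite gt_eqF.
have -> : (rho / s) `^ (sig + 2) = rho `^ sig * rho ^+ 2 * (s `^ (- sig - 1) / s).
  rewrite powR_div ?(ltW rho0) ?(ltW s0)// powRD ?rho0' ?implybT// powR_mulrn ?(ltW rho0)//; congr (_ * _).
  rewrite -powRN -(powR_inv1 (ltW s0)) -powRD ?s0' ?implybT//; congr (_ `^ _); ring.
by field; rewrite s0'.
Qed.

Let ddiff_eq0 l k s : 0 < s -> (l <= k)%N -> rho <= 2 ^+ l * s ->
  dcutoff_sum k (s ^+ 2) = dcutoff_sum l (s ^+ 2).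
Proof.
move=> s0 lk h; apply/eqP; rewrite -subr_eq0 /dcutoff_sum (@big_cat_nat _ _ _ l 0 k)//= addrAC subrr add0r.
rewrite (@dyadic_sum_eq0 _ s rho)// => j hj.
by rewrite dcutoff_eq0 ?mulr0// theta_ge3.
Qed.

Let truncated k (s : R) : R := if 0 < s then cutoff_sum k (s ^+ 2) else 0.

(** For each s > 0 the sequence is eventually constant, so the limit is a finite sum whose length
    depends on s. *)
Definition singular (s : R) : R := limn (truncated ^~ s).

Let cvg_truncated K s : 0 < s -> rho <= 2 ^+ K * s ->
  truncated k s @[k --> \oo] --> cutoff_sum K (s ^+ 2).
Proof.
move=> s0 h; apply: cvg_near_cst; exists K => // k /= Kk.
by rewrite /truncated s0 (diff_eq0 s0 Kk h).
Qed.

Let stageP s : 0 < s -> exists K0, forall K, (K0 <= K)%N -> rho <= 2 ^+ K * s.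
Proof.
move=> s0; have [K0 hK] := pow2_large (rho / s); exists K0 => K /hK.
by rewrite ler_pdivrMr.
Qed.

Let singularE K s : 0 < s -> rho <= 2 ^+ K * s -> singular s = cutoff_sum K (s ^+ 2).
Proof. by move=> s0 h; apply/cvg_lim => //; exact: cvg_truncated. Qed.

Lemma measurable_singular : measurable_fun setT singular.
Proof.
apply: (@measurable_fun_cvg _ _ _ _ truncated) => [k|s _].
  apply: measurable_fun_ifT => //; first exact: measurable_fun_ltr.
  exact: (measurableT_comp (measurable_cutoff_sum k) (measurable_funX 2 (@measurable_id _ _ _))).
have [s0|s0] := boolP (0 < s).
  have [K hK] := stageP s0; rewrite (singularE s0 (hK K (leqnn K))).
  exact: cvg_truncated s0 (hK K (leqnn K)).
have H : truncated ^~ s = fun=> 0 by apply/funext => k; rewrite /truncated (negbTE s0).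
by rewrite /singular H lim_cst//; exact: cvg_cst.
Qed.

(** Such a function lives on |x| < rho / 2^l, where the a-th power of its norm is at most W (rho /
    2^l)^(m - k a), uniformly in [f]. This gives both the Cauchy property of the gradients and the
    convergence in the Sobolev exponent. *)
Let ball_norm_dyadic_le (a k D e : R) : 0 < a -> 0 <= D -> k * a < m -> 0 < e ->
  exists l, forall f : 'rV[R]_N -> R, measurable_fun (eball r) f ->
    (forall x, 0 < enorm x -> rho <= 2 ^+ l * enorm x -> f x = 0) ->
    (forall x, 0 < enorm x -> `|f x| <= D * enorm x `^ (- k)) ->
    (ball_norm r a f <= e%:E)%E.
Proof.
move=> a0 D0 kam e0; pose ka := m - k * a.
have ka0 : 0 < ka by rewrite subr_gt0.
have om0 : 0 < omega m by apply: omega_gt0; rewrite ltr0n.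
pose W := omega m * (D `^ a / ka).
have W0 : 0 <= W by rewrite mulr_ge0 ?(ltW om0)// divr_ge0 ?powR_ge0 ?(ltW ka0).
have W10 : 0 < W + 1 by rewrite ltr_wpDl.
(* Chosen so that W eps^(m - k a) <= e^a, with W + 1 to keep the denominator positive when W = 0. *)
pose eps := (e `^ a / (W + 1)) `^ ka^-1.
have eps0 : 0 < eps by rewrite powR_gt0// divr_gt0// powR_gt0.
have [l0 hl] := pow2_large (rho / eps); exists l0 => f mf fv fb.
have p2 : (0 : R) < 2 ^+ l0 by rewrite exprn_gt0.
pose y := rho / 2 ^+ l0.
have y0 : 0 < y by rewrite divr_gt0.
have yeps : y <= eps.
  by have := hl l0 (leqnn _); rewrite /y !ler_pdivrMr// mulrC.
pose I : set R := `]0, y]%classic.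
have mI : measurable I by exact: measurable_itv.
apply: (@ball_norm_radial_le _ _ r a e f (fun s => D * s `^ (- k) * \1_I s)) => //.
- exact: ltW.
- apply: measurable_funM; last by apply: measurable_indic; exact: mI.
  by apply: measurable_funM => //; exact: measurable_powR.
- by move=> s; apply: mulr_ge0; [apply: mulr_ge0 => //; exact: powR_ge0|rewrite indicE].
- move=> x x0; rewrite indicE; have [xI|xI] := boolP (enorm x \in I); first by rewrite mulr1 fb.
  rewrite mulr0 fv ?normr0// leNgt; apply: contra xI => h.
  by rewrite inE /I /= in_itv/= x0 /y ler_pdivlMr// mulrC ltW.
have I0 : I `<=` `]0, +oo[%classic by move=> s /=; rewrite !in_itv/= andbT => /andP[].
rewrite (integral_radial_power _ a0 D0 mI I0).
have -> : N%:R - 1 + - k * a = ka - 1 by rewrite /ka mulNr addrAC.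
apply: (@le_trans _ _ ((omega m)%:E * ((D `^ a)%:E * (y `^ ka / ka)%:E))%E).
  apply: lee_wpmul2l; first by rewrite lee_fin ltW.
  apply: lee_wpmul2l; first by rewrite lee_fin powR_ge0.
  exact: le_integral_powR0.
have -> : ((omega m)%:E * ((D `^ a)%:E * (y `^ ka / ka)%:E) = (W * y `^ ka)%:E)%E.
  by rewrite -!EFinM /W; congr (_%:E); move: (omega m) (D `^ a) (y `^ ka) => *; ring.
rewrite lee_fin; apply: (@le_trans _ _ (W * (e `^ a / (W + 1)))).
  apply: ler_wpM2l => //; apply: (@le_trans _ _ (eps `^ ka)).
    by apply: (ge0_ler_powR (ltW ka0)); rewrite ?nnegrE ?(ltW y0) ?(ltW eps0).
  rewrite /eps -powRrM mulVf ?gt_eqF// powRr1// divr_ge0 ?powR_ge0//.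
  exact: ltW.
rewrite mulrCA -[leRHS]mulr1; apply: ler_wpM2l; first exact: powR_ge0.
by rewrite ler_pdivrMr// mul1r lerDl.
Qed.

Let u (x : 'rV[R]_N) : R := singular (enorm x).

Let measurable_u : measurable_fun setT u.
Proof. exact: (measurableT_comp measurable_singular (@measurable_enorm R N)). Qed.

Let grad_phi k x : grad (phi k) x = (2 * dcutoff_sum k (enorm x ^+ 2)) *: x.
Proof. exact: (grad_radial (is_derive_cutoff_sum k _)). Qed.

Let D1 : R := 6 * dyadic_const (sig + 2) * rho `^ sig.

Let dyadic_const_ge0 a : 0 < a -> 0 <= dyadic_const a :> R.
Proof.
move=> a0; rewrite divr_ge0 ?powR_ge0// subr_ge0.
exact: ltW (powR2_gt1 a0).
Qed.

Let grad_bound l k x : 0 < enorm x ->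
  enorm (grad (phi k) x - grad (phi l) x) <= D1 * enorm x `^ (- (sig + 1)).
Proof.
move=> x0; wlog lk : l k / (l <= k)%N.
  move=> H; have [lk|/ltnW kl] := leqP l k; first exact: H.
  by rewrite -enormN opprB; exact: H.
rewrite !grad_phi -scalerBl enormZ -mulrBr opprD; exact: ddiff_bound.
Qed.

Let grad_vanish l0 l k x : 0 < enorm x -> (l0 <= l)%N -> (l0 <= k)%N ->
  rho <= 2 ^+ l0 * enorm x -> enorm (grad (phi k) x - grad (phi l) x) = 0.
Proof.
move=> x0 ll lk h; rewrite !grad_phi (ddiff_eq0 x0 ll h) (ddiff_eq0 x0 lk h).
by rewrite subrr enorm0.
Qed.

(** The two integrability conditions, (sig + 1) p < N for the gradients and sig p^* < N for the
    functions, both say sig < (N - p) / p. *)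
Lemma singular_dotW0_rad : dotW0_rad p r u.
Proof.
have sphi k : smooth (phi k) by case: (test_phi k).
split; last by exists singular; [exact: measurable_singular|exact: aeW].
split; first exact: measurable_funTS.
have mp0 : 0 < m - p by rewrite subr_gt0.
have sigp : sig * p < m - p by rewrite -ltr_pdivlMr.
exists phi; split => // [e e0|].
  have D10 : 0 <= D1.
    by apply: mulr_ge0 (powR_ge0 _ _); apply: mulr_ge0 => //; apply: dyadic_const_ge0; rewrite addr_gt0.
  have kp : (sig + 1) * p < m by rewrite mulrDl mul1r -ltrBrDr.
  have [l0 hl] := ball_norm_dyadic_le p0 D10 kp e0; exists l0 => k l kk ll.
  apply: hl => [|x x0 h|x x0].
  - apply: measurable_funTS; apply: (measurableT_comp (@measurable_enorm R N)).
    exact: measurable_gradB.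
  - exact: grad_vanish h.
  - by rewrite ger0_norm ?enorm_ge0//; exact: grad_bound.
have ps0 := @sobolev_exponent_gt0 R n p p1 pN.
apply: cvge0_le => [k|e e0]; first exact: ball_norm_ge0.
have D20 : 0 <= dyadic_const sig * rho `^ sig.
  by apply: mulr_ge0 (powR_ge0 _ _); exact: dyadic_const_ge0.
have kp : sig * @sobolev_exponent R N p < m.
  rewrite /sobolev_exponent mulrA ltr_pdivrMr// mulrA [sig * _]mulrC -mulrA.
  by rewrite ltr_pM2l// ltr0n.
have [l0 hl] := ball_norm_dyadic_le ps0 D20 kp e0; exists l0 => k kk.
have hk (x : 'rV[R]_N) : 0 < enorm x -> rho <= 2 ^+ l0 * enorm x -> rho <= 2 ^+ k * enorm x.
  by move=> x0 h; apply: le_trans h _; rewrite ler_pM2r// ler_weXn2l// ler1n.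
apply: hl => [|x x0 h|x x0].
- apply: measurable_funTS; apply: measurable_funB => //.
  by apply: continuous_measurable_rV; exact: smooth_continuous.
- by rewrite /u (singularE x0 (hk _ x0 h)) subrr.
have [K0 hK] := stageP x0.
rewrite /u (singularE x0 (hK (maxn K0 k) (leq_maxl _ _))) /phi distrC.
have /andP[h0 h1] := diff_bound x0 (leq_maxr K0 k).
rewrite ger0_norm//; apply: le_trans h1 _.
rewrite powR_div ?(ltW rho0) ?(ltW x0)// powRN mulrA; exact: lexx.
Qed.

(** All terms are nonnegative, and the j-th one alone is still at its maximum. *)
Lemma singular_ge j s : 0 < s -> 2 ^+ j * s <= rho / 2 -> (2 ^+ j) `^ sig * ramp 1 <= singular s.
Proof.
move=> s0 h; have [K0 hK] := stageP s0.
rewrite (singularE s0 (hK (maxn K0 j.+1) (leq_maxl _ _))).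
have jK : (j < maxn K0 j.+1)%N := leq_maxr K0 j.+1.
have f0 i : 0 <= (2 ^+ i) `^ sig * cutoff (theta i * s ^+ 2) by rewrite mulr_ge0 ?powR_ge0 ?cutoff_ge0.
rewrite /cutoff_sum (big_cat_nat (leq0n j) (ltnW jK)) /= (big_ltn jK) (cutoff_max (theta_le1 s0 h)).
rewrite addrCA lerDl addr_ge0//; exact: sumr_ge0.
Qed.

End singular_function.

Lemma exp_integral_singular {R : realType} {n : nat} (p : R) (r : \bar R) (gamma : R) :
  1 < p -> p < n.+1%:R -> (0 < r)%E -> conj_exp p < gamma ->
  exists u : 'rV[R]_n.+1 -> R, dotW0_rad p r u /\ exp_integral p r gamma 1 u = +oo%E.
Proof.
move=> p1 pN r0 qg; pose m : R := n.+1%:R.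
pose b := (m - p) / (p - 1).
pose c := omega p / omega m.
pose A := (p - 1) / (m - p) * p * c `^ (p - 1)^-1.
pose rb := neg_pow r (- b).
have p0 : 0 < p by rewrite (lt_trans _ p1).
have p10 : 0 < p - 1 by rewrite subr_gt0.
have mp0 : 0 < m - p by rewrite subr_gt0.
have b0 : 0 < b by rewrite divr_gt0.
have omp0 : 0 < omega p by exact: omega_gt0.
have omm0 : 0 < omega m by apply: omega_gt0; rewrite ltr0n.
have c0 : 0 < c by rewrite divr_gt0.
have A0 : 0 < A by rewrite mulr_gt0 ?powR_gt0// mulr_gt0// divr_gt0.
have q0 : 0 < conj_exp p by rewrite (lt_trans _ (conj_exp_gt1 p1)).
have g0 : 0 < gamma by rewrite (lt_trans q0).
have bg : b / gamma < (m - p) / p.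
  have -> : (m - p) / p = b / conj_exp p.
    rewrite /b /conj_exp; move: (m - p) => z; field.
    by rewrite !gt_eqF.
  by rewrite ltr_pM2l// ltf_pV2.
have [rho rho0 rhor] := radius_lt r0.
pose sig := (b / gamma + (m - p) / p) / 2.
have sigN : sig < (m - p) / p by rewrite /sig; move: bg; set x := b / gamma; set y := (m - p) / p; lra.
have sigb : b / gamma < sig by rewrite /sig; move: bg; set x := b / gamma; set y := (m - p) / p; lra.
have bg0 : 0 < b / gamma by rewrite divr_gt0.
have sig0 : 0 < sig by rewrite (lt_trans bg0).
pose u (x : 'rV[R]_n.+1) := singular sig rho (enorm x).
have du : dotW0_rad p r u by exact: singular_dotW0_rad.
exists u; split => //; apply/eqP; rewrite -leye_eq leNgt; apply/negP => ufin.
have msing := measurable_singular sig rho0.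
have mu_ : measurable_fun (eball r) u.
  by apply: measurable_funTS; exact: (measurableT_comp msing (@measurable_enorm R n.+1)).
(* Where s^(-b) is of the order of z_j = 2^(j b), the power |u|^gamma is at least of order z_j^tau
   while T is of order z_j. The choice sig > b / gamma means tau > 1. *)
pose tau := sig * gamma / b.
have tau1 : 0 < tau - 1.
  by rewrite subr_gt0 /tau ltr_pdivlMr// mul1r -ltr_pdivrMr.
pose e1 := ramp 1 `^ gamma.
have e10 : 0 < e1 by rewrite powR_gt0// ramp1_gt0.
pose d0 := (rho / 2) `^ (- b).
have d00 : 0 < d0 by rewrite powR_gt0// divr_gt0.
pose D := omega m * c `^ conj_exp p / b.
have D0 : 0 < D by rewrite divr_gt0// mulr_gt0// powR_gt0.
pose z j : R := (2 ^+ j) `^ b.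
have z0 j : 0 < z j by rewrite powR_gt0// exprn_gt0.
have lb j : ((D * expR (e1 * z j `^ tau - A * (d0 * z j + 1 - rb)))%:E <= exp_integral p r gamma 1 u)%E.
  have w0 : (0 : R) < 2 ^+ j by rewrite exprn_gt0.
  have w1 : (1 : R) <= 2 ^+ j by rewrite exprn_ege1// ler1n.
  pose s1 := rho / 2 / 2 ^+ j.
  have s10 : 0 < s1 by rewrite !divr_gt0.
  have s1E : s1 `^ (- b) = d0 * z j.
    by rewrite /s1 powR_div ?divr_ge0 ?(ltW rho0) ?(ltW w0)// [X in _ / X]powRN invrK.
  have s1r : s1 <= rho.
    rewrite /s1 ler_pdivrMr//; apply: (@le_trans _ _ rho); first by lra.
    by rewrite ler_peMr// ltW.
  have rbs : rb < d0 * z j.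
    have [_] := proj2 (ray_domE s1 p1 pN r0) (conj s10 (le_lt_trans (y := rho%:E) (x := s1%:E) s1r rhor)).
    by rewrite -s1E.
  have hE s : 0 < s -> d0 * z j <= s `^ (- b) -> e1 * z j `^ tau <= 1 * `|singular sig rho s| `^ gamma.
    move=> s0 hs; rewrite mul1r.
    have ss1 : s <= s1.
      have inv (x : R) : 0 < x -> (x `^ (- b)) `^ (- b^-1) = x.
        by move=> x0; rewrite -powRrM mulrNN mulfV ?gt_eqF// powRr1// ltW.
      rewrite -(inv s s0) -(inv s1 s10) s1E.
      by apply: ler_powRN => //; [rewrite oppr_le0 invr_ge0 ltW|rewrite mulr_gt0].
    have hw : 2 ^+ j * s <= rho / 2.
      by rewrite mulrC -ler_pdivlMr.
    have h := singular_ge sig rho0 s0 hw.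
    have -> : e1 * z j `^ tau = ((2 ^+ j) `^ sig * ramp 1) `^ gamma.
      rewrite powRM ?powR_ge0 ?ramp_ge0// mulrC /z -!powRrM; congr (_ `^ _ * _).
      by rewrite /tau mulrCA mulfV ?mulr1// gt_eqF.
    apply: (ge0_ler_powR (ltW g0)).
    - by rewrite nnegrE; apply: mulr_ge0; [exact: powR_ge0|exact: ramp_ge0].
    - by rewrite nnegrE.
    by apply: le_trans h _; exact: ler_norm.
  have := exp_integral_ge p1 pN r0 mu_ msing (aeW _ (fun x _ => erefl)) (mulr_gt0 d00 (z0 j)) rbs hE.
  apply: le_trans; rewrite lee_fin le_eqVlt; apply/orP; left; apply/eqP.
  rewrite -/m -/b -/rb -/c -/A /D.
  by move: (expR _) (omega m) (c `^ _) (b) => *; ring.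
have [t Tt] : exists t, exp_integral p r gamma 1 u = t%:E.
  have := lb 0%N; move: (exp_integral p r gamma 1 u) ufin => [t| |]//; first by exists t.
(* [Q] makes e1 z^(tau-1) at least A d0 + 1, so that the exponent is at least z - A (1 - rb). [B]
   makes this at least |t| / D, where t is the supposed finite value. *)
pose B := `|t| / D + A * `|1 - rb|.
have B0 : 0 <= B by apply: addr_ge0; [apply: divr_ge0 => //; exact: ltW|apply: mulr_ge0 => //; exact: ltW].
pose Q := ((A * d0 + 1) / e1) `^ (tau - 1)^-1.
have Qp : 0 < (A * d0 + 1) / e1 by rewrite divr_gt0// addr_gt0// mulr_gt0.
have Q0 : 0 < Q by rewrite powR_gt0.
have [j hj] := pow2_large ((B + Q) `^ b^-1).
have zj : B + Q <= z j.
  have BQ : 0 < B + Q by rewrite ltr_wpDl.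
  have -> : B + Q = ((B + Q) `^ b^-1) `^ b by rewrite -powRrM mulVf ?gt_eqF// powRr1// ltW.
  by apply: (ge0_ler_powR (ltW b0)); rewrite ?nnegrE ?powR_ge0 ?exprn_ge0//; exact: hj.
have zQ : (A * d0 + 1) / e1 <= z j `^ (tau - 1).
  have -> : (A * d0 + 1) / e1 = Q `^ (tau - 1).
    by rewrite /Q -powRrM mulVf ?gt_eqF// powRr1// ltW.
  apply: (ge0_ler_powR (ltW tau1)); rewrite ?nnegrE ?(ltW Q0) ?(ltW (z0 j))//.
  by apply: le_trans zj; rewrite lerDr.
have zt : z j `^ tau = z j * z j `^ (tau - 1).
  rewrite -{2}(powRr1 (ltW (z0 j))) -powRD; first by congr (_ `^ _); ring.
  by apply/implyP => _; rewrite gt_eqF.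
have main : `|t| / D <= e1 * z j `^ tau - A * (d0 * z j + 1 - rb).
  have h1 : A * d0 + 1 <= e1 * z j `^ (tau - 1) by rewrite [leRHS]mulrC -ler_pdivrMr.
  have h2 := ler_wpM2l (ltW (z0 j)) h1.
  have h3 : A * (1 - rb) <= A * `|1 - rb| by rewrite ler_pM2l// ler_norm.
  rewrite zt mulrCA; apply: le_trans (lerB h2 (lexx _)).
  have -> : z j * (A * d0 + 1) - A * (d0 * z j + 1 - rb) = z j - A * (1 - rb) by ring.
  by move: zj; rewrite /B => zj; lra.
have := lb j; rewrite Tt lee_fin leNgt => /negP; apply.
apply: (@lt_le_trans _ _ (D * (1 + `|t| / D))).
  rewrite mulrDr mulr1 [D * (_ / _)]mulrC divfK ?gt_eqF//.
  by apply: le_lt_trans (ler_norm t) _; rewrite ltrDr.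
rewrite ler_pM2l//; apply: le_trans (expR_ge1Dx _); lra.
Qed.

Theorem theorem2 (R : realType) (N : nat) (p : R) (r : \bar R)
    (hN : (2 <= N)%N) (hp1 : 1 < p) (hpN : p < N%:R) (hr : (0 < r)%E) :
  (forall gamma : R, 0 < gamma ->
    ((forall u : 'rV[R]_N -> R, dotW0_rad p r u ->
        forall alpha : R, 0 < alpha ->
          (exp_integral p r gamma alpha u < +oo)%E)
     <-> gamma <= conj_exp p)) /\
  (forall alpha : R, (T_rad N p r alpha < +oo)%E <-> alpha <= alpha_crit p).
Proof.
case: N hN hpN => [//|n] _ pN; split => [gamma g0|alpha]; split.
- move=> h; rewrite leNgt; apply/negP => qg.
  have [u [du uoo]] := exp_integral_singular hp1 pN hr qg.
  by have := h u du 1 ltr01; rewrite uoo ltxx.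
- by move=> gq u du alpha a0; exact: exp_integral_lty.
- by move=> h; rewrite leNgt; apply/negP => /(T_rad_pinfty hp1 pN hr) E; rewrite E ltxx in h.
- exact: T_rad_lty.
Qed.
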